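(* Let $N\ge 1$ be an integer, $s\in(0,1)$, $q\in(1,2)$, and let $\Omega\subset\mathbb{R}^N$ be a nonempty open set with $\lambda_1(\Omega,s,q)>0$. Then, up to a multiplicative constant, there exists a unique eigenfunction achieving the minimum in the definition of $\lambda_1(\Omega,s,q)$, the minimum being taken over $u\in\mathcal{D}^{s,2}_0(\Omega)$ with $\int_\Omega |u|^q\,dx=1$. The first eigenfunction has constant sign (that is, $u\ge0$ a.e. in $\Omega$ or $u\le0$ a.e. in $\Omega$), and $\lambda_1(\Omega,s,q)$ is the unique $q$-semilinear $s$-eigenvalue of $\Omega$ admitting eigenfunctions of constant sign.
   Context: For a function $u$ on $\mathbb{R}^N$ write $[u]^2=\int_{\mathbb{R}^N}\int_{\mathbb{R}^N}\frac{(u(x)-u(y))^2}{|x-y|^{N+2s}}\,dx\,dy$. Functions in $C_0^\infty(\Omega)$ (smooth, compactly supported in $\Omega$) are extended by $0$ to $\mathbb{R}^N\setminus\Omega$. $\mathcal{D}^{s,2}_0(\Omega)$ is the completion of $C_0^\infty(\Omega)$ with respect to the norm $[\cdot]$. $\lambda_1(\Omega,s,q)=\inf\{[\varphi]^2:\varphi\in C_0^\infty(\Omega),\ \int_\Omega|\varphi|^q\,dx=1\}$. When $\lambda_1(\Omega,s,q)>0$, $\mathcal{D}^{s,2}_0(\Omega)$ is identified with a space of functions continuously embedded in $L^q(\Omega)$, extended by $0$ outside $\Omega$. A number $\lambda>0$ is a $q$-semilinear $s$-eigenvalue of $\Omega$ (a constrained critical value of $[\cdot]^2$ along $\{u\in\mathcal{D}^{s,2}_0(\Omega):\int_\Omega|u|^q\,dx=1\}$)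 if there is a non-trivial $u\in\mathcal{D}^{s,2}_0(\Omega)$, called a corresponding eigenfunction, with $$\int_{\mathbb{R}^N}\int_{\mathbb{R}^N}\frac{(u(x)-u(y))(\varphi(x)-\varphi(y))}{|x-y|^{N+2s}}\,dx\,dy=\lambda\|u\|_{L^q(\Omega)}^{2-q}\int_\Omega|u|^{q-2}u\,\varphi\,dx\quad\text{for all }\varphi\in\mathcal{D}^{s,2}_0(\Omega).$$ A first eigenfunction is an eigenfunction corresponding to $\lambda=\lambda_1(\Omega,s,q)$. *)

(* Defs.v *)
From HB Require Import structures.
From mathcomp Require Import all_boot all_order all_algebra.
From mathcomp Require Import all_classical all_reals all_analysis.

Set Implicit Arguments.
Unset Strict Implicit.
Unset Printing Implicit Defensive.

Import Order.TTheory GRing.Theory Num.Theory.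
Import numFieldNormedType.Exports.

Local Open Scope classical_set_scope.
Local Open Scope ring_scope.

(* The library has no Lebesgue measure on R^n.  It is built here on 'rV[R]_n,
   with the sigma-algebra generated by the coordinates (that is, the Borel
   sets), as the n-fold product of the one-dimensional Lebesgue measure. *)

Definition measure_rV_display : measure_display.
Proof. exact: default_measure_display. Qed.

Section measurable_rV.
Context {R : realType} (n : nat).

Definition rV_coord (i : 'I_n) (x : 'rV[R]_n) : measurableTypeR R := x ord0 i.

Let rV_set0 : g_sigma_preimage rV_coord set0.
Proof. exact: sigma_algebra0. Qed.

Let rV_setC A : g_sigma_preimage rV_coord A ->
  g_sigma_preimage rV_coord (~` A).
Proof. exact: sigma_algebraC. Qed.

Let rV_bigcup (F : (set 'rV[R]_n)^nat) :
  (forall i, g_sigma_preimage rV_coord (F i)) ->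
  g_sigma_preimage rV_coord (\bigcup_i (F i)).
Proof. exact: sigma_algebra_bigcup. Qed.

HB.instance Definition _ := @isMeasurable.Build measure_rV_display
  'rV[R]_n (g_sigma_preimage rV_coord) rV_set0 rV_setC rV_bigcup.

Lemma measurable_rV_coord (i : 'I_n) : measurable_fun [set: 'rV[R]_n] (rV_coord i).
Proof.
move=> _ Y mY; rewrite setTI; apply: sub_sigma_algebra => /=.
rewrite -bigcup_seq/=; exists i => /=; first by rewrite mem_index_enum.
by exists Y => //; rewrite setTI.
Qed.

Lemma measurable_fun_rVP d (T : measurableType d) (f : T -> 'rV[R]_n) :
  (forall i, measurable_fun [set: T] (rV_coord i \o f)) ->
  measurable_fun [set: T] f.
Proof.
move=> mf _ A mA.
have sub : g_sigma_preimage (fun i => rV_coord i \o f) `<=` measurable.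
  apply: smallest_sub; first exact: sigma_algebra_measurable.
  by rewrite -bigcup_seq => B [i _ [C mC <-]]; exact: mf.
by apply: sub; rewrite g_sigma_preimage_comp; exists A.
Qed.

End measurable_rV.

Lemma sigma_finite_product d1 d2 (T1 : measurableType d1)
    (T2 : measurableType d2) (R : realType)
    (m1 : {sigma_finite_measure set T1 -> \bar R})
    (m2 : {sigma_finite_measure set T2 -> \bar R}) :
  sigma_finite setT (m1 \x m2)%E.
Proof.
have /sigma_finiteP[F [TF ndF Foo]] := sigma_finiteT m1.
have /sigma_finiteP[G [TG ndG Goo]] := sigma_finiteT m2.
exists (fun n => F n `*` G n) => [|k].
  rewrite -setXTT TF TG predeqE => -[x y]; split => [|[n _ []/= ? ?]].
    move=> [/= [n _ Fnx] [k _ Gky]]; exists (maxn n k) => //; split.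
    - by move: x Fnx; exact/subsetPset/ndF/leq_maxl.
    - by move: y Gky; exact/subsetPset/ndG/leq_maxr.
  by split; exists n.
have [? ?] := Foo k; have [? ?] := Goo k.
split; first exact: measurableX.
by rewrite product_measure1E// lte_mul_pinfty// ge0_fin_numE.
Qed.

Section lebesgue_rV.
Context {R : realType}.

Section cons.
Context (n : nat).

Definition rV_cons (p : measurableTypeR R * 'rV[R]_n) : 'rV[R]_(1 + n) :=
  row_mx (p.1 : R)%:M p.2.

Let rV_uncons (x : 'rV[R]_(1 + n)) : measurableTypeR R * 'rV[R]_n :=
  (lsubmx x ord0 ord0, rsubmx x).

Let rV_consK : cancel rV_cons rV_uncons.
Proof.
by case=> a v; rewrite /rV_cons /rV_uncons row_mxKl row_mxKr mxE eqxx mulr1n.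
Qed.

Let rV_unconsK : cancel rV_uncons rV_cons.
Proof.
move=> x; rewrite /rV_cons /rV_uncons /= -[RHS]hsubmxK; congr row_mx.
by apply/rowP => i; rewrite !ord1 !mxE eqxx mulr1n.
Qed.

Let measurable_rV_cons : measurable_fun setT rV_cons.
Proof.
apply: measurable_fun_rVP => i; case: (splitP i) => j ij.
- rewrite (_ : _ \o _ = fst)//; apply/funext => p /=.
  rewrite /rV_coord /rV_cons (_ : i = lshift n j) ?row_mxEl; last exact/val_inj.
  by rewrite !ord1 mxE eqxx mulr1n.
- rewrite (_ : _ \o _ = rV_coord j \o snd).
    by apply: measurableT_comp => //; exact: measurable_rV_coord.
  apply/funext => p /=; rewrite /rV_coord /rV_cons.
  by rewrite (_ : i = rshift 1 j) ?row_mxEr//; exact/val_inj.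
Qed.

Let measurable_rV_uncons : measurable_fun setT rV_uncons.
Proof.
apply: measurable_fun_pair => /=.
- rewrite (_ : (fun _ => _) = rV_coord (lshift n (ord0 : 'I_1))).
    exact: measurable_rV_coord.
  by apply/funext => x; rewrite mxE.
- apply: measurable_fun_rVP => i.
  rewrite (_ : _ \o _ = rV_coord (rshift 1 i)).
    exact: measurable_rV_coord.
  by apply/funext => x; rewrite /= /rV_coord mxE.
Qed.

Section lebesgue_rV_succ.
Local Open Scope ereal_scope.
Variable mu : {sigma_finite_measure set 'rV[R]_n -> \bar R}.

Definition lebesgue_rV_succ : set 'rV[R]_n.+1 -> \bar R :=
  pushforward (@lebesgue_measure R \x mu) rV_cons.

Let succ0 : lebesgue_rV_succ set0 = 0.
Proof. by rewrite /lebesgue_rV_succ /pushforward preimage_set0 measure0. Qed.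

Let succ_ge0 A : 0 <= lebesgue_rV_succ A.
Proof. exact: measure_ge0. Qed.

Let succ_sigma_additive : semi_sigma_additive lebesgue_rV_succ.
Proof.
move=> F mF tF mUF; rewrite /lebesgue_rV_succ /pushforward preimage_bigcup.
have mpre A : measurable A -> measurable (rV_cons @^-1` A).
  by move=> mA; rewrite -[X in measurable X]setTI; exact: measurable_rV_cons.
apply: measure_semi_sigma_additive.
- by move=> k; exact: mpre.
- apply/trivIsetP => /= i j _ _ ij; rewrite -preimage_setI.
  by move/trivIsetP : tF => /(_ _ _ _ _ ij) ->//; rewrite preimage_set0.
- by rewrite -preimage_bigcup; exact: mpre.
Qed.

HB.instance Definition _ := isMeasure.Build _ _ _ lebesgue_rV_succ
  succ0 succ_ge0 succ_sigma_additive.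

Let succ_sigma_finite : sigma_finite setT lebesgue_rV_succ.
Proof.
have [F FT Foo] := sigma_finite_product (@lebesgue_measure R) mu.
exists (fun k => rV_uncons @^-1` F k).
  by rewrite -preimage_bigcup -FT preimage_setT.
move=> k; have [mFk Fkoo] := Foo k; split.
  by rewrite -[X in measurable X]setTI; exact: measurable_rV_uncons.
rewrite /lebesgue_rV_succ /pushforward -comp_preimage.
by rewrite (_ : _ \o _ = id) ?preimage_id//; apply/funext => p; exact: rV_consK.
Qed.

HB.instance Definition _ := Measure_isSigmaFinite.Build _ _ _ lebesgue_rV_succ
  succ_sigma_finite.

End lebesgue_rV_succ.
End cons.

Fixpoint lebesgue_rV (n : nat) :
    {sigma_finite_measure set 'rV[R]_n -> \bar R} :=
  match n with
  | 0 => \d_(0 : 'rV[R]_0)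
  | n'.+1 => lebesgue_rV_succ (lebesgue_rV n')
  end.

End lebesgue_rV.

(* The norm of 'rV[R]_n in the library is the sup norm. *)
Definition euclid_norm (R : realType) (n : nat) (x : 'rV[R]_n) : R :=
  Num.sqrt (\sum_(i < n) x ord0 i ^+ 2).

Section test_functions.
Context {R : realType} {N : nat}.
Implicit Types (phi : 'rV[R]_N -> R) (Omega : set 'rV[R]_N).

Definition partial (i : 'I_N) phi : 'rV[R]_N -> R :=
  'D_(delta_mx ord0 i : 'rV[R]_N) phi.

Definition iter_partial (l : seq 'I_N) phi : 'rV[R]_N -> R :=
  foldr partial phi l.

Definition smooth phi : Prop := forall l : seq 'I_N,
  continuous (iter_partial l phi) /\
  forall (i : 'I_N) (x : 'rV[R]_N),
    derivable (iter_partial l phi) x (delta_mx ord0 i).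

Definition test_function Omega phi : Prop :=
  let supp := closure [set x | phi x != 0] in
  [/\ smooth phi, compact supp & supp `<=` Omega].

End test_functions.

Section semilinear_eigenvalues.
Context {R : realType} {N : nat}.
Variables (Omega : set 'rV[R]_N) (s q : R).
Implicit Types u v phi : 'rV[R]_N -> R.

Local Notation leb := (@lebesgue_rV R N).

(* On the diagonal the quotient is 0/0 = 0; the diagonal is a null set. *)
Definition gagliardo_form u v : \bar R :=
  \int[leb \x leb]_z
    ((u z.1 - u z.2) * (v z.1 - v z.2)
      / euclid_norm (z.1 - z.2) `^ (N%:R + 2 * s))%:E.

(* the square [u]^2 of the seminorm *)
Definition gagliardo2 u : \bar R :=
  \int[leb \x leb]_z
    ((u z.1 - u z.2) ^+ 2 / euclid_norm (z.1 - z.2) `^ (N%:R + 2 * s))%:E.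

(* the q-th power of the norm of L^q(Omega) *)
Definition Lq_mass u : \bar R := \int[leb]_(x in Omega) (`|u x| `^ q)%:E.

Definition Lq_norm u : \bar R := (Lq_mass u `^ q^-1)%E.

Definition lambda1 : \bar R :=
  ereal_inf [set gagliardo2 phi | phi in
    [set phi | test_function Omega phi /\ Lq_mass phi = 1%E]].

(* When lambda1 > 0, a Cauchy sequence of test functions for the seminorm,
   i.e. an element of the completion, is also Cauchy in L^q(Omega); it is
   identified with its limit there, extended by 0.  Elements are represented
   by Borel functions, and equality in the completion is equality almost
   everywhere. *)
Definition in_D u : Prop :=
  [/\ measurable_fun setT u,
      (forall x, ~ Omega x -> u x = 0) &
      exists phi : nat -> 'rV[R]_N -> R,
        [/\ forall k, test_function Omega (phi k),
            forall e : R, 0 < e -> exists k0, forall j k,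
              (k0 <= j)%N -> (k0 <= k)%N ->
              (gagliardo2 (phi j \- phi k)%R < e%:E)%E &
            Lq_mass (phi k \- u) @[k --> \oo] --> 0%E]].

Definition eigenfunction (lambda : R) u : Prop :=
  [/\ 0 < lambda, in_D u, ~ (\forall x \ae leb, u x = 0) &
      forall phi, in_D phi ->
        gagliardo_form u phi =
        (lambda%:E * Lq_norm u `^ (2 - q)
           * \int[leb]_(x in Omega) (`|u x| `^ (q - 2) * u x * phi x)%:E)%E].

Definition first_eigenfunction u : Prop := eigenfunction (fine lambda1) u.

Definition admissible u : Prop := in_D u /\ Lq_mass u = 1%E.

Definition minimizer u : Prop :=
  admissible u /\ forall v, admissible v -> (gagliardo2 u <= gagliardo2 v)%E.

Definition constant_sign u : Prop :=
  (\forall x \ae leb, Omega x -> 0 <= u x) \/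
  (\forall x \ae leb, Omega x -> u x <= 0).

End semilinear_eigenvalues.

(* Main.v *)
Require Import Defs.
From mathcomp Require Import all_boot all_order all_algebra.
From mathcomp Require Import all_classical all_reals all_analysis.
From mathcomp Require Import measurable_realfun ring lra.

Set Implicit Arguments.
Unset Strict Implicit.
Unset Printing Implicit Defensive.

Import Order.TTheory GRing.Theory Num.Theory.
Import numFieldNormedType.Exports.

Local Open Scope classical_set_scope.
Local Open Scope ring_scope.

(** Write [G u] for the squared seminorm, [M u] for the integral of [`|u| `^ q]
    over [Omega], and [l] for the first eigenvalue. By homogeneity the inequality
    [l * M u `^ (2 / q) <= G u] holds on the whole completion ([poincare]). Since
    [2 / q > 1], Bernoulli's inequality bounds the energy
    [J u = G u - (2 l / q) * M u] below by [l * (1 - 2 / q)], with equality exactly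
    when [M u = 1] and [G u = l] ([min_energy_le], [energy_minimizer]). The
    constrained minimization problem is thus equivalent to the free minimization
    of [J], and [J] has a lattice structure that the constraint hides: pair by
    pair, [J (max u v) + J (min u v) <= J u + J v] ([energy_submodular]), and
    [J `|u| <= J u].

    Existence needs no compact embedding. Take absolute values of test functions,
    with energies within [2^-n] of the minimum. By submodularity, maxima of
    stretches of this sequence have almost minimal energy as well, and their
    masses are bounded; choosing the stretches long enough gives an almost
    monotone sequence, which is Cauchy in [L^q]
    ([exists_monotone_minimizing_sequence]). The parallelogram identity turns
    this into the Cauchy property for the seminorm ([energy_midpoint]), and the
    limit minimizes [J] ([exists_energy_minimizer]).

    Uniqueness follows from the same structure. If [u] and [v] are nonnegative
    minimizers, so are [max u v] and [min u v]; all of them have mass one, hence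
    [u = v] almost everywhere ([nonneg_minimizer_unique]). If [u] is any
    minimizer, so is [`|u|], and equality of the seminorms forces [u x * u y >= 0]
    for almost every pair; as the pairs with [u x > 0 > u y] form a rectangle, [u]
    has constant sign ([minimizer_sign]). First eigenfunctions, normalized to mass
    one, are minimizers, as testing the equation with the eigenfunction itself
    shows; conversely minimizers solve the weak equation ([euler_lagrange]).

    Finally let [u >= 0] have mass one and solve the weak equation with eigenvalue
    [mu], so that [mu = G u >= l]. Testing with [phi^2 / (u + e)], for a test
    function [phi] of mass one, and using Picone's inequality gives
    [mu * int u^(q-1) phi^2 / (u + e) <= G phi]. As [e] tends to [0], the defect in
    Picone's inequality stays integrable only if [phi] vanishes almost everywhere
    on the zero set of [u], and Fatou's lemma gives
    [mu * int u^(q-2) phi^2 <= G phi]. Young's inequality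
    [`|phi|^q <= (q/2) u^(q-2) phi^2 + (1 - q/2) u^q] shows that the integral is at
    least one, whence [mu <= G phi] ([eigenvalue_le_gform]); the infimum over [phi]
    is [l], so [mu = l] ([nonneg_eigenvalue]).

    The groundwork consists of the finiteness of the seminorm on test functions
    ([test_function_gagliardo]), a description of the completion by approximation
    ([approximableP]), and its stability under the nonlinear maps used above
    ([approximable_abs], [approximable_ratio]), which follows from one dominated
    convergence argument ([approximable_lipschitz]). *)

(** * Borel sets and boxes *)

Section rV_measure.
Context {R : realType}.

Lemma measurable_rV_ball n (a : 'rV[R]_n) (r : R) : measurable (ball a r).
Proof.
have [r0|r0] := leP r 0.
  by rewrite (_ : ball a r = set0)//; apply/seteqP; split => // x [+ _]; rewrite ltNge r0.
have -> : ball a r =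
    \big[setI/setT]_(i < n) (rV_coord i @^-1` (ball (a ord0 i) r)).
  apply/seteqP; split => x /=.
    move=> [_ h]; rewrite -bigcap_seq => i /= _.
    exact: h.
  rewrite -bigcap_seq => h; split => // i j; rewrite (ord1 i).
  by apply: (h j) => /=; rewrite mem_index_enum.
apply: bigsetI_measurable => i _.
rewrite -[X in measurable X]setTI; apply: measurable_rV_coord => //.
by rewrite ball_itv; exact: measurable_itv.
Qed.

(** The sigma-algebra is generated by the coordinates, so opens have to be
    written as countable unions of products of intervals: balls of the sup norm
    with rational centre and radius [1/(k+1)] do. *)
Lemma open_measurable_rV n (A : set 'rV[R]_n) : open A -> measurable A.
Proof.
move=> oA.
pose cb (p : 'rV[rat]_n * nat) : set 'rV[R]_n :=
  ball (map_mx (@ratr R) p.1) (p.2.+1%:R^-1).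
pose F p := if pselect (cb p `<=` A) then cb p else set0.
have -> : A = \bigcup_p F p.
  apply/seteqP; split => x; last first.
    by move=> [p _]; rewrite /F; case: pselect => // s /s.
  move=> Ax; have /nbhs_ballP[e /= e0 eA] : nbhs x A by apply: open_nbhs_nbhs.
  have [k ke] : exists k, k.+1%:R^-1 < e / 2 :> R.
    have e20 : 0 < e / 2 by rewrite divr_gt0.
    exists (Num.truncn (e / 2)^-1); rewrite invf_plt ?posrE//.
    by rewrite truncnS_gt// invr_ge0 ltW.
  have k0 : (0 : R) < k.+1%:R^-1 by rewrite invr_gt0.
  have cx i : exists c : rat, `|ratr c - x ord0 i| < k.+1%:R^-1.
    have /rat_in_itvoo[c] : x ord0 i - k.+1%:R^-1 < x ord0 i + k.+1%:R^-1.
      by rewrite ltrD2l gtrN.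
    rewrite in_itv/= => /andP[c1 c2]; exists c.
    by rewrite ltr_norml ltrBrDl c1/= ltrBlDl.
  have [c cP] := choice cx.
  exists (\row_i c i, k) => //; rewrite /F.
  have cbx : cb (\row_i c i, k) x.
    split => // i j; rewrite (ord1 i) !mxE; exact: cP.
  case: pselect => // -[] y cy; apply: eA.
  apply: (@ball_split _ _ (map_mx (@ratr R) (\row_i c i))).
    by apply: ball_sym; apply: le_ball cbx; exact: ltW.
  by apply: le_ball cy; exact: ltW.
apply: countable_bigcupT_measurable => [|p]; first exact: countableP.
rewrite /F; case: pselect => ?; last exact: measurable0.
exact: (measurable_rV_ball (map_mx (@ratr R) p.1)).
Qed.

Lemma continuous_measurable_rV n (f : 'rV[R]_n -> R) :
  continuous f -> measurable_fun setT f.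
Proof.
move=> cf; apply: (measurability _ (RGenOpens.measurableE R)) => //.
move=> _ [_ [a [b ->]] <-]; rewrite setTI; apply: open_measurable_rV.
by apply: open_comp => // x _; exact: cf.
Qed.

(** Closed balls of the sup norm; unlike Euclidean balls they have an explicit
    measure and are exhausted coordinate by coordinate. *)
Definition rV_box n (a : 'rV[R]_n) (r : R) : set 'rV[R]_n :=
  [set x | forall i, `|x ord0 i - a ord0 i| <= r].

Lemma measurable_rV_box n (a : 'rV[R]_n) r : measurable (rV_box a r).
Proof.
have -> : rV_box a r =
    \big[setI/setT]_(i < n) (rV_coord i @^-1` `[a ord0 i - r, a ord0 i + r]).
  apply/seteqP; split => x /=.
    move=> h; rewrite -bigcap_seq => i /= _.
    by have := h i; rewrite ler_norml in_itv/= lerBrDl addrC lerBlDl.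
  rewrite -bigcap_seq => h i.
  have /= := h i (mem_index_enum _).
  by rewrite ler_norml in_itv/= lerBrDl addrC lerBlDl.
apply: bigsetI_measurable => i _.
by rewrite -[X in measurable X]setTI; apply: measurable_rV_coord.
Qed.

Lemma lebesgue_rV_box n (a : 'rV[R]_n) r : 0 <= r ->
  lebesgue_rV n (rV_box a r) = ((2 * r) ^+ n)%:E.
Proof.
move=> r0; elim: n a => [|n IH] a.
  rewrite /= diracE expr0; suff -> : (0 \in rV_box a r) = true by [].
  by apply/mem_set => -[].
rewrite /= /lebesgue_rV_succ /pushforward.
have -> : @rV_cons R n @^-1` rV_box a r =
    `[a ord0 ord0 - r, a ord0 ord0 + r] `*` rV_box (\row_i a ord0 (lift ord0 i)) r.
  have E0 (p : measurableTypeR R * 'rV[R]_n) : @rV_cons R n p ord0 ord0 = p.1.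
    by rewrite /rV_cons mxE; case: splitP => //= j _; rewrite !ord1 mxE mulr1n.
  have E1 (p : measurableTypeR R * 'rV[R]_n) i :
      @rV_cons R n p ord0 (lift ord0 i) = p.2 ord0 i.
    rewrite /rV_cons mxE; case: splitP => j /= ij.
      by have := ltn_ord j; rewrite -ij /bump.
    by congr (p.2 _ _); apply: val_inj => /=; move: ij; rewrite /bump !add1n => -[].
  apply/seteqP; split => p /=.
    move=> h; split.
      by have := h ord0; rewrite E0 ler_norml in_itv/= lerBrDl addrC lerBlDl.
    by move=> i; have := h (lift ord0 i); rewrite E1 mxE.
  move=> [h1 h2] i; case: (unliftP ord0 i) => [j|] ->.
    by rewrite E1; have := h2 j; rewrite mxE.
  by move: h1; rewrite E0 in_itv/= ler_norml lerBrDl addrC lerBlDl.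
rewrite product_measure1E//; last exact: measurable_rV_box.
rewrite IH /= lebesgue_measure_itv/= lte_fin.
have [rr|rr] := ltP.
  by rewrite -EFinB -EFinM exprS; congr (_ * _)%:E; ring.
have -> : r = 0 by lra.
by rewrite mulr0 exprS mul0r mul0e.
Qed.

Lemma ae_fst d1 d2 (T1 : measurableType d1) (T2 : measurableType d2)
    (m1 : {measure set T1 -> \bar R}) (m2 : {sigma_finite_measure set T2 -> \bar R})
    (P : set T1) :
  (\forall x \ae m1, P x) -> \forall z \ae (m1 \x m2)%E, P z.1.
Proof.
move=> [A [mA A0 sA]]; exists (A `*` setT); split.
- exact: measurableX.
- by rewrite product_measure1E// A0 mul0e.
- by move=> z /= nP; split => //; apply: sA.
Qed.

Lemma ae_snd d1 d2 (T1 : measurableType d1) (T2 : measurableType d2)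
    (m1 : {measure set T1 -> \bar R}) (m2 : {sigma_finite_measure set T2 -> \bar R})
    (P : set T2) :
  (\forall x \ae m2, P x) -> \forall z \ae (m1 \x m2)%E, P z.2.
Proof.
move=> [A [mA A0 sA]]; exists (setT `*` A); split.
- exact: measurableX.
- by rewrite product_measure1E// A0 mule0.
- by move=> z /= nP; split => //; apply: sA.
Qed.

End rV_measure.

Lemma ae_rectangle d1 d2 (T1 : measurableType d1) (T2 : measurableType d2) (R : realType)
    (m1 : {sigma_finite_measure set T1 -> \bar R})
    (m2 : {sigma_finite_measure set T2 -> \bar R}) (A : set T1) (B : set T2) :
  measurable A -> measurable B ->
  (\forall z \ae (m1 \x m2)%E, ~ (A z.1 /\ B z.2)) ->
  (\forall x \ae m1, ~ A x) \/ (\forall y \ae m2, ~ B y).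
Proof.
move=> mA mB AB.
have : (m1 \x m2)%E (A `*` B) = 0%E.
  apply/negligibleP; first exact: measurableX.
  by apply: negligibleS AB => z [Az Bz]; exact.
rewrite product_measure1E// => /eqP; rewrite mule_eq0 => /orP[] /eqP h; [left|right].
- by apply: (negligibleS _ ((negligibleP m1 mA).2 h)) => x /contrapT.
- by apply: (negligibleS _ ((negligibleP m2 mB).2 h)) => x /contrapT.
Qed.

(** * Smooth functions *)

Section smooth_calculus.
Context {R : realType} {N : nat}.
Implicit Types (f g phi : 'rV[R]_N -> R) (x v : 'rV[R]_N) (i j : 'I_N).

Local Notation e_ i := (delta_mx ord0 i : 'rV[R]_N).

(** [smooth] quantifies over lists of partial derivatives; differentiability
    of order [n], by recursion on [n], is what product and chain rules can be
    proved for by induction. *)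
Fixpoint Cn (n : nat) f : Prop :=
  [/\ continuous f, (forall i x, derivable f x (e_ i)) &
      match n with 0 => True | m.+1 => forall i, Cn m (partial i f) end].

Lemma CnS n f : Cn n.+1 f -> Cn n f.
Proof.
elim: n f => [|n IH] f [cf df pf]; first by split.
by split => // i; apply: IH; exact: pf.
Qed.

Lemma smoothP f : smooth f <-> forall n, Cn n f.
Proof.
split=> [sf n|Cf l].
  elim: n f sf => [|n IH] f sf; have [cf df] := sf [::].
    by split => // i x; exact: df.
  split=> // i.
  by apply: IH => l; have := sf (rcons l i); rewrite /iter_partial foldr_rcons.
move: (Cf (size l)) => {Cf}; elim/last_ind: l f => [|l i IH] f.
  by move=> [cf df _]; split => // i x; exact: df.
rewrite size_rcons /iter_partial foldr_rcons => -[_ _ pf].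
exact: (IH _ (pf i)).
Qed.

(** Directional derivatives are derivatives along a line, which gives access
    to the calculus of functions of one variable. *)
Lemma derive1_line f x v :
  (derivable f x v <-> derivable (fun h : R => f (h *: v + x)) 0 1) /\
  'D_v f x = 'D_1 (fun h : R => f (h *: v + x)) 0.
Proof.
split; first by apply derivable1P.
rewrite /derive; set g1 := fun h => h^-1 *: _; set g2 := fun h => h^-1 *: _.
suff -> : g1 = g2 by [].
by rewrite funeqE /g1 /g2 => h /=; rewrite addr0 scale0r add0r [_%:A]mulr1.
Qed.

Lemma is_derive1_lineP f x v df :
  is_derive (0 : R) 1 (fun h : R => f (h *: v + x)) df <-> is_derive x v f df.
Proof.
have [h1 h2] := derive1_line f x v.
split => -[a b]; split; [exact/h1|by rewrite h2|exact/h1|by rewrite -h2].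
Qed.

Lemma is_derive_comp_line f (g : R -> R) x v df dg :
  is_derive x v f df -> is_derive (f x) 1 g dg ->
  is_derive x v (g \o f) (dg * df).
Proof.
move=> /is_derive1_lineP h1 h2; apply/is_derive1_lineP.
apply: (@is_derive1_comp _ g (fun h : R => f (h *: v + x))).
by rewrite scale0r add0r.
Qed.

Lemma Cn_cst n (c : R) : Cn n (fun=> c).
Proof.
have cc (a : R) : continuous (fun _ : 'rV[R]_N => a) by exact: cst_continuous.
have dc (a : R) i x : derivable (fun _ : 'rV[R]_N => a) x (e_ i).
  exact: derivable_cst.
elim: n c => [|n IH] c; split => // i.
rewrite (_ : partial i _ = fun=> 0); first exact: IH.
by apply/funext => x; exact: derive_cst.
Qed.

Lemma Cn_coord n i : Cn n (fun x => x ord0 i).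
Proof.
have dc x j : is_derive x (e_ j) (fun y : 'rV[R]_N => y ord0 i) ((i == j)%:R).
  apply/is_derive1_lineP.
  rewrite (_ : (fun _ => _) = fun h => h * (i == j)%:R + x ord0 i); last first.
    by apply/funext => h; rewrite !mxE.
  by apply: is_derive_eq; rewrite scaler0 add0r addr0 [LHS]mulr1.
have [cc dd] : continuous (fun x : 'rV[R]_N => x ord0 i) /\
    forall j x, derivable (fun x : 'rV[R]_N => x ord0 i) x (e_ j).
  by split => [|j x]; [exact: coord_continuous|have [] := dc x j].
case: n => [|n]; split => // j.
rewrite (_ : partial j _ = fun=> (i == j)%:R); first exact: Cn_cst.
by apply/funext => x; have [] := dc x j.
Qed.

Lemma CnD n f g : Cn n f -> Cn n g -> Cn n (fun x => f x + g x).
Proof.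
elim: n f g => [|n IH] f g [cf df pf] [cg dg pg].
all: have cfg : continuous (fun x => f x + g x) by
  move=> x; exact: (continuousD (cf x) (cg x)).
all: have dfg i x : derivable (fun x => f x + g x) x (e_ i) by
  exact: (derivableD (df i x) (dg i x)).
  exact: (And3 cfg dfg I).
split => // i; rewrite (_ : partial i _ = fun x => partial i f x + partial i g x).
  by apply: IH; [exact: pf|exact: pg].
by apply/funext => x; exact: (deriveD (df i x) (dg i x)).
Qed.

Lemma CnM n f g : Cn n f -> Cn n g -> Cn n (fun x => f x * g x).
Proof.
elim: n f g => [|n IH] f g Cf Cg; have [cf df pf] := Cf; have [cg dg pg] := Cg.
all: have cfg : continuous (fun x => f x * g x) by
  move=> x; exact: (continuousM (cf x) (cg x)).
all: have dfg i x : derivable (fun x => f x * g x) x (e_ i) by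
  exact: (derivableM (df i x) (dg i x)).
  exact: (And3 cfg dfg I).
split => // i; rewrite (_ : partial i _ =
    fun x => f x * partial i g x + g x * partial i f x).
  by apply: CnD; apply: IH; [exact: CnS Cf|exact: pg|exact: CnS Cg|exact: pf].
by apply/funext => x; exact: (deriveM (df i x) (dg i x)).
Qed.

(** Chain rule at all orders at once: [G] lists a function of one variable
    together with its successive derivatives, so that differentiating
    [G k \o f] only shifts [k]. *)
Lemma Cn_comp (G : nat -> R -> R) (I : set R) n f :
  (forall k y, I y -> is_derive y 1 (G k) (G k.+1 y)) ->
  (forall x, I (f x)) -> Cn n f -> forall k, Cn n (fun x => G k (f x)).
Proof.
move=> dG fI; elim: n => [|n IH] Cf k; have [cf df pf] := Cf.
all: have dc i x : is_derive x (e_ i) (fun x => G k (f x))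
    (G k.+1 (f x) * partial i f x) by
  apply: (@is_derive_comp_line f (G k)); [split => //; exact: df|exact: dG].
all: have cG : continuous (fun x => G k (f x)) by
  move=> x; apply: (@continuous_comp _ _ _ f (G k)); [exact: cf|
    apply: differentiable_continuous; apply/derivable1_diffP;
    by have [] := dG k _ (fI x)].
  by split => [//|i x|//]; have [] := dc i x.
split => [//|i x|i]; first by have [] := dc i x.
rewrite (_ : partial i _ = fun x => G k.+1 (f x) * partial i f x).
  apply: CnM; last exact: pf.
  by apply: IH; exact: CnS Cf.
by apply/funext => x; have [] := dc i x.
Qed.

Lemma smooth_cst (c : R) : smooth (fun _ : 'rV[R]_N => c).
Proof. by apply/smoothP => n; exact: Cn_cst. Qed.

Lemma smooth_coord i : smooth (fun x : 'rV[R]_N => x ord0 i).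
Proof. by apply/smoothP => n; exact: Cn_coord. Qed.

Lemma smoothD f g : smooth f -> smooth g -> smooth (fun x => f x + g x).
Proof. by move=> /smoothP sf /smoothP sg; apply/smoothP => n; exact: CnD. Qed.

Lemma smoothM f g : smooth f -> smooth g -> smooth (fun x => f x * g x).
Proof. by move=> /smoothP sf /smoothP sg; apply/smoothP => n; exact: CnM. Qed.

Lemma smooth_sum (I : Type) (r : seq I) (F : I -> 'rV[R]_N -> R) :
  (forall k, smooth (F k)) -> smooth (fun x => \sum_(k <- r) F k x).
Proof.
move=> sF; elim: r => [|k r IH].
  rewrite (_ : (fun _ => _) = fun=> 0); first exact: smooth_cst.
  by apply/funext => x; rewrite big_nil.
rewrite (_ : (fun _ => _) = fun x => F k x + \sum_(j <- r) F j x).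
  exact: smoothD.
by apply/funext => x; rewrite big_cons.
Qed.

Lemma smooth_comp (G : nat -> R -> R) (I : set R) f :
  (forall k y, I y -> is_derive y 1 (G k) (G k.+1 y)) ->
  (forall x, I (f x)) -> smooth f -> smooth (fun x => G 0 (f x)).
Proof.
by move=> dG fI /smoothP sf; apply/smoothP => n; exact: (Cn_comp dG fI (sf n) 0).
Qed.

Lemma smooth_powR (p : R) f :
  (forall x, 0 < f x) -> smooth f -> smooth (fun x => f x `^ p).
Proof.
move=> f0 sf.
(* the [k]-th derivative of [y `^ p] is [c k * y `^ (p - k)] *)
pose c k := \prod_(j < k) (p - j%:R).
pose G k (y : R) := c k * y `^ (p - k%:R).
rewrite (_ : (fun _ => _) = fun x => G 0 (f x)); last first.
  by apply/funext => x; rewrite /G /c big_ord0 mul1r subr0.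
apply: (smooth_comp (I := [set y | 0 < y])) => // k y /= y0.
have d := is_derive1_powR (p - k%:R) y0.
have -> : G k = c k *: (@powR R ^~ (p - k%:R)) by [].
apply: is_derive_eq.
rewrite /G /c big_ord_recr/= -!mulrA -natr1 opprD addrA.
by congr (_ * _); rewrite mulrA.
Qed.

End smooth_calculus.

(** * A flat function *)

Section flat_function.
Context {R : realType}.
Implicit Types (p : {poly R}) (x y : R).

(** The case of contact of order two is all that is needed at [0], where the
    rules of calculus do not apply to [flat]. *)
Lemma is_derive_quadratic (f : R -> R) x C :
  (forall h, `|h| <= 1 -> `|f (h + x) - f x| <= C * h ^+ 2) ->
  is_derive x 1 f 0.
Proof.
move=> fC.
suff fx : (fun h => h^-1 *: ((f \o shift x) (h *: 1) - f x)) @ 0^' --> (0 : R).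
  by split; [apply/cvg_ex; exists 0|exact: cvg_lim fx].
apply/cvgr0Pnorm_lt => e e0.
have C0 : 0 <= `|C| by [].
near=> h.
have h0 : h != 0 by near: h; exact: nbhs_dnbhs_neq.
rewrite /= [h%:A]mulr1 normrZ normfV.
have h1 : `|h| <= 1.
  by near: h; apply: dnbhs0_le.
apply: (@le_lt_trans _ _ (`|h|^-1 * (`|C| * `|h| ^+ 2))).
  rewrite ler_wpM2l ?invr_ge0//; apply: le_trans (fC _ h1) _.
  by rewrite real_normK ?num_real// ler_wpM2r ?sqr_ge0// ler_norm.
rewrite expr2 mulrCA mulKf ?normr_eq0//.
apply: (@le_lt_trans _ _ ((`|C| + 1) * `|h|)).
  by rewrite ler_wpM2r// lerDl.
rewrite -ltr_pdivlMl ?ltr_wpDl//.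
near: h; apply: dnbhs0_lt; rewrite mulr_gt0// invr_gt0 ltr_wpDl//.
Unshelve. all: by end_near. Qed.

Lemma poly_expRN_bounded p k :
  exists C : R, forall y, 1 <= y -> y ^+ k * `|p.[y]| * expR (- y) <= C.
Proof.
elim/poly_ind: p k => [|p c IH] k.
  by exists 0 => y _; rewrite horner0 normr0 mulr0 mul0r.
have [C1 h1] := IH k.+1.
exists (C1 + `|c| * k.+1`!%:R) => y y1.
have y0 : 0 <= y by apply: le_trans y1.
have e0 := expR_ge0 (- y).
rewrite !hornerE.
apply: (@le_trans _ _ (y ^+ k.+1 * `|p.[y]| * expR (- y) + `|c| * (y ^+ k * expR (- y)))).
  rewrite (_ : _ + _ = y ^+ k * (`|p.[y] * y| + `|c|) * expR (- y)); last first.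
    by rewrite normrM (ger0_norm y0) exprS; ring.
  by rewrite ler_wpM2r// ler_wpM2l ?exprn_ge0// ler_normD.
apply: lerD; first exact: h1.
rewrite ler_wpM2l// expRN ler_pdivrMr ?expR_gt0//.
apply: (@le_trans _ _ (y ^+ k.+1)); first by rewrite ler_weXn2l.
have f0 : (0 : R) < k.+1`!%:R by rewrite ltr0n fact_gt0.
rewrite mulrC -ler_pdivrMr//; apply: le_trans (expR_ge1Dxn k y0).
by rewrite lerDr.
Qed.

(** The functions [p(1/x) exp(-1/x)], extended by [0] to [x <= 0]: the family is
    stable under differentiation, so all its members are smooth, which yields
    the classical bump function. *)
Definition flat p x : R := if 0 < x then p.[x^-1] * expR (- x^-1) else 0.

Lemma is_derive_flat p x :
  is_derive x 1 (flat p) (flat ('X^2 * (p - p^`())) x).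
Proof.
have [x0|x0|<-] := ltgtP 0 x.
- apply: (@near_eq_is_derive _ _ _ (fun y => p.[y^-1] * expR (- y^-1))).
    near=> y; rewrite /flat ifT//; near: y; exact: lt_nbhsr.
  have dV : is_derive x 1 (fun y : R => y^-1) (- x ^- 2).
    have xn0 : x != 0 by rewrite gt_eqF.
    split; first exact: (@derivableV _ _ id x 1 xn0 (@derivable_id _ _ x 1)).
    by rewrite (@deriveV _ _ id x 1 xn0 (@derivable_id _ _ x 1)) derive_id [LHS]mulr1.
  have dN : is_derive x 1 (fun y : R => - y^-1) (x ^- 2).
    by apply: is_derive_eq; rewrite opprK.
  have d1 := @is_derive1_comp _ (horner p) _ x _ _ (is_derive_poly p x^-1) dV.
  have d2 := @is_derive1_comp _ (@expR R) _ x _ _ (is_derive_expR (- x^-1)) dN.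
  apply: (@is_derive_eq _ _ _ _ _ _ _ _ (is_deriveM d1 d2)).
  rewrite /flat x0 !hornerE /= /GRing.scale/= exprVn; ring.
- apply: (@near_eq_is_derive _ _ _ (cst 0)).
    near=> y; rewrite /flat ifF//; apply/negbTE; rewrite -leNgt; apply: ltW.
    near: y; exact: lt_nbhsl.
  by rewrite /flat ifF; [exact: is_derive_cst|apply/negbTE; rewrite -leNgt ltW].
- rewrite [X in is_derive _ _ _ X](_ : _ = 0); last by rewrite /flat ltxx.
  have [C CP] := poly_expRN_bounded p 2.
  have C0 : 0 <= C.
    by apply: le_trans (CP 1 (lexx _)); rewrite expr1n mul1r mulr_ge0 ?expR_ge0.
  apply: (@is_derive_quadratic _ _ C) => h h1.
  rewrite /flat addr0 ltxx subr0; case: ifPn => [h0|_]; last first.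
    by rewrite normr0 mulr_ge0 ?sqr_ge0.
  have := CP h^-1; rewrite invf_ge1// => /(_ (le_trans (ler_norm _) h1)).
  rewrite normrM (ger0_norm (expR_ge0 _)) -mulrA exprVn.
  by rewrite ler_pdivrMl ?exprn_gt0// [C * _]mulrC.
Unshelve. all: by end_near. Qed.

End flat_function.

(** * Test functions *)

Section test_functions_theory.
Context {R : realType} {N : nat}.
Implicit Types (f phi psi : 'rV[R]_N -> R) (Omega : set 'rV[R]_N).
Implicit Types (x y : 'rV[R]_N).

Local Notation e_ i := (delta_mx ord0 i : 'rV[R]_N).

Lemma smooth_continuous f : smooth f -> continuous f.
Proof. by move=> /(_ [::])[]. Qed.

Lemma test_function0 Omega phi x : test_function Omega phi -> ~ Omega x -> phi x = 0.
Proof.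
move=> [_ _ sO] nO; apply: contra_notP nO => /eqP p0.
by apply: sO; exact: subset_closure.
Qed.

Lemma test_function_measurable Omega phi :
  test_function Omega phi -> measurable_fun setT phi.
Proof.
by move=> [sp _ _]; apply: continuous_measurable_rV; exact: smooth_continuous.
Qed.

Lemma test_function_support Omega phi psi f :
  test_function Omega phi -> test_function Omega psi -> smooth f ->
  (forall x, phi x = 0 -> psi x = 0 -> f x = 0) -> test_function Omega f.
Proof.
move=> [_ cp sp] [_ cq sq] sf f0.
have sub : closure [set x | f x != 0] `<=`
    closure [set x | phi x != 0] `|` closure [set x | psi x != 0].
  rewrite -closureU; apply: closure_subset => x /= fx.
  have [p|p] := eqVneq (phi x) 0; last by left.
  have [p'|p'] := eqVneq (psi x) 0; last by right.
  by move: fx; rewrite f0// eqxx.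
split => //; last by move=> x /sub[/sp|/sq].
by apply: subclosed_compact sub; [exact: closed_closure|exact: compactU].
Qed.

Lemma test_functionD Omega phi psi (a b : R) :
  test_function Omega phi -> test_function Omega psi ->
  test_function Omega (fun x => a * phi x + b * psi x).
Proof.
move=> tp tq; apply: (test_function_support tp tq).
  have [sp _ _] := tp; have [sq _ _] := tq.
  exact: (smoothD (smoothM (smooth_cst a) sp) (smoothM (smooth_cst b) sq)).
by move=> x -> ->; rewrite !mulr0 addr0.
Qed.

Lemma compact_rV_box (a : 'rV[R]_N) r : compact (rV_box a r).
Proof.
have -> : rV_box a r =
    [set v | forall i, [set` `[a ord0 i - r, a ord0 i + r]] (v ord0 i)].
  apply/seteqP; split => x /= h i; have := h i.
    by rewrite ler_norml in_itv/= lerBrDl addrC lerBlDl.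
  by rewrite ler_norml in_itv/= lerBrDl addrC lerBlDl.
by apply: (@rV_compact R N (fun i => `[_, _]%classic)) => i; exact: segment_compact.
Qed.

Lemma bounded_of_box f r : continuous f ->
  (forall x, ~ rV_box 0 r x -> f x = 0) -> exists2 M, 0 <= M & forall x, `|f x| <= M.
Proof.
move=> cf f0; have [B0|/set0P B0] := eqVneq (rV_box (0 : 'rV[R]_N) r) set0.
  by exists 0 => // x; rewrite f0 ?normr0// B0.
have [c _ cM] : exists2 c, c \in rV_box 0 r &
    forall t, t \in rV_box 0 r -> `|f t| <= `|f c|.
  apply: (@EVT_max_rV R N (fun x => `|f x|)) => //; first exact: compact_rV_box.
  apply: continuous_subspaceT => x; apply: (@continuous_comp _ _ _ f Num.norm).
    exact: cf.
  exact: norm_continuous.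
exists `|f c| => // x; have [xb|xb] := pselect (rV_box 0 r x).
  by apply: cM; rewrite inE.
by rewrite f0// normr0.
Qed.

(** Moving from [y] to [x] one coordinate at a time reduces the estimate to the
    mean value theorem in one variable. *)
Lemma lipschitz_of_partial f (L rho : R) x y :
  (forall i z, derivable f z (e_ i)) -> (forall i z, `|partial i f z| <= L) ->
  (forall i, `|x ord0 i - y ord0 i| <= rho) ->
  `|f x - f y| <= N%:R * L * rho.
Proof.
move=> df pL xy.
(* [w k] has the first [k] coordinates of [x] and the others of [y] *)
pose w (k : nat) : 'rV[R]_N := \row_j if (j < k)%N then x ord0 j else y ord0 j.
have step (i : 'I_N) : `|f (w i.+1) - f (w i)| <= L * rho.
  pose d := x ord0 i - y ord0 i.
  pose F (h : R) := f (h *: e_ i + w i).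
  have dF (h : R) : is_derive h (1 : R) F (partial i f (h *: e_ i + w i)).
    have /is_derive1_lineP h1 : is_derive (h *: e_ i + w i) (e_ i) f
      (partial i f (h *: e_ i + w i)) by split => //; exact: df.
    pose G (k : R) := f (k *: e_ i + (h *: e_ i + w i)).
    have FG : F = G \o (fun k => k - h).
      apply/funext => k; rewrite /F /G /= addrA -scalerDl subrK//.
    rewrite FG -[X in is_derive _ _ _ X]mulr1.
    have d1 : is_derive (h - h) (1 : R) G (partial i f (h *: e_ i + w i)).
      by rewrite subrr.
    have d2 : is_derive h (1 : R) (fun k : R => k - h) 1.
      by apply: is_derive_eq; rewrite subr0.
    exact: (@is_derive1_comp _ G (fun k => k - h) h _ _ d1 d2).
  have cF : continuous F.
    move=> h; apply: differentiable_continuous; apply/derivable1_diffP.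
    by have [] := dF h.
  have wE : w i.+1 = d *: e_ i + w i.
    apply/rowP => j; rewrite !mxE eqxx/= ltnS leq_eqVlt.
    have [->|ji] := eqVneq j i; first by rewrite eqxx ltnn /d mulr1 subrK.
    by rewrite (negbTE (_ : (j : nat) != i))//= mulr0 add0r.
  have -> : f (w i.+1) - f (w i) = F d - F 0 by rewrite /F scale0r add0r -wE.
  have L0 : 0 <= L by apply: le_trans (pL i 0).
  have [d0|d0] := leP 0 d.
    have [c _ ->] := @MVT_segment R F _ 0 d d0 (fun h _ => dF h)
      (@continuous_subspaceT _ _ _ _ cF).
    by rewrite subr0 normrM ler_pM// ?pL ?xy.
  have [c _] := @MVT_segment R F _ d 0 (ltW d0) (fun h _ => dF h)
      (@continuous_subspaceT _ _ _ _ cF).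
  rewrite distrC => ->; rewrite sub0r normrM normrN.
  by rewrite ler_pM// ?pL ?xy.
have -> : f x - f y = \sum_(i < N) (f (w i.+1) - f (w i)).
  rewrite -(big_mkord xpredT (fun i => f (w i.+1) - f (w i))) telescope_sumr//.
  congr (f _ - f _); apply/rowP => j; rewrite !mxE ?ltn_ord//.
apply: le_trans (ler_norm_sum _ _ _) _.
apply: le_trans (ler_sum _ (fun i _ => step i)) _.
by rewrite sumr_const card_ord -[leLHS]mulr_natl mulrA.
Qed.

(** Finiteness of both norms rests on these bounds alone; the Lipschitz constant
    comes from the mean value theorem. *)
Lemma test_function_bounds Omega phi : test_function Omega phi ->
  exists r M L, [/\ 0 <= r, 0 <= M, 0 <= L & [/\
    forall x, ~ rV_box 0 r x -> phi x = 0, forall x, `|phi x| <= M &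
    forall x y rho, (forall i, `|x ord0 i - y ord0 i| <= rho) ->
      `|phi x - phi y| <= L * rho]].
Proof.
move=> [sp cp _]; set K := closure _ in cp.
have [r r0 Kr] : exists2 r, 0 <= r & K `<=` rV_box 0 r.
  have [r0 [_ rK]] := compact_bounded cp.
  exists (`|r0| + 1); first by rewrite addr_ge0.
  move=> x Kx i; rewrite mxE subr0.
  have := rK (`|r0| + 1) _ x Kx; rewrite ltr_pwDr ?ler_norm// => /(_ erefl).
  apply: le_trans; rewrite [leRHS]/Num.norm/= mx_normrE.
  by apply/bigmax_geP; right => /=; exists (ord0, i).
have p0 x : ~ K x -> phi x = 0.
  by move=> nK; apply: contra_notP nK => /eqP h; exact: subset_closure.
have d0 i x : ~ K x -> partial i phi x = 0.
  move=> nK; rewrite /partial -(derive_cst (0 : R) x (e_ i)).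
  apply: near_eq_derive; apply: (@filterS _ _ _ (~` K)).
    by move=> z /p0.
  apply: open_nbhs_nbhs; split => //; apply: closed_openC; exact: closed_closure.
have pr x : ~ rV_box 0 r x -> phi x = 0 by move=> nb; apply: p0 => /Kr.
have [M M0 pM] := bounded_of_box (smooth_continuous sp) pr.
have : exists2 L, 0 <= L & forall i x, `|partial i phi x| <= L.
  have H i : exists L, forall x, `|partial i phi x| <= L.
    have [||L _ ?] := @bounded_of_box (partial i phi) r; last by exists L.
      by have [] := sp [:: i].
    by move=> x nb; apply: d0 => /Kr.
  have [L LP] := choice H; exists (\sum_i `|L i|); first exact: sumr_ge0.
  move=> i x; apply: le_trans (LP i x) _; apply: le_trans (ler_norm _) _.
  by rewrite (bigD1 i)//= lerDl sumr_ge0.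
move=> [L L0 pL]; exists r, M, (N%:R * L); split => //; first by rewrite mulr_ge0.
split => // x y rho xy; apply: lipschitz_of_partial => // i z.
by have [_ h] := sp [::]; exact: h.
Qed.

(** The bump [exp(-1/(r^2 - |x - a|^2))] around a point [a] of [Omega]. *)
Lemma exists_test_function Omega : open Omega -> Omega !=set0 ->
  exists2 phi, test_function Omega phi & exists2 x, Omega x & phi x != 0.
Proof.
move=> oO [a Oa].
have /nbhs_ballP[e /= e0 eO] : nbhs a Omega by apply: open_nbhs_nbhs.
pose r := e / 2; have r0 : 0 < r by rewrite divr_gt0.
pose rho x := r ^+ 2 - \sum_(i < N) (x ord0 i - a ord0 i) ^+ 2.
pose P k : {poly R} := iter k (fun p => 'X^2 * (p - p^`())) 1.
pose phi x := flat 1 (rho x).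
have srho : smooth rho.
  rewrite (_ : rho = fun x => r ^+ 2 +
     \sum_(i < N) (-1) * ((x ord0 i + - a ord0 i) * (x ord0 i + - a ord0 i))).
    apply: smoothD; first exact: smooth_cst.
    have sc i : smooth (fun x => x ord0 i + - a ord0 i).
      by apply: smoothD; [exact: smooth_coord|exact: smooth_cst].
    apply: smooth_sum => i; apply: smoothM; first exact: smooth_cst.
    by apply: smoothM.
  apply/funext => x; rewrite /rho -sumrN; congr (_ + _).
  by apply: eq_bigr => i _; rewrite mulN1r.
have sphi : smooth phi.
  apply: (@smooth_comp _ _ (fun k => flat (P k)) setT) => // k y _.
  exact: is_derive_flat.
have supp : closure [set x | phi x != 0] `<=` rV_box a r.
  have cb : closed (rV_box a r).
    by apply: compact_closed; [exact: norm_hausdorff|exact: compact_rV_box].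
  rewrite [X in _ `<=` X]((closure_id _).1 cb).
  apply: closure_subset => x /=; rewrite /phi /flat /rho.
  case: ifPn => [|_]; last by rewrite eqxx.
  rewrite subr_gt0 => h _ i.
  rewrite -ler_sqr ?nnegrE// ?(ltW r0)// real_normK ?num_real//.
  apply: le_trans (ltW h); rewrite (bigD1 i)//= lerDl sumr_ge0// => j _.
  exact: sqr_ge0.
exists phi.
  split => //.
    apply: subclosed_compact supp; first exact: closed_closure.
    exact: compact_rV_box.
  move=> x /supp xb; apply: eO; split => // i j; rewrite (ord1 i).
  rewrite /ball/= distrC; apply: le_lt_trans (xb j) _.
  by rewrite /r ltr_pdivrMr// ltr_pMr// ltr1n.
exists a => //; rewrite /phi /flat /rho big1 ?subr0 ?exprn_gt0//.
  by rewrite hornerE mul1r gt_eqF// expR_gt0.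
by move=> i _; rewrite subrr expr0n.
Qed.

End test_functions_theory.

(** * Integrability of the truncated kernel *)

Section kernel.
Context {R : realType} {N : nat}.
Local Notation leb := (@lebesgue_rV R N).
Implicit Types (x y z : 'rV[R]_N).

Lemma rV_norm_le z (r : R) : 0 <= r -> (`|z| <= r <-> forall i, `|z ord0 i| <= r).
Proof.
move=> r0; rewrite [in X in X <-> _]/Num.norm/= mx_normrE; split.
  by move=> /bigmax_leP[_ h] i; exact: (h (ord0, i)).
by move=> h; apply/bigmax_leP; split => // -[i j] _ /=; rewrite (ord1 i).
Qed.

Lemma rV_boxE x r : 0 <= r -> rV_box x r = [set y | `|x - y| <= r].
Proof.
move=> r0; apply/seteqP; split => y /=; rewrite (rV_norm_le _ r0) => h i.
  by rewrite !mxE distrC; have := h i.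
by have := h i; rewrite !mxE distrC.
Qed.

Lemma rV_norm_le_euclid z : `|z| <= euclid_norm z.
Proof.
apply/(rV_norm_le _ (sqrtr_ge0 _)) => i.
rewrite -sqrtr_sqr ler_wsqrtr// (bigD1 i)//= lerDl sumr_ge0// => j _.
exact: sqr_ge0.
Qed.

Lemma measurable_subrV :
  measurable_fun setT (fun z : 'rV[R]_N * 'rV[R]_N => z.1 - z.2).
Proof.
apply: measurable_fun_rVP => i.
rewrite (_ : _ \o _ = (rV_coord i \o fst) \- (rV_coord i \o snd)); last first.
  by apply/funext => z /=; rewrite /rV_coord !mxE.
by apply: measurable_funB; apply: measurableT_comp => //; exact: measurable_rV_coord.
Qed.

Lemma measurable_euclid_norm : measurable_fun setT (@euclid_norm R N).
Proof.
rewrite (_ : @euclid_norm R N = fun x => (\sum_(i < N) x ord0 i ^+ 2) `^ 2^-1).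
  apply: (@measurableT_comp _ _ _ _ _ _ (@powR R ^~ 2^-1)).
    exact: measurable_powR.
  apply: measurable_sum => i; apply: (measurable_funX 2).
  exact: measurable_rV_coord.
apply/funext => x; rewrite /euclid_norm powR12_sqrt// sumr_ge0// => i _.
exact: sqr_ge0.
Qed.

Section dyadic.
Variable s : R.
Hypothesis s01 : 0 < s < 1.
Let p : R := N%:R + 2 * s.
Let t (a : R) : R := 2 `^ a.

Let tD a b : t a * t b = t (a + b).
Proof. by rewrite /t powRD// pnatr_eq0 implybT. Qed.

Let t_gt0 a : 0 < t a. Proof. by rewrite powR_gt0. Qed.

Let tX a n : t a ^+ n = t (a * n%:R).
Proof. by rewrite /t powRrM powR_mulrn// powR_ge0. Qed.

Let t_lt1 (a : R) : a < 0 -> t a < 1.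
Proof.
move=> a0; rewrite -[a]opprK /t powRN invf_lt1 ?powR_gt0//.
have : (1 : R) `^ (- a) < 2 `^ (- a).
  by apply: gt0_ltr_powR; rewrite ?oppr_gt0 ?nnegrE ?ltr1n.
by rewrite powR1.
Qed.

Let t_archi (a : R) : exists k : nat, a < t k%:R.
Proof.
exists (Num.truncn `|a|).+1; rewrite /t powR_mulrn//.
apply: le_lt_trans (ler_norm _) _; apply: lt_le_trans (truncnS_gt _) _.
by rewrite -natrX ler_nat ltnW// ltn_expl.
Qed.

(** Upper bounds for [min(1, rho^2) / rho^p] on the dyadic shells
    [2^-(k+1) <= rho <= 2^-k] and [2^k <= rho <= 2^(k+1)] respectively. *)
Definition near_coef (k : nat) : R := t (- 2 * k%:R + k.+1%:R * p).
Definition far_coef (k : nat) : R := t (- k%:R * p).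

(** The numerator is largest at the outer end of a shell and the denominator
    smallest at its inner end. *)
Lemma dyadic_shell (rho : R) : 0 < rho ->
  exists k, (rho <= t (- k%:R) /\ Num.min 1 (rho ^+ 2) / rho `^ p <= near_coef k) \/
    (rho <= t k.+1%:R /\ Num.min 1 (rho ^+ 2) / rho `^ p <= far_coef k).
Proof.
move=> rho0; have p0 : 0 <= p.
  by rewrite /p addr_ge0// mulr_ge0//; case/andP: s01 => /ltW.
have inv_le a : t a <= rho -> (rho `^ p)^-1 <= t (- (a * p)).
  move=> ar; rewrite /t powRN lef_pV2 ?posrE ?powR_gt0// powRrM.
  by apply: ge0_ler_powR; rewrite ?nnegrE ?powR_ge0// ltW.
have [r1|r1] := ltP rho 1.
  have ex : exists k, t (- k.+1%:R) <= rho.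
    have [k hk] := t_archi rho^-1; exists k.
    rewrite /t powRN -[leRHS]invrK lef_pV2 ?posrE ?powR_gt0 ?invr_gt0//.
    apply: le_trans (ltW hk) _; apply: ler_powR; rewrite ?ler1n ?ler_nat//.
  case: (ex_minnP ex) => k hk kmin; exists k; left.
  have rk : rho <= t (- k%:R).
    case: k {hk} kmin => [|k] kmin; first by rewrite oppr0 /t powRr0 ltW.
    by rewrite leNgt; apply/negP => /ltW /kmin; rewrite ltnn.
  split => //; rewrite /near_coef -tD; apply: ler_pM.
  - by rewrite le_min ler01 sqr_ge0.
  - by rewrite invr_ge0 powR_ge0.
  - rewrite ge_min; apply/orP; right.
    apply: (@le_trans _ _ (t (- k%:R) ^+ 2)).
      by rewrite lerXn2r// nnegrE ltW.
    by rewrite tX mulrC mulrN -mulNr.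
  - by apply: le_trans (inv_le _ hk) _; rewrite mulNr opprK.
have ex : exists k, rho <= t k.+1%:R.
  have [k hk] := t_archi rho; exists k; apply: le_trans (ltW hk) _.
  by apply: ler_powR; rewrite ?ler1n ?ler_nat.
case: (ex_minnP ex) => k hk kmin; exists k; right; split => //.
have rk : t k%:R <= rho.
  case: k {hk} kmin => [|k] kmin; first by rewrite /t powRr0.
  by rewrite leNgt; apply/negP => /ltW /kmin; rewrite ltnn.
rewrite -[leRHS]mul1r; apply: ler_pM.
- by rewrite le_min ler01 sqr_ge0.
- by rewrite invr_ge0 powR_ge0.
- by rewrite ge_min lexx.
- by apply: le_trans (inv_le _ rk) _; rewrite /far_coef mulNr.
Qed.

Let geometric_sum (r C : R) n : 0 <= r < 1 -> 0 <= C ->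
  \sum_(k < n) C * r ^+ k <= C / (1 - r).
Proof.
move=> /andP[r0 r1] C0; rewrite -mulr_sumr ler_wpM2l//.
rewrite -[leRHS]mul1r ler_pdivlMr ?subr_gt0//.
have rn : 0 <= r ^+ n by rewrite exprn_ge0.
have rX := subrX1 r n.
by rewrite mulrC -[1 - r]opprB mulNr -rX opprB lerBlDr lerDl.
Qed.

(** A box of side [2^(1-k)] has measure of order [2^(-kN)], so the terms are
    geometric of ratio [2^(2s-2)], and [s < 1]. *)
Lemma near_sum : exists C : R, forall n,
  \sum_(k < n) near_coef k * (2 * t (- k%:R)) ^+ N <= C.
Proof.
exists (t (N%:R + p) / (1 - t (2 * s - 2))) => n.
rewrite (eq_bigr (fun k : 'I_n => t (N%:R + p) * t (2 * s - 2) ^+ k)).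
  apply: geometric_sum; last exact: ltW.
  by rewrite ltW//= t_lt1//; case/andP: s01 => ? ?; lra.
move=> k _; rewrite exprMn /near_coef !tX tD (_ : 2 ^+ N = t N%:R); last first.
  by rewrite /t powR_mulrn.
rewrite !tD; congr t; rewrite /p -natr1; ring.
Qed.

(** Here the ratio is [2^(-2s)], and [s > 0]. *)
Lemma far_sum : exists C : R, forall n,
  \sum_(k < n) far_coef k * (2 * t k.+1%:R) ^+ N <= C.
Proof.
exists (t (2 * N%:R) / (1 - t (- 2 * s))) => n.
rewrite (eq_bigr (fun k : 'I_n => t (2 * N%:R) * t (- 2 * s) ^+ k)).
  apply: geometric_sum; last exact: ltW.
  by rewrite ltW//= t_lt1//; case/andP: s01 => ? ?; lra.
move=> k _; rewrite exprMn /far_coef !tX tD (_ : 2 ^+ N = t N%:R); last first.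
  by rewrite /t powR_mulrn.
rewrite !tD; congr t; rewrite /p -natr1; ring.
Qed.

(** The increments of a bounded Lipschitz function are at most a multiple of
    [min(1, |x - y|)], so up to a constant this majorizes the integrand of its
    seminorm. The sup norm, smaller than the Euclidean one, keeps the level sets
    boxes. *)
Definition truncated_kernel (z : 'rV[R]_N * 'rV[R]_N) : R :=
  Num.min 1 (`|z.1 - z.2| ^+ 2) / `|z.1 - z.2| `^ p.

Lemma truncated_kernel_ge0 (z : 'rV[R]_N * 'rV[R]_N) : 0 <= truncated_kernel z.
Proof. by rewrite divr_ge0 ?powR_ge0// le_min ler01 sqr_ge0. Qed.

Lemma measurable_truncated_kernel : measurable_fun setT truncated_kernel.
Proof.
have mn : measurable_fun setT (fun z : 'rV[R]_N * 'rV[R]_N => `|z.1 - z.2|).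
  apply: (@measurableT_comp _ _ _ _ _ _ (fun x : 'rV[R]_N => `|x|)).
    by apply: continuous_measurable_rV; exact: norm_continuous.
  exact: measurable_subrV.
apply: measurable_funM.
  by apply: measurable_minr => //; exact: measurable_funX.
rewrite (_ : (fun _ => _) = fun w : 'rV[R]_N * 'rV[R]_N => `|w.1 - w.2| `^ (- p)).
  apply: (@measurableT_comp _ _ _ _ _ _ (@powR R ^~ (- p))).
    exact: measurable_powR.
  exact: mn.
by apply/funext => w; rewrite powRN.
Qed.

Lemma truncated_kernel_sym x y : truncated_kernel (x, y) = truncated_kernel (y, x).
Proof. by rewrite /truncated_kernel /= distrC. Qed.

Lemma integral_truncated_kernel : exists C : R, forall x,
  (\int[leb]_y (truncated_kernel (x, y))%:E <= C%:E)%E.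
Proof.
have [C1 h1] := near_sum; have [C2 h2] := far_sum.
have near0 k : 0 <= near_coef k by rewrite ltW// t_gt0.
have far0 k : 0 <= far_coef k by rewrite ltW// t_gt0.
exists (C1 + C2) => x.
pose A k := rV_box x (t (- k%:R)); pose B k := rV_box x (t k.+1%:R).
have mA k : measurable (A k) by exact: measurable_rV_box.
have mB k : measurable (B k) by exact: measurable_rV_box.
pose F k y : \bar R := ((near_coef k)%:E * (\1_(A k) y)%:E +
                       (far_coef k)%:E * (\1_(B k) y)%:E)%E.
have F0 k y : (0 <= F k y)%E.
  by apply: adde_ge0; rewrite -EFinM lee_fin mulr_ge0.
have m1 (c : R) C : measurable C ->
    measurable_fun setT (fun y : 'rV[R]_N => c%:E * (\1_C y)%:E)%E.
  move=> mC; apply: measurable_funeM; apply/measurable_EFinP.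
  exact: measurable_indic.
have mF k : measurable_fun setT (F k).
  by apply: emeasurable_funD; exact: m1.
have t0 a : 0 <= t a by rewrite ltW.
apply: (@le_trans _ _ (\int[leb]_y \sum_(k <oo) F k y)%E).
  apply: ge0_le_integral => //.
  - by move=> y _; rewrite lee_fin truncated_kernel_ge0.
  - apply/measurable_EFinP; apply: (measurableT_comp measurable_truncated_kernel).
    exact: measurable_pair1.
  - by apply: ge0_emeasurable_sum.
  move=> y _; have [xy|xy] := eqVneq x y.
    rewrite /truncated_kernel xy subrr normr0 expr0n/=.
    by rewrite (_ : Num.min 1 0 = 0) ?mul0r ?nneseries_ge0// min_r.
  have [|k hk] := @dyadic_shell `|x - y|; first by rewrite normr_gt0 subr_eq0.
  apply: (@le_trans _ _ (F k y)).
    rewrite /F -!EFinM -EFinD lee_fin !indicE /A /B !rV_boxE//.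
    case: hk => -[b hk]; rewrite (mem_set (b : [set _ | _] y)) mulr1.
    - by apply: le_trans hk _; rewrite lerDl mulr_ge0.
    - by apply: le_trans hk _; rewrite lerDr mulr_ge0.
  apply: le_trans (nneseries_lim_ge k.+1 _) => //.
  by rewrite big_nat_recr//= leeDr// sume_ge0.
rewrite integral_nneseries//.
apply: lime_le; first by apply: is_cvg_nneseries => k _ _; exact: integral_ge0.
apply: nearW => n.
have FE k : (\int[leb]_y F k y)%E = (near_coef k * (2 * t (- k%:R)) ^+ N +
     far_coef k * (2 * t k.+1%:R) ^+ N)%:E.
  rewrite /F ge0_integralD//; [|by move=> y _; rewrite -EFinM lee_fin mulr_ge0|exact: m1|
    by move=> y _; rewrite -EFinM lee_fin mulr_ge0|exact: m1].
  rewrite !ge0_integralZl_EFin//; try (by apply/measurable_EFinP; exact: measurable_indic).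
  rewrite !integral_indic// !setIT /A /B.
  rewrite EFinD !EFinM.
  by congr (_ * _ + _ * _)%E; exact: lebesgue_rV_box (t0 _).
rewrite (eq_bigr _ (fun k _ => FE k)) sumEFin lee_fin big_mkord big_split/=.
by apply: lerD; [exact: h1|exact: h2].
Qed.

End dyadic.
End kernel.

(** * Difference quotients *)

Section difference_quotient.
Context {R : realType} {N : nat}.
Variable s : R.
Local Notation leb := (@lebesgue_rV R N).
Implicit Types (u v : 'rV[R]_N -> R) (z : 'rV[R]_N * 'rV[R]_N).

Definition gkernel z : R :=
  Num.sqrt (euclid_norm (z.1 - z.2) `^ (N%:R + 2 * s))^-1.

(** With the square root of the kernel absorbed, the seminorm and the bilinear
    form are the norm and the scalar product of [L^2] of the product space. *)
Definition dquot u z : R := (u z.1 - u z.2) * gkernel z.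

Lemma sqr_gkernel z :
  gkernel z ^+ 2 = (euclid_norm (z.1 - z.2) `^ (N%:R + 2 * s))^-1.
Proof. by rewrite sqr_sqrtr// invr_ge0 powR_ge0. Qed.

Lemma gkernel_gt0 z : z.1 != z.2 -> 0 < gkernel z.
Proof.
move=> zz; rewrite sqrtr_gt0 invr_gt0 powR_gt0//.
by apply: lt_le_trans (rV_norm_le_euclid _); rewrite normr_gt0 subr_eq0.
Qed.

Lemma gagliardo2E u : gagliardo2 s u = (\int[leb \x leb]_z (dquot u z ^+ 2)%:E)%E.
Proof. by apply: eq_integral => z _; rewrite exprMn sqr_gkernel. Qed.

Lemma gagliardo_formE u v :
  gagliardo_form s u v = (\int[leb \x leb]_z (dquot u z * dquot v z)%:E)%E.
Proof.
apply: eq_integral => z _; rewrite /dquot mulrACA -expr2 sqr_gkernel//.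
Qed.

Lemma measurable_gkernel : measurable_fun setT gkernel.
Proof.
rewrite (_ : gkernel = fun z =>
    (euclid_norm (z.1 - z.2) `^ (- (N%:R + 2 * s))) `^ 2^-1).
  apply: (@measurableT_comp _ _ _ _ _ _ (@powR R ^~ 2^-1)).
    exact: measurable_powR.
  apply: (@measurableT_comp _ _ _ _ _ _ (@powR R ^~ (- (N%:R + 2 * s)))).
    exact: measurable_powR.
  apply: (@measurableT_comp _ _ _ _ _ _ (@euclid_norm R N)).
    exact: measurable_euclid_norm.
  exact: measurable_subrV.
by apply/funext => z; rewrite powRN powR12_sqrt// invr_ge0 powR_ge0.
Qed.

Lemma measurable_dquot u : measurable_fun setT u -> measurable_fun setT (dquot u).
Proof.
move=> mu; apply: measurable_funM; last exact: measurable_gkernel.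
by apply: measurable_funB; apply: measurableT_comp.
Qed.

End difference_quotient.

Section test_function_finiteness.
Context {R : realType} {N : nat}.
Local Notation leb := (@lebesgue_rV R N).
Variables (Omega : set 'rV[R]_N) (s q : R) (phi : 'rV[R]_N -> R).
Hypothesis s01 : 0 < s < 1.
Hypothesis tphi : test_function Omega phi.

Lemma test_function_mass : 0 < q -> measurable Omega ->
  (Lq_mass Omega q phi < +oo)%E.
Proof.
move=> q0 mO; have [r [M [L [r0 M0 _ [p0 pM _]]]]] := test_function_bounds tphi.
have mphi := test_function_measurable tphi.
have mI : measurable_fun Omega (EFin \o (\1_(rV_box (0 : 'rV[R]_N) r) : _ -> R)).
  apply/measurable_EFinP; apply: measurable_funTS; apply: measurable_indic.
  exact: measurable_rV_box.
apply: (@le_lt_trans _ _ (\int[leb]_(x in Omega)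
    ((M `^ q)%:E * (\1_(rV_box 0 r) x)%:E))%E).
  apply: ge0_le_integral => //.
  - apply/measurable_EFinP; apply: measurable_funTS.
    apply: (@measurableT_comp _ _ _ _ _ _ (@powR R ^~ q)).
      exact: measurable_powR.
    exact: measurableT_comp.
  - exact: measurable_funeM.
  move=> x _; rewrite -EFinM lee_fin indicE.
  have [xb|xb] := boolP (x \in _).
    by rewrite mulr1 ge0_ler_powR ?nnegrE// ltW.
  rewrite p0 ?normr0 ?powR0 ?gt_eqF ?mulr0//.
  by move=> /mem_set xb'; rewrite xb' in xb.
rewrite ge0_integralZl_EFin ?powR_ge0// integral_indic//; last exact: measurable_rV_box.
rewrite lte_mul_pinfty ?lee_fin ?powR_ge0//.
have h : (leb (rV_box 0 r) < +oo)%E by rewrite lebesgue_rV_box// ltry.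
apply: le_lt_trans h; apply: le_measure; last exact: subIsetl.
  by rewrite inE; apply: measurableI => //; exact: measurable_rV_box.
by rewrite inE; exact: measurable_rV_box.
Qed.

(** The integrand vanishes unless one of the two points lies in the box [B]
    around the support; integrating first in the other point leaves at most a
    constant times the measure of [B]. *)
Lemma test_function_gagliardo : (gagliardo2 s phi < +oo)%E.
Proof.
have [r [M [L [r0 M0 L0 [p0 pM pL]]]]] := test_function_bounds tphi.
have mphi := test_function_measurable tphi.
have [C hC] := @integral_truncated_kernel R N s s01.
pose B := rV_box (0 : 'rV[R]_N) r.
have mB : measurable B by exact: measurable_rV_box.
pose K := (2 * M) ^+ 2 + L ^+ 2.
have K0 : 0 <= K by rewrite addr_ge0// sqr_ge0.
pose H := @truncated_kernel R N s.
have H0 z : 0 <= H z by exact: truncated_kernel_ge0.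
have mH : measurable_fun setT H by exact: measurable_truncated_kernel.
pose F1 z : \bar R := (\1_B z.1 * H z)%:E.
pose F2 z : \bar R := (\1_B z.2 * H z)%:E.
have F10 z : (0 <= F1 z)%E by rewrite lee_fin mulr_ge0.
have F20 z : (0 <= F2 z)%E by rewrite lee_fin mulr_ge0.
have mI : measurable_fun setT (\1_B : _ -> R) by exact: measurable_indic.
have mF1 : measurable_fun setT F1.
  by apply/measurable_EFinP; apply: measurable_funM => //; exact: measurableT_comp.
have mF2 : measurable_fun setT F2.
  by apply/measurable_EFinP; apply: measurable_funM => //; exact: measurableT_comp.
have CB : (\int[leb]_x ((\1_B x)%:E * C%:E) < +oo)%E.
  have C0 : 0 <= C.
    rewrite -lee_fin; apply: le_trans (hC 0).
    by apply: integral_ge0 => y _; rewrite lee_fin.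
  rewrite ge0_integralZr ?lee_fin//; last by apply/measurable_EFinP.
  rewrite integral_indic// setIT lte_mul_pinfty ?ltry//.
  rewrite ge0_fin_numE//.
  by have := ltry ((2 * r) ^+ N); rewrite -(lebesgue_rV_box (0 : 'rV[R]_N) r0).
have I1 : (\int[leb \x leb]_z F1 z < +oo)%E.
  rewrite fubini_tonelli1//; apply: le_lt_trans CB.
  apply: ge0_le_integral => //.
  - by move=> x _; apply: integral_ge0.
  - exact: measurable_fun_fubini_tonelli_F.
  - by apply: emeasurable_funM => //; apply/measurable_EFinP.
  move=> x _; rewrite /fubini_F /F1 /=.
  under eq_integral do rewrite EFinM.
  rewrite ge0_integralZl_EFin//.
  - by rewrite lee_wpmul2l ?lee_fin.
  - by move=> y _; rewrite lee_fin.
  - apply/measurable_EFinP; apply: (measurableT_comp mH); exact: measurable_pair1.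
have I2 : (\int[leb \x leb]_z F2 z < +oo)%E.
  rewrite fubini_tonelli2//; apply: le_lt_trans CB.
  apply: ge0_le_integral => //.
  - by move=> x _; apply: integral_ge0.
  - exact: measurable_fun_fubini_tonelli_G.
  - by apply: emeasurable_funM => //; apply/measurable_EFinP.
  move=> x _; rewrite /fubini_G /F2 /=.
  under eq_integral do rewrite EFinM /H truncated_kernel_sym.
  rewrite ge0_integralZl_EFin//.
  - by rewrite lee_wpmul2l ?lee_fin.
  - by move=> y _; rewrite lee_fin.
  - apply/measurable_EFinP; apply: (measurableT_comp mH); exact: measurable_pair1.
apply: (@le_lt_trans _ _ (\int[leb \x leb]_z (K%:E * (F1 z + F2 z)))%E).
  rewrite gagliardo2E; apply: ge0_le_integral => //.
  - by move=> z _; rewrite lee_fin sqr_ge0.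
  - by apply/measurable_EFinP; apply: measurable_funX; exact: measurable_dquot.
  - by apply: measurable_funeM; exact: emeasurable_funD.
  move=> [x y] _; rewrite /F1 /F2 -EFinD -EFinM lee_fin /= -mulrDl.
  rewrite /dquot exprMn sqr_gkernel /=.
  have pxy : `|phi x - phi y| <= L * `|x - y|.
    by apply: pL => i; have := (rV_norm_le (x - y) (normr_ge0 _)).1 (lexx _) i; rewrite !mxE.
  have pxy2 : `|phi x - phi y| <= 2 * M.
    by rewrite mulr2n mulrDl !mul1r; apply: le_trans (ler_normB _ _) _; exact: lerD.
  have key : (phi x - phi y) ^+ 2 <= K * Num.min 1 (`|x - y| ^+ 2).
    rewrite -[X in X <= _]real_normK ?num_real// /K mulrDl.
    have [_|_] := leP 1 (`|x - y| ^+ 2).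
      by rewrite mulr1; apply: ler_wpDr; [exact: mulr_ge0 (sqr_ge0 _) _|
        rewrite lerXn2r ?nnegrE// mulr_ge0].
    apply: ler_wpDl; first by rewrite mulr_ge0 ?sqr_ge0.
    by rewrite -exprMn lerXn2r ?nnegrE// mulr_ge0.
  have [xy|xy] := eqVneq x y.
    by rewrite xy subrr expr0n/= mul0r mulr_ge0// mulr_ge0// addr_ge0.
  have n0 : 0 < `|x - y| by rewrite normr_gt0 subr_eq0.
  have ker : (euclid_norm (x - y) `^ (N%:R + 2 * s))^-1 <=
      (`|x - y| `^ (N%:R + 2 * s))^-1.
    have e0 := lt_le_trans n0 (rV_norm_le_euclid (x - y)).
    rewrite lef_pV2 ?posrE ?powR_gt0//; apply: ge0_ler_powR.
    - by rewrite addr_ge0// mulr_ge0//; case/andP: s01 => /ltW.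
    - by rewrite nnegrE ltW.
    - by rewrite nnegrE ltW.
    - exact: rV_norm_le_euclid.
  have HE : (phi x - phi y) ^+ 2 / euclid_norm (x - y) `^ (N%:R + 2 * s) <=
      K * H (x, y).
    rewrite /H /truncated_kernel /= mulrA; apply: ler_pM => //.
    - by rewrite sqr_ge0.
    - by rewrite invr_ge0 powR_ge0.
  have KH : 0 <= K * H (x, y) by rewrite mulr_ge0.
  rewrite !indicE; have [xB|xB] := boolP (x \in B).
    apply: le_trans HE _; rewrite ler_wpM2l// mulrDl mul1r lerDl.
    by rewrite mulr_ge0.
  have [yB|yB] := boolP (y \in B); first by rewrite add0r mul1r.
  have px : phi x = 0 by apply: p0 => /mem_set; rewrite (negbTE xB).
  have py : phi y = 0 by apply: p0 => /mem_set; rewrite (negbTE yB).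
  by rewrite px py subrr expr0n/= mul0r addr0 mul0r mulr0.
rewrite ge0_integralZl_EFin//.
- by rewrite ge0_integralD// lte_mul_pinfty ?lee_fin// lte_add_pinfty.
- by move=> z _; rewrite adde_ge0.
- exact: emeasurable_funD.
Qed.

End test_function_finiteness.

(** * Convergence of integrals *)

Lemma exprV2_gt0 (R : realType) k : (0 : R) < 2^-1 ^+ k.
Proof. by rewrite exprn_gt0. Qed.

Lemma cvg_exprV2 (R : realType) : (fun k => (2^-1 : R) ^+ k) @ \oo --> (0 : R).
Proof. by apply: cvg_expr; rewrite ger0_norm// invf_lt1// ltr1n. Qed.

Lemma cvge0_of_exprV2 (R : realType) (f : nat -> \bar R) :
  (forall k, (0 <= f k <= (2^-1 ^+ k)%:E)%E) -> f @ \oo --> 0%E.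
Proof.
move=> fh; apply: (@squeeze_cvge _ _ _ _ (cst 0%E) _ (fun k => (2^-1 ^+ k)%:E)).
- exact: nearW.
- exact: cvg_cst.
- by apply: cvg_EFin; [exact: nearW|exact: cvg_exprV2].
Qed.

Section convergence_of_integrals.
Context d (T : measurableType d) (R : realType) (mu : {measure set T -> \bar R}).
Variables (D : set T) (mD : measurable D).
Implicit Types (f g h : T -> R).

(** Fatou's lemma, in the form in which it is applied below. *)
Lemma integral_le_of_ae_cvg (G : nat -> T -> R) f (M : \bar R) :
  (forall k, measurable_fun D (G k)) -> measurable_fun D f ->
  (forall k x, D x -> 0 <= G k x) -> (forall x, D x -> 0 <= f x) ->
  {ae mu, forall x, D x -> G ^~ x @ \oo --> f x} ->
  (forall k, (\int[mu]_(x in D) (G k x)%:E <= M)%E) ->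
  (\int[mu]_(x in D) (f x)%:E <= M)%E.
Proof.
move=> mG mf G0 f0 Gf GM.
apply: (@le_trans _ _ (\int[mu]_(x in D) limn_einf (fun k => (G k x)%:E))%E).
  apply: ae_ge0_le_integral => //.
  - exact/measurable_EFinP.
  - by move=> x Dx; rewrite limn_einf_lim; apply: lime_ge;
      [exact: is_cvg_einfs|apply: nearW => k; apply: le_ereal_inf_tmp => _ [j _ <-];
       rewrite lee_fin G0].
  - apply: measurableT_comp => //; apply: measurable_fun_limn_esup => k.
    by apply: measurableT_comp => //; exact/measurable_EFinP.
  move: Gf; apply: filterS => x Gf Dx.
  have /cvg_limn_einf_sup[-> _] // : (fun k => (G k x)%:E) @ \oo --> (f x)%:E.
  by apply: cvg_EFin; [exact: nearW|exact: Gf].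
have mGE k : measurable_fun D (fun x => (G k x)%:E) by exact/measurable_EFinP.
have GE0 k x : D x -> (0 <= (G k x)%:E)%E by move=> Dx; rewrite lee_fin G0.
apply: (le_trans (fatou mu mD mGE GE0)).
rewrite limn_einf_lim; apply: lime_le; first exact: is_cvg_einfs.
apply: nearW => k; apply: le_trans (GM k); apply: ereal_inf_lbound.
by exists k => /=.
Qed.

(** The sum of the [g k] is integrable, hence finite almost everywhere. *)
Lemma ae_cvg0_of_integral (g : nat -> T -> R) :
  (forall k, measurable_fun D (g k)) -> (forall k x, D x -> 0 <= g k x) ->
  (forall k, (\int[mu]_(x in D) (g k x)%:E <= (2^-1 ^+ k)%:E)%E) ->
  {ae mu, forall x, D x -> g ^~ x @ \oo --> (0 : R)}.
Proof.
move=> mg g0 gk.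
have mgE k : measurable_fun D (EFin \o g k) by exact/measurable_EFinP.
pose S x : \bar R := (\sum_(k <oo) (g k x)%:E)%E.
have mS : measurable_fun D S.
  apply: ge0_emeasurable_sum => [k x Dx _|k _]; first by rewrite lee_fin g0.
  exact: mgE.
have S0 x : D x -> (0 <= S x)%E by move=> Dx; apply: nneseries_ge0 => k _ _; rewrite lee_fin g0.
have : mu.-integrable D S.
  apply/integrableP; split => //.
  apply: (@le_lt_trans _ _ 2%:E); last exact: ltry.
  rewrite (eq_integral S); last by move=> x /set_mem Dx; rewrite gee0_abs ?S0.
  rewrite integral_nneseries//.
  apply: lime_le; first by apply: is_cvg_nneseries => k _ _; apply: integral_ge0 => x Dx; rewrite lee_fin g0.
  apply: nearW => n; apply: le_trans (lee_sum _ (fun k _ => gk k)) _.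
  rewrite sumEFin lee_fin big_mkord.
  have e : \sum_(i < n) 2^-1 ^+ i = 2 - 2 * 2^-1 ^+ n :> R.
    have := subrX1 (2^-1 : R) n; set A := \sum_(_ < _) _; set B := _ ^+ n.
    by lra.
  by rewrite e lerBlDr lerDl mulr_ge0// exprn_ge0.
move=> /(integrable_ae mD); apply: filterS => x Sx Dx.
have {Sx} Sfin := Sx Dx.
apply: cvg_series_cvg_0; apply: nondecreasing_is_cvgn.
  by apply/nondecreasing_seqP => n; rewrite !seriesEnat/= big_nat_recr//= lerDl g0.
exists (fine (S x)) => _ [n _ <-].
rewrite -lee_fin fineK// seriesEnat/= -sumEFin.
by apply: nneseries_lim_ge => k _ _; rewrite lee_fin g0.
Qed.

(** Subtracting [C * h k] leaves a sequence with a fixed integrable bound, to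
    which dominated convergence applies. *)
Lemma dominated_cvg0 (f h : nat -> T -> R) g (C : R) :
  0 <= C ->
  (forall k, measurable_fun D (f k)) -> (forall k, measurable_fun D (h k)) ->
  measurable_fun D g ->
  (forall k x, D x -> 0 <= f k x) -> (forall k x, D x -> 0 <= h k x) ->
  (forall x, D x -> 0 <= g x) ->
  (forall k x, D x -> f k x <= C * (h k x + g x)) ->
  {ae mu, forall x, D x -> f ^~ x @ \oo --> (0 : R)} ->
  (\int[mu]_(x in D) (h k x)%:E)%E @[k --> \oo] --> 0%E ->
  (\int[mu]_(x in D) (g x)%:E < +oo)%E ->
  (\int[mu]_(x in D) (f k x)%:E)%E @[k --> \oo] --> 0%E.
Proof.
move=> C0 mf mh mg f0 h0 g0 fhg fae ih ig.
pose F k x := Num.max 0 (f k x - C * h k x).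
have mF k : measurable_fun D (F k).
  apply: measurable_maxr => //; apply: measurable_funB => //.
  exact: measurable_funM.
have FC k x : D x -> `|F k x| <= C * g x.
  move=> Dx; rewrite ger0_norm ?le_max ?lexx// ge_max mulr_ge0 ?g0//=.
  by rewrite lerBlDr -mulrDr addrC fhg.
have iCg : mu.-integrable D (fun x => (C * g x)%:E).
  have ig' : mu.-integrable D (fun x => (g x)%:E).
    apply/integrableP; split; first exact/measurable_EFinP.
    rewrite (eq_integral (EFin \o g))// => x /set_mem Dx.
    by rewrite gee0_abs// lee_fin g0.
  exact: (integrableZl mD C ig').
have FE0 : {ae mu, forall x, D x -> (fun k => (F k x)%:E) @ \oo --> 0%E}.
  move: fae; apply: filterS => x fx Dx; apply: cvg_EFin; first exact: nearW.
  apply: (@squeeze_cvgr _ _ _ _ (fun=> 0) (f ^~ x)).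
  - apply: nearW => k; rewrite /F le_max lexx/= ge_max f0//=.
    by rewrite lerBlDr lerDl mulr_ge0 ?h0.
  - exact: cvg_cst.
  - exact: fx.
have [_ _ +] := @dominated_convergence _ _ _ mu D mD (fun k x => (F k x)%:E)
  (cst 0%E) (fun x => (C * g x)%:E) (fun k => (measurable_EFinP _ _).2 (mF k))
  (@measurable_cst _ _ _ _ _ _) FE0 iCg
  (aeW _ (fun x k Dx => (FC k x Dx : (`|(F k x)%:E| <= (C * g x)%:E)%E))).
rewrite integral0 => F0.
apply: (@squeeze_cvge _ _ _ _ (fun=> 0%E) _
   (fun k => (\int[mu]_(x in D) (F k x)%:E + C%:E * \int[mu]_(x in D) (h k x)%:E)%E)).
- apply: nearW => k; apply/andP; split.
    by apply: integral_ge0 => x Dx; rewrite lee_fin f0.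
  rewrite -ge0_integralZl_EFin//; last 2 first.
  + by move=> x Dx; rewrite lee_fin h0.
  + exact/measurable_EFinP.
  rewrite -ge0_integralD//; last 4 first.
  + by move=> x Dx; rewrite lee_fin /F le_max lexx.
  + exact/measurable_EFinP.
  + by move=> x Dx; rewrite -EFinM lee_fin mulr_ge0 ?h0.
  + by apply: measurable_funeM; exact/measurable_EFinP.
  apply: ge0_le_integral => //.
  + by move=> x Dx; rewrite lee_fin f0.
  + exact/measurable_EFinP.
  + apply: emeasurable_funD; first exact/measurable_EFinP.
    by apply: measurable_funeM; exact/measurable_EFinP.
  move=> x Dx; rewrite -EFinM -EFinD lee_fin /F -lerBlDr.
  by rewrite le_max lexx orbT.
- exact: cvg_cst.
- rewrite -[X in _ --> X](_ : (0 + C%:E * 0)%E = 0%E); last by rewrite mule0 adde0.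
  apply: cvgeD => //; apply: cvgeZl => //.
Qed.

End convergence_of_integrals.

Lemma ae_eq0_of_integral d (T : measurableType d) (R : realType)
    (mu : {measure set T -> \bar R}) (D : set T) (f : T -> R) : measurable D ->
  measurable_fun D f -> (forall x, D x -> 0 <= f x) ->
  (\int[mu]_(x in D) (f x)%:E = 0)%E -> \forall x \ae mu, D x -> f x = 0.
Proof.
move=> mD mf f0 I0.
have I0' : (\int[mu]_(x in D) `|(f x)%:E| = 0)%E.
  rewrite (eq_integral (fun x => (f x)%:E)); first exact: I0.
  by move=> x /set_mem Dx; rewrite gee0_abs ?lee_fin ?f0.
have mfE : measurable_fun D (EFin \o f) by exact/measurable_EFinP.
by have := (ae_eq_integral_abs mu mD mfE).1 I0'; apply: filterS => x h Dx; case: (h Dx).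
Qed.

(** * Square-integrable functions and real powers *)

Section square_integrable.
Context d (T : measurableType d) (R : realType) (mu : {measure set T -> \bar R}).
Implicit Types (f g h : T -> R).

Definition L2 f := measurable_fun setT f /\ (\int[mu]_x (f x ^+ 2)%:E < +oo)%E.

Definition dot f g : R := \int[mu]_x (f x * g x).

Lemma L2_integrable_sqr f : L2 f -> mu.-integrable setT (EFin \o (fun x => f x ^+ 2)).
Proof.
move=> [mf fi]; apply/integrableP; split.
  by apply/measurable_EFinP; exact: measurable_funX.
rewrite (eq_integral (fun x => (f x ^+ 2)%:E))// => x _.
by rewrite gee0_abs//= lee_fin sqr_ge0.
Qed.

Lemma L2_integrableM f g : L2 f -> L2 g ->
  mu.-integrable setT (EFin \o (fun x => f x * g x)).
Proof.
move=> Lf Lg; have [mf _] := Lf; have [mg _] := Lg.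
apply: (@le_integrable _ _ _ mu setT measurableT _
   (EFin \o ((fun x => f x ^+ 2) \+ (fun x => g x ^+ 2)))).
- by apply/measurable_EFinP; exact: measurable_funM.
- move=> x _; rewrite /= lee_fin [leRHS]ger0_norm ?addr_ge0 ?sqr_ge0//.
  by rewrite ler_norml; apply/andP; split; nra.
- exact: (integrableD measurableT (L2_integrable_sqr Lf) (L2_integrable_sqr Lg)).
Qed.

Lemma L2_lin f g a b : L2 f -> L2 g -> L2 (fun x => a * f x + b * g x).
Proof.
move=> Lf Lg; have [mf _] := Lf; have [mg _] := Lg.
have mab : measurable_fun setT (fun x => a * f x + b * g x).
  by apply: measurable_funD; apply: measurable_funM.
split => //.
pose h x := (2 * a ^+ 2) * f x ^+ 2 + (2 * b ^+ 2) * g x ^+ 2.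
have mh : measurable_fun setT h.
  by apply: measurable_funD; apply: measurable_funM => //; exact: measurable_funX.
have ih : mu.-integrable setT (EFin \o h).
  exact: (integrableD measurableT
    (integrableZl measurableT (2 * a ^+ 2) (L2_integrable_sqr Lf))
    (integrableZl measurableT (2 * b ^+ 2) (L2_integrable_sqr Lg))).
apply: le_lt_trans (integrable_lty measurableT ih).
apply: ge0_le_integral => //.
- by move=> x _; rewrite lee_fin sqr_ge0.
- by apply/measurable_EFinP; exact: measurable_funX.
- exact/measurable_EFinP.
move=> x _; rewrite lee_fin /h.
by have := sqr_ge0 (a * f x - b * g x); nra.
Qed.

Lemma dotE f g : L2 f -> L2 g -> (\int[mu]_x (f x * g x)%:E = (dot f g)%:E)%E.
Proof.
by move=> Lf Lg; rewrite /dot /Rintegral fineK//; apply: integrable_fin_num => //;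
  exact: L2_integrableM.
Qed.

Lemma dotC f g : dot f g = dot g f.
Proof. by apply: eq_Rintegral => x _; rewrite mulrC. Qed.

Lemma dot_linl f g h a b : L2 f -> L2 g -> L2 h ->
  dot (fun x => a * f x + b * g x) h = a * dot f h + b * dot g h.
Proof.
move=> Lf Lg Lh.
have i1 := L2_integrableM Lf Lh; have i2 := L2_integrableM Lg Lh.
rewrite /dot -!RintegralZl//.
rewrite -RintegralD//; [|exact: (integrableZl measurableT a i1)|
  exact: (integrableZl measurableT b i2)].
by apply: eq_Rintegral => x _; rewrite /=; ring.
Qed.

Lemma dot_ge0 f : 0 <= dot f f.
Proof. by apply: Rintegral_ge0 => x _; rewrite -expr2 sqr_ge0. Qed.

Lemma dot_sqr_lin f g a b : L2 f -> L2 g ->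
  dot (fun x => a * f x + b * g x) (fun x => a * f x + b * g x) =
  a ^+ 2 * dot f f + 2 * a * b * dot f g + b ^+ 2 * dot g g.
Proof.
move=> Lf Lg; have L := L2_lin a b Lf Lg.
rewrite dot_linl// (dotC f) (dotC g) !dot_linl// (dotC g f); ring.
Qed.

End square_integrable.

Section real_powers.
Context {R : realType}.
Implicit Types (a b q : R).

Lemma powR_norm_mul q a : 1 < q -> `|a| `^ (q - 2) * `|a| = `|a| `^ (q - 1).
Proof.
move=> q1; have [->|a0] := eqVneq a 0.
  by rewrite normr0 mulr0 powR0// gt_eqF// subr_gt0.
rewrite -[X in _ * X]powRr1// -powRD; last by rewrite normr_eq0 a0 implybT.
by congr (_ `^ _); ring.
Qed.

Lemma powR_norm_sqr q a : 0 < q -> `|a| `^ (q - 2) * a * a = `|a| `^ q.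
Proof.
move=> q0; have [->|a0] := eqVneq a 0.
  by rewrite normr0 mulr0 powR0// gt_eqF.
rewrite -mulrA -expr2 -[a ^+ 2]real_normK ?num_real// -powR_mulrn// -powRD; last first.
  by rewrite normr_eq0 a0 implybT.
by rewrite subrK.
Qed.

Lemma powR_norm_addl q a b : 0 < q < 2 -> `|a + b| `^ q <= 4 * (`|a| `^ q + `|b| `^ q).
Proof.
move=> /andP[q0 q2].
have H (x y : R) : `|x| <= `|y| -> `|x + y| `^ q <= 4 * `|y| `^ q.
  move=> xy; apply: (@le_trans _ _ ((2 * `|y|) `^ q)).
    apply: ge0_ler_powR; rewrite ?nnegrE ?mulr_ge0//; first exact: ltW.
    by apply: le_trans (ler_normD _ _) _; rewrite mulr2n mulrDl !mul1r lerD2r.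
  rewrite powRM// ler_wpM2r ?powR_ge0//.
  have -> : (4 : R) = 2 `^ 2 by rewrite powR_mulrn//; ring.
  by apply: ler_powR; [lra|exact: ltW].
have [ab|ab] := leP `|a| `|b|.
  by apply: le_trans (H _ _ ab) _; rewrite ler_wpM2l// lerDr powR_ge0.
by rewrite addrC; apply: le_trans (H _ _ (ltW ab)) _; rewrite ler_wpM2l// lerDl powR_ge0.
Qed.

Lemma powR_superadd q a b : 1 <= q -> 0 <= a <= b -> (b - a) `^ q <= b `^ q - a `^ q.
Proof.
move=> q1 /andP[a0 ab]; have q0 : 0 < q by lra.
have b0 : 0 <= b by lra.
have ba0 : 0 <= b - a by lra.
rewrite -!(@mulr_powRB1 _ _ q)//.
have h1 : a `^ (q - 1) <= b `^ (q - 1) by apply: ge0_ler_powR; rewrite ?nnegrE//; lra.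
have h2 : (b - a) `^ (q - 1) <= b `^ (q - 1) by apply: ge0_ler_powR; rewrite ?nnegrE//; lra.
by nra.
Qed.

(** Convexity of [`|.| `^ q]; it comes down to Young's inequality for
    [`|a| `^ (q - 1)] and [`|a + b|]. *)
Lemma powR_tangent q a b : 1 < q ->
  `|a| `^ q + q * (`|a| `^ (q - 2) * a * b) <= `|a + b| `^ q.
Proof.
move=> q1; have q0 : 0 < q by lra.
have pq : (q / (q - 1))^-1 + q^-1 = 1 by field; apply/andP; split; lra.
have Y := @conjugate_powR _ (`|a| `^ (q - 1)) `|a + b| (q / (q - 1)) q
  (powR_ge0 _ _) (normr_ge0 _) (divr_gt0 q0 (_ : 0 < q - 1)) q0 pq.
have {}Y : q * (`|a| `^ (q - 1) * `|a + b|) <= (q - 1) * `|a| `^ q + `|a + b| `^ q.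
  have q10 : 0 < q - 1 by lra.
  have := Y q10; rewrite -powRrM (_ : (q - 1) * (q / (q - 1)) = q); last by field; lra.
  move=> h; rewrite -ler_pdivlMl// (le_trans h)// le_eqVlt; apply/orP; left.
  by apply/eqP; field; apply/andP; split; lra.
have L : `|a| `^ (q - 2) * a * (a + b) <= `|a| `^ (q - 1) * `|a + b|.
  rewrite -(powR_norm_mul a q1) -!mulrA ler_wpM2l ?powR_ge0//.
  by rewrite -normrM ler_norm.
by move: L; rewrite mulrDr (powR_norm_sqr a q0); nra.
Qed.

Lemma powR_young_le q a b : 1 < q -> `|a| `^ (q - 2) * `|a| * `|b| <= `|a| `^ q + `|b| `^ q.
Proof.
move=> q1; have q0 : 0 < q by lra.
rewrite (powR_norm_mul a q1); have [ab|ab] := leP `|b| `|a|.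
  apply: (@le_trans _ _ (`|a| `^ q)); last by rewrite lerDl powR_ge0.
  by rewrite -(@mulr_powRB1 _ `|a| q)// mulrC ler_wpM2r ?powR_ge0.
apply: (@le_trans _ _ (`|b| `^ q)); last by rewrite lerDr powR_ge0.
rewrite -(@mulr_powRB1 _ `|b| q)// mulrC ler_wpM2l//.
by apply: ge0_ler_powR; rewrite ?nnegrE//; [lra|exact: ltW].
Qed.

(** Young's inequality for the factors [(b ^ 2 a ^ (q - 2)) ^ (q / 2)] and
    [(a ^ q) ^ (1 - q / 2)]. *)
Lemma powR_young_weighted q a b : 1 < q < 2 -> 0 < a ->
  `|b| `^ q <= q / 2 * (b ^+ 2 * a `^ (q - 2)) + (1 - q / 2) * a `^ q.
Proof.
move=> /andP[q1 q2] a0; have q0 : 0 < q by lra.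
have an0 : a != 0 by rewrite gt_eqF.
have pq : (2 / q)^-1 + (2 / (2 - q))^-1 = 1.
  by field; apply/andP; split; lra.
have q20 : 0 < 2 - q by lra.
pose A := `|b| `^ q * a `^ ((q - 2) * (q / 2)); pose B := a `^ (q * (1 - q / 2)).
have := @conjugate_powR _ A B (2 / q) (2 / (2 - q)) (mulr_ge0 (powR_ge0 _ _) (powR_ge0 _ _))
  (powR_ge0 _ _) (divr_gt0 (ltr0n _ 2) q0) (divr_gt0 (ltr0n _ 2) q20) pq.
have -> : A * B = `|b| `^ q.
  rewrite /A /B -mulrA -powRD; last by rewrite an0 implybT.
  rewrite (_ : _ + _ = 0) ?powRr0 ?mulr1//; by field.
have -> : A `^ (2 / q) = b ^+ 2 * a `^ (q - 2).
  rewrite /A powRM ?powR_ge0// -!powRrM.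
  rewrite (_ : q * (2 / q) = 2%:R); last by field; lra.
  rewrite powR_mulrn// real_normK ?num_real//; congr (_ * _ `^ _); field; lra.
have -> : B `^ (2 / (2 - q)) = a `^ q.
  rewrite /B -powRrM; congr (_ `^ _); field; lra.
move=> h; apply: (le_trans h); rewrite le_eqVlt; apply/orP; left; apply/eqP.
by field; lra.
Qed.

End real_powers.

Lemma bernoulli_powR (R : realType) (p y : R) : 1 < p -> 0 <= y ->
  1 + p * (y - 1) <= y `^ p.
Proof.
move=> p1 y0; have := powR_tangent 1 (y - 1) p1.
by rewrite [1 + (y - 1)]addrC subrK normr1 !powR1 !mul1r ger0_norm.
Qed.

(** Strictness comes from squaring the inequality at the square root [z] of
    [y]: the gain is [p (p - 1) (z - 1)^2]. *)
Lemma bernoulli_powR_strict (R : realType) (p y : R) : 1 < p -> 0 <= y -> y != 1 ->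
  1 + p * (y - 1) < y `^ p.
Proof.
move=> p1 y0 yn1; pose z := Num.sqrt y; have z0 : 0 <= z by exact: sqrtr_ge0.
have yz : y = z ^+ 2 by rewrite sqr_sqrtr.
have zn1 : 0 < (z - 1) ^+ 2.
  rewrite lt0r sqr_ge0 andbT sqrf_eq0 subr_eq0; apply: contraNneq yn1 => z1.
  by rewrite yz z1 expr1n.
have B := bernoulli_powR p1 z0.
have zp0 : 0 <= z `^ p by exact: powR_ge0.
have -> : y `^ p = (z `^ p) ^+ 2.
  by rewrite yz -powR_mulrn// -powRrM mulrC powRrM powR_mulrn ?powR_ge0.
have [b0|b0] := leP 0 (1 + p * (z - 1)).
  apply: (@lt_le_trans _ _ ((1 + p * (z - 1)) ^+ 2)); last first.
    by rewrite lerXn2r ?nnegrE.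
  rewrite -subr_gt0 yz.
  rewrite (_ : _ - _ = p * (p - 1) * (z - 1) ^+ 2); last by ring.
  by rewrite mulr_gt0// mulr_gt0//; lra.
apply: lt_le_trans (sqr_ge0 _); apply: (le_lt_trans _ b0).
rewrite yz lerD2l ler_pM2l; last by lra.
have z1 : z < 1.
  rewrite ltNge; apply/negP => h.
  have : 0 <= p * (z - 1) by rewrite mulr_ge0//; lra.
  by move: b0; lra.
by nra.
Qed.

(** The triangle inequality for [`|.| `^ q] with a factor close to one on the
    main term: split according to which of [`|a - b|] and [t * `|b|] is larger. *)
Lemma powR_norm_split (R : realType) (q a b t : R) : 1 < q < 2 -> 0 < t ->
  `|a| `^ q <= (1 + t) ^+ 2 * `|b| `^ q + (1 + t^-1) ^+ 2 * `|a - b| `^ q.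
Proof.
move=> /andP[q1 q2] t0; have q0 : 0 < q by lra.
have H (x y r : R) : 0 < r -> 0 <= x -> 0 <= y -> x <= r * y ->
    (x + y) `^ q <= (1 + r) ^+ 2 * y `^ q.
  move=> r0 x0 y0 xy; apply: (@le_trans _ _ (((1 + r) * y) `^ q)).
    apply: ge0_ler_powR; rewrite ?nnegrE ?addr_ge0//.
    - exact: ltW.
    - by rewrite mulr_ge0// addr_ge0// ltW.
    - by rewrite mulrDl mul1r addrC lerD2l.
  have r1 : 0 <= 1 + r by lra.
  rewrite powRM// ler_wpM2r ?powR_ge0// -[leRHS]powR_mulrn//.
  by apply: ler_powR; lra.
have ab : `|a| <= `|a - b| + `|b| by rewrite -{1}(subrK b a) ler_normD.
apply: (@le_trans _ _ ((`|a - b| + `|b|) `^ q)).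
  by apply: ge0_ler_powR; rewrite ?nnegrE ?addr_ge0// ltW.
have [h|h] := leP `|a - b| (t * `|b|).
  by apply: le_trans (H _ _ _ t0 _ _ h) _; rewrite ?lerDl// mulr_ge0 ?powR_ge0 ?sqr_ge0.
have h' : `|b| <= t^-1 * `|a - b| by rewrite mulrC ler_pdivlMr// mulrC ltW.
rewrite addrC; apply: le_trans (H _ _ _ _ _ _ h') _; rewrite ?invr_gt0//.
by rewrite lerDr mulr_ge0 ?powR_ge0 ?sqr_ge0.
Qed.

(** * Completeness of the space of integrable powers *)

Section powR_limits.
Context {R : realType} (q : R).
Hypothesis q0 : 0 < q.

Lemma powR_inv_lt (a e : R) : 0 <= a -> 0 < e -> (a `^ q < e) = (a < e `^ q^-1).
Proof.
move=> a0 e0; have e1 : e = (e `^ q^-1) `^ q.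
  by rewrite -powRrM mulVf ?gt_eqF// powRr1// ltW.
rewrite [in LHS]e1; apply/idP/idP => [h|h]; last first.
  by apply: gt0_ltr_powR; rewrite ?nnegrE ?powR_ge0.
rewrite ltNge; apply: contraTN h => h; rewrite -leNgt.
by apply: ge0_ler_powR; rewrite ?nnegrE ?powR_ge0// ltW.
Qed.

Lemma cvg_norm_powR (a : nat -> R) (l : R) :
  a @ \oo --> l -> (fun k => `|a k| `^ q) @ \oo --> `|l| `^ q.
Proof.
move=> al; have [l0|l0] := eqVneq l 0.
  rewrite l0 normr0 powR0 ?gt_eqF//; move: al; rewrite l0 => al.
  apply/cvgr0Pnorm_lt => e e0.
  have e1 : 0 < e `^ q^-1 by rewrite powR_gt0.
  move/cvgr0Pnorm_lt : al => /(_ _ e1); apply: filterS => k /= h.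
  by rewrite [`|_ `^ _|]ger0_norm ?powR_ge0// powR_inv_lt.
have nl : (fun k => `|a k|) @ \oo --> `|l| by exact: cvg_norm.
have cp : {for `|l|, continuous (fun x : R => x `^ q)}.
  apply: differentiable_continuous; apply/derivable1_diffP.
  by have [] := @is_derive1_powR R q `|l| _; rewrite ?normr_gt0.
by apply: (@continuous_cvg _ _ _ _ _ (fun k => `|a k|) (fun x : R => x `^ q)).
Qed.

Lemma cvg0_of_norm_powR (a : nat -> R) :
  (fun k => `|a k| `^ q) @ \oo --> 0 -> a @ \oo --> 0.
Proof.
move=> aq; apply/cvgr0Pnorm_lt => e e0.
have e1 : 0 < e `^ q by rewrite powR_gt0.
move/cvgr0Pnorm_lt : aq => /(_ _ e1); apply: filterS => k /=.
rewrite [`|_ `^ _|]ger0_norm ?powR_ge0//; rewrite powR_inv_lt// -powRrM mulfV ?gt_eqF//.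
by rewrite powRr1// ltW.
Qed.

(** Geometric decay of the powers makes the increments absolutely summable. *)
Lemma cvg_of_powR_increments (a : nat -> R) :
  (fun k => 2 ^+ k * `|a k.+1 - a k| `^ q) @ \oo --> 0 -> cvgn a.
Proof.
move=> /cvgP/cvg_seq_bounded[M [_ /(_ (`|M| + 1))]].
rewrite ltr_pwDr ?ler_norm// => /(_ erefl) hM.
pose C := `|M| + 1; have C0 : 0 < C by rewrite ltr_wpDl.
pose r : R := 2 `^ (- q^-1).
have r1 : `|r| < 1.
  rewrite ger0_norm ?powR_ge0// /r powRN invf_lt1 ?powR_gt0//.
  have : (1 : R) `^ q^-1 < 2 `^ q^-1.
    by apply: gt0_ltr_powR; rewrite ?invr_gt0 ?nnegrE ?ltr1n.
  by rewrite powR1.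
have step k : `|a k.+1 - a k| <= C `^ q^-1 * r ^+ k.
  have hk := le_trans (ler_norm _) (hM k I).
  have {}hk : `|a k.+1 - a k| `^ q <= C * (2 ^+ k)^-1.
    by rewrite ler_pdivlMr ?exprn_gt0// mulrC.
  have : (`|a k.+1 - a k| `^ q) `^ q^-1 <= (C * (2 ^+ k)^-1) `^ q^-1.
    apply: ge0_ler_powR => //.
    - by rewrite invr_ge0 ltW.
    - by rewrite nnegrE powR_ge0.
    - by rewrite nnegrE mulr_ge0 ?invr_ge0 ?exprn_ge0//; exact: ltW.
  rewrite -powRrM mulfV ?gt_eqF// powRr1// => /le_trans; apply.
  rewrite powRM ?invr_ge0 ?exprn_ge0//; last exact: ltW.
  rewrite ler_wpM2l ?powR_ge0//.
  rewrite le_eqVlt; apply/orP; left; apply/eqP.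
  by rewrite -powR_invn// -powRrM /r -[RHS]powR_mulrn ?powR_ge0// -powRrM; congr (_ `^ _); ring.
have : cvgn (series (telescope a)).
  apply: normed_cvg; apply: (@series_le_cvg _ _ (geometric (C `^ q^-1) r)) => [n|n|n|].
  - exact: normr_ge0.
  - by rewrite /geometric/= mulr_ge0 ?exprn_ge0 ?powR_ge0.
  - exact: step.
  - exact: is_cvg_geometric_series.
move=> ct; rewrite (_ : a = fun n => a 0%N + series (telescope a) n); last first.
  by apply/funext => n; rewrite -eq_sum_telescope.
by apply: is_cvgD => //; exact: is_cvg_cst.
Qed.

End powR_limits.

Section Lq_convergence.
Context d (T : measurableType d) (R : realType) (mu : {measure set T -> \bar R}).
Variables (D : set T) (mD : measurable D) (q : R).
Hypothesis q12 : 0 < q < 2.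
Implicit Types (f g h : T -> R).

Definition pmass f : \bar R := (\int[mu]_(x in D) (`|f x| `^ q)%:E)%E.

Let q0 : 0 < q. Proof. by case/andP: q12. Qed.

Lemma pmass_ge0 f : (0 <= pmass f)%E.
Proof. by apply: integral_ge0 => x _; rewrite lee_fin powR_ge0. Qed.

Lemma measurable_norm_powR f : measurable_fun setT f ->
  measurable_fun D (fun x => `|f x| `^ q).
Proof.
move=> mf; apply: measurable_funTS.
apply: (@measurableT_comp _ _ _ _ _ _ (@powR R ^~ q)).
  exact: measurable_powR.
exact: measurableT_comp.
Qed.

Lemma measurable_norm_powRE f : measurable_fun setT f ->
  measurable_fun D (fun x => (`|f x| `^ q)%:E).
Proof. by move=> mf; apply/measurable_EFinP; exact: measurable_norm_powR. Qed.

Lemma le_pmass f g : measurable_fun setT f -> measurable_fun setT g ->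
  (forall x, D x -> `|f x| <= `|g x|) -> (pmass f <= pmass g)%E.
Proof.
move=> mf mg fg; apply: ge0_le_integral => //.
- exact: measurable_norm_powRE.
- exact: measurable_norm_powRE.
by move=> x Dx; rewrite lee_fin ge0_ler_powR ?nnegrE// ?fg// ltW.
Qed.

Lemma pmassZ f a : measurable_fun setT f ->
  pmass (fun x => a * f x) = ((`|a| `^ q)%:E * pmass f)%E.
Proof.
move=> mf; rewrite /pmass -ge0_integralZl_EFin//; last first.
- exact: measurable_norm_powRE.
by apply: eq_integral => x _; rewrite normrM powRM// EFinM.
Qed.

Lemma pmassD f g : measurable_fun setT f -> measurable_fun setT g ->
  (pmass (fun x => f x + g x)%R <= 4%:E * (pmass f + pmass g))%E.
Proof.
move=> mf mg; rewrite /pmass.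
have mf' : measurable_fun D (fun x => (`|f x| `^ q)%:E).
  exact: measurable_norm_powRE.
have mg' : measurable_fun D (fun x => (`|g x| `^ q)%:E).
  exact: measurable_norm_powRE.
rewrite -ge0_integralD//; try by move=> x _; rewrite lee_fin powR_ge0.
rewrite -ge0_integralZl_EFin//; last 2 first.
- by move=> x _; rewrite adde_ge0// lee_fin powR_ge0.
- exact: emeasurable_funD.
apply: ge0_le_integral => //.
- by apply/measurable_EFinP; apply: measurable_norm_powR; exact: measurable_funD.
- by apply: measurable_funeM; exact: emeasurable_funD.
by move=> x _; rewrite -EFinD -EFinM lee_fin powR_norm_addl.
Qed.

Lemma pmassB f g : measurable_fun setT f -> measurable_fun setT g ->
  (pmass (fun x => f x - g x)%R <= 4%:E * (pmass f + pmass g))%E.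
Proof.
move=> mf mg; apply: le_trans (pmassD mf (_ : measurable_fun setT (\- g))) _.
  exact: measurable_funN.
by rewrite /pmass; under [X in (_ + X)%E]eq_integral do rewrite normrN.
Qed.

Lemma pmass_distC f g : pmass (fun x => f x - g x) = pmass (fun x => g x - f x).
Proof. by apply: eq_integral => x _; rewrite distrC. Qed.

Lemma ae_cvg_of_pmass (f : nat -> T -> R) g :
  (forall k, measurable_fun setT (f k)) -> measurable_fun setT g ->
  (forall k, (pmass (fun x => f k x - g x)%R <= (2^-1 ^+ k)%:E)%E) ->
  {ae mu, forall x, D x -> f ^~ x @ \oo --> g x}.
Proof.
move=> mf mg h.
have := @ae_cvg0_of_integral _ _ _ mu D mD (fun k x => `|f k x - g x| `^ q)
  (fun k => measurable_norm_powR (measurable_funB (mf k) mg))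
  (fun k x _ => powR_ge0 _ _) h.
apply: filterS => x hx Dx; rewrite -(subr_cvg0 _ _).
apply: (@cvg0_of_norm_powR _ q q0); exact: hx.
Qed.

(** Riesz-Fischer: a subsequence with increments of mass at most [4^-k]
    converges almost everywhere, and Fatou's lemma shows that its limit is the
    limit in mean of the whole sequence. *)
Lemma pmass_complete (f : nat -> T -> R) : (forall k, measurable_fun setT (f k)) ->
  (forall e : R, 0 < e -> exists k0, forall j k, (k0 <= j)%N -> (k0 <= k)%N ->
     (pmass (fun x => f j x - f k x)%R < e%:E)%E) ->
  exists2 g : T -> R, measurable_fun setT g & pmass (fun x => f k x - g x) @[k --> \oo] --> 0%E.
Proof.
move=> mf cf.
have e0 k : 0 < (4^-1 : R) ^+ k by rewrite exprn_gt0.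
have [nn hnn] := choice (fun k => cf _ (e0 k)).
pose m k := (k + \sum_(i < k.+1) nn i)%N.
have nm k : (nn k <= m k)%N by rewrite /m big_ord_recr/= addnA leq_addl.
have mm k : (m k <= m k.+1)%N.
  by rewrite [m k.+1]/m big_ord_recr/= addSn ltnW// ltnS addnA leq_addr.
have mk0 k j : (k <= j)%N -> (nn k <= m j)%N.
  move=> kj; apply: leq_trans (nm k) _.
  by elim: j kj => [|j IH]; [rewrite leqn0 => /eqP ->|
    rewrite leq_eqVlt => /orP[/eqP->//|/IH h]; exact: leq_trans h (mm j)].
have aec : {ae mu, forall x, D x -> cvgn (fun k => f (m k) x)}.
  have mF k : measurable_fun D (fun x => 2 ^+ k * `|f (m k.+1) x - f (m k) x| `^ q).
    by apply: measurable_funM => //; apply: measurable_norm_powR; exact: measurable_funB.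
  have := @ae_cvg0_of_integral _ _ _ mu D mD _ mF.
  move=> /(_ (fun k x _ => mulr_ge0 (exprn_ge0 _ (ler0n _ 2)) (powR_ge0 _ _))).
  have h k : (\int[mu]_(x in D) (2 ^+ k * `|f (m k.+1) x - f (m k) x| `^ q)%:E <=
      (2^-1 ^+ k)%:E)%E.
    under eq_integral do rewrite EFinM.
    rewrite ge0_integralZl_EFin ?exprn_ge0//; last first.
      by apply/measurable_EFinP; apply: measurable_norm_powR; exact: measurable_funB.
    rewrite (_ : 2^-1 ^+ k = 2 ^+ k * 4^-1 ^+ k); last first.
      by rewrite -exprMn; congr (_ ^+ _); field.
    rewrite EFinM lee_wpmul2l ?lee_fin ?exprn_ge0//; apply: ltW.
    by apply: hnn; apply: mk0.
  move=> /(_ h); apply: filterS => x hx Dx.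
  by apply: (@cvg_of_powR_increments _ q q0); exact: hx.
(* the upper limit is measurable and defined everywhere *)
pose g x := fine (limn_esup (fun k => (f (m k) x)%:E)).
have mg : measurable_fun setT g.
  apply: measurableT_comp => //; apply: measurable_fun_limn_esup => k.
  exact/measurable_EFinP.
have fg : {ae mu, forall x, D x -> (fun k => f (m k) x) @ \oo --> g x}.
  move: aec; apply: filterS => x hx Dx; have /cvg_ex[l hl] := hx Dx.
  suff -> : g x = l by exact: hl.
  rewrite /g; have [_ ->//] : limn_einf (fun k => (f (m k) x)%:E) = l%:E /\
     limn_esup (fun k => (f (m k) x)%:E) = l%:E.
  have /cvg_limn_einf_sup[-> ->] // : (fun k => (f (m k) x)%:E) @ \oo --> l%:E.
  by apply: cvg_EFin; [exact: nearW|exact: hl].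
exists g => //; apply/fine_cvgP.
have small (e : R) : 0 < e ->
    \forall k \near \oo, (pmass (fun x => f k x - g x)%R <= e%:E)%E.
  move=> {}e0; have [k0 hk0] := cf _ e0; exists k0 => // k /= k0k.
  have [j0 hj0] : exists j0, forall j, (k0 <= m (j + j0))%N.
    exists k0 => j; elim: j => [|j IH]; first exact: leq_addr.
    exact: leq_trans IH (mm _).
  apply: (@integral_le_of_ae_cvg _ _ _ mu D mD
     (fun j x => `|f k x - f (m (j + j0)%N) x| `^ q)) => //.
  - by move=> j; apply: measurable_norm_powR; exact: measurable_funB.
  - by apply: measurable_norm_powR; exact: measurable_funB.
  - move: fg; apply: filterS => x fgx Dx.
    apply: (cvg_norm_powR q0); apply: cvgB; first exact: cvg_cst.
    have := fgx Dx; rewrite -(cvg_shiftn j0); exact.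
  - by move=> j; apply: ltW; exact: hk0.
split.
  have := small 1 ltr01; apply: filterS => k hk.
  by rewrite ge0_fin_numE ?pmass_ge0//; apply: le_lt_trans hk _; exact: ltry.
apply/cvgr0Pnorm_le => e e0'; have := small e e0'; apply: filterS => k hk.
rewrite /= ger0_norm ?fine_ge0 ?pmass_ge0//.
rewrite -lee_fin fineK// ge0_fin_numE ?pmass_ge0//; apply: le_lt_trans hk _; exact: ltry.
Qed.

End Lq_convergence.

(** * The form, the mass and the completion *)

Lemma cvge0P (R : realType) (f : nat -> \bar R) : (forall k, (0 <= f k)%E) ->
  f @ \oo --> 0%E <->
  forall e : R, 0 < e -> exists k0, forall k, (k0 <= k)%N -> (f k <= e%:E)%E.
Proof.
move=> f0; split => [/fine_cvgP[[k1 _ fk1] /cvgr0Pnorm_le h] e e0|h].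
  have [k2 _ hk2] := h e e0; exists (maxn k1 k2) => k.
  rewrite geq_max => /andP[h1 h2]; have := hk2 k h2.
  by rewrite /= ger0_norm ?fine_ge0// -lee_fin fineK//; exact: fk1.
have fin (e : R) k : (f k <= e%:E)%E -> f k \is a fin_num.
  by move=> fe; rewrite ge0_fin_numE//; apply: le_lt_trans fe _; exact: ltry.
apply/fine_cvgP; split.
  by have [k0 hk0] := h 1 ltr01; exists k0 => // k /hk0/fin.
apply/cvgr0Pnorm_le => e e0; have [k0 hk0] := h e e0; exists k0 => // k /= /hk0 fe.
by rewrite ger0_norm ?fine_ge0// -lee_fin fineK//; exact: fin fe.
Qed.

Section energy_space.
Context {R : realType} {N : nat}.
Variables (Omega : set 'rV[R]_N) (s q : R).
Hypothesis s01 : 0 < s < 1.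
Hypothesis q12 : 1 < q < 2.
Hypothesis oO : open Omega.
Local Notation leb := (@lebesgue_rV R N).
Local Notation leb2 := (leb \x leb)%E.
Implicit Types (u v w phi psi : 'rV[R]_N -> R).

Let q0 : 0 < q. Proof. by case/andP: q12 => ? _; lra. Qed.
Let q02 : 0 < q < 2. Proof. by rewrite q0; case/andP: q12. Qed.
Let mO : measurable Omega. Proof. exact: open_measurable_rV. Qed.

Definition gform u v : R := dot leb2 (dquot s u) (dquot s v).

Definition mass u : R := fine (Lq_mass Omega q u).

(** Membership in the completion, stated without Cauchy sequences and with
    both norms finite; this form is stable under linear combinations and limits
    by direct estimates. It is equivalent to [in_D] by [approximableP]. *)
Definition approximable u : Prop :=
  [/\ measurable_fun setT u, (forall x, ~ Omega x -> u x = 0),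
      L2 leb2 (dquot s u), (Lq_mass Omega q u < +oo)%E &
      forall e : R, 0 < e -> exists phi, [/\ test_function Omega phi,
        (gagliardo2 s (fun x => phi x - u x)%R <= e%:E)%E &
        (Lq_mass Omega q (fun x => phi x - u x)%R <= e%:E)%E]].

Lemma dquot_lin u v a b :
  dquot s (fun x => a * u x + b * v x) =
  (fun z => a * dquot s u z + b * dquot s v z).
Proof. by apply/funext => z; rewrite /dquot; ring. Qed.

Lemma dquotB u v :
  dquot s (fun x => u x - v x) = (fun z => 1 * dquot s u z + (-1) * dquot s v z).
Proof. by apply/funext => z; rewrite /dquot; ring. Qed.

Lemma gagliardo2_gform u : L2 leb2 (dquot s u) -> gagliardo2 s u = (gform u u)%:E.
Proof. by move=> Lu; rewrite gagliardo2E /gform -dotE. Qed.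

Lemma gagliardo_form_gform u v : L2 leb2 (dquot s u) -> L2 leb2 (dquot s v) ->
  gagliardo_form s u v = (gform u v)%:E.
Proof. by move=> Lu Lv; rewrite gagliardo_formE /gform -dotE. Qed.

Lemma L2_dquot_lin u v a b : L2 leb2 (dquot s u) -> L2 leb2 (dquot s v) ->
  L2 leb2 (dquot s (fun x => a * u x + b * v x)).
Proof. by move=> Lu Lv; rewrite dquot_lin; exact: L2_lin. Qed.

Lemma L2_dquotB u v : L2 leb2 (dquot s u) -> L2 leb2 (dquot s v) ->
  L2 leb2 (dquot s (fun x => u x - v x)).
Proof. by move=> Lu Lv; rewrite dquotB; exact: L2_lin. Qed.

Lemma L2_dquot_measurable u : measurable_fun setT u ->
  (gagliardo2 s u < +oo)%E -> L2 leb2 (dquot s u).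
Proof. by move=> mu gu; split; [exact: measurable_dquot|rewrite -gagliardo2E]. Qed.

Lemma gform_ge0 u : 0 <= gform u u. Proof. exact: dot_ge0. Qed.

Lemma gform_sqr_lin u v a b : L2 leb2 (dquot s u) -> L2 leb2 (dquot s v) ->
  gform (fun x => a * u x + b * v x) (fun x => a * u x + b * v x) =
  a ^+ 2 * gform u u + 2 * a * b * gform u v + b ^+ 2 * gform v v.
Proof. by move=> Lu Lv; rewrite /gform dquot_lin dot_sqr_lin. Qed.

Lemma gform_sqrB u v : L2 leb2 (dquot s u) -> L2 leb2 (dquot s v) ->
  gform (fun x => u x - v x) (fun x => u x - v x) =
  gform u u - 2 * gform u v + gform v v.
Proof. by move=> Lu Lv; rewrite /gform dquotB dot_sqr_lin//; ring. Qed.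

Lemma gform_lin u v w a b : L2 leb2 (dquot s u) -> L2 leb2 (dquot s v) ->
  L2 leb2 (dquot s w) ->
  gform (fun x => a * u x + b * v x) w = a * gform u w + b * gform v w.
Proof. by move=> Lu Lv Lw; rewrite /gform dquot_lin dot_linl. Qed.

(** The triangle inequality, squared, with a factor as close to one as wanted
    on the main term. *)
Lemma gform_young u v (t : R) : 0 < t -> L2 leb2 (dquot s u) -> L2 leb2 (dquot s v) ->
  gform v v <= (1 + t) * gform u u + (1 + t^-1) * gform (fun x => v x - u x) (fun x => v x - u x).
Proof.
move=> t0 Lu Lv; set d := fun x => v x - u x.
have Ld : L2 leb2 (dquot s d) by exact: L2_dquotB.
have -> : gform v v = gform u u + 2 * gform u d + gform d d.
  have := gform_sqr_lin 1 1 Lu Ld.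
  rewrite (_ : (fun x => 1 * u x + 1 * d x) = v); last first.
    by apply/funext => x; rewrite /d; ring.
  by move=> ->; ring.
have : 0 <= gform (fun x => t * u x + (-1) * d x) (fun x => t * u x + (-1) * d x).
  exact: gform_ge0.
rewrite gform_sqr_lin// => h.
have {}h : 2 * gform u d <= t * gform u u + t^-1 * gform d d.
  rewrite -(ler_pM2l t0) mulrDr [t * (t^-1 * _)]mulrA mulfV ?gt_eqF//.
  by nra.
by nra.
Qed.

(** Comparing increments pair by pair is enough, since the kernel is a common
    positive factor. *)
Lemma gform_add_le u1 u2 v1 v2 :
  L2 leb2 (dquot s u1) -> L2 leb2 (dquot s u2) ->
  L2 leb2 (dquot s v1) -> L2 leb2 (dquot s v2) ->
  (forall x y, (u1 x - u1 y) ^+ 2 + (u2 x - u2 y) ^+ 2 <=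
     (v1 x - v1 y) ^+ 2 + (v2 x - v2 y) ^+ 2) ->
  gform u1 u1 + gform u2 u2 <= gform v1 v1 + gform v2 v2.
Proof.
move=> L1 L2' L3 L4 h; rewrite /gform /dot.
have i1 := L2_integrableM L1 L1; have i2 := L2_integrableM L2' L2'.
have i3 := L2_integrableM L3 L3; have i4 := L2_integrableM L4 L4.
rewrite -!RintegralD//; apply: le_Rintegral => //.
- exact: (integrableD measurableT i1 i2).
- exact: (integrableD measurableT i3 i4).
move=> z _; rewrite -!expr2 /dquot !exprMn -!mulrDl.
by rewrite ler_wpM2r ?sqr_ge0.
Qed.

Lemma gform_distC u v : gform (fun x => u x - v x) (fun x => u x - v x) =
  gform (fun x => v x - u x) (fun x => v x - u x).
Proof. by apply: eq_Rintegral => z _; rewrite /dquot; ring. Qed.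

Lemma gagliardo2_ge0 u : (0 <= gagliardo2 s u)%E.
Proof. by rewrite gagliardo2E integral_ge0// => z _; rewrite lee_fin sqr_ge0. Qed.

Lemma gagliardo2_lin_le u v a b : measurable_fun setT u -> measurable_fun setT v ->
  (gagliardo2 s (fun x => a * u x + b * v x)%R <=
   (2 * a ^+ 2)%:E * gagliardo2 s u + (2 * b ^+ 2)%:E * gagliardo2 s v)%E.
Proof.
move=> mu mv; rewrite !gagliardo2E dquot_lin.
have mD f : measurable_fun setT f ->
    measurable_fun setT (fun z => ((dquot s f z) ^+ 2)%:E).
  by move=> mf; apply/measurable_EFinP; apply: measurable_funX; exact: measurable_dquot.
have a0 : 0 <= 2 * a ^+ 2 by rewrite mulr_ge0 ?sqr_ge0.
have b0 : 0 <= 2 * b ^+ 2 by rewrite mulr_ge0 ?sqr_ge0.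
rewrite -!ge0_integralZl_EFin//; try exact: mD; try by move=> z _; rewrite lee_fin sqr_ge0.
rewrite -ge0_integralD//; try by move=> z _; rewrite -EFinM lee_fin mulr_ge0 ?sqr_ge0.
- apply: ge0_le_integral => //.
  + by move=> z _; rewrite lee_fin sqr_ge0.
  + apply/measurable_EFinP; apply: measurable_funX.
    by apply: measurable_funD; apply: measurable_funM => //; exact: measurable_dquot.
  + by apply: emeasurable_funD; apply: measurable_funeM; exact: mD.
  move=> z _; rewrite -!EFinM -EFinD lee_fin -subr_ge0.
  have := sqr_ge0 (a * dquot s u z - b * dquot s v z).
  by congr (_ <= _); ring.
- by apply: measurable_funeM; exact: mD.
- by apply: measurable_funeM; exact: mD.
Qed.

Lemma gagliardo2B_le u v w : measurable_fun setT u -> measurable_fun setT v ->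
  measurable_fun setT w ->
  (gagliardo2 s (fun x => u x - v x)%R <=
   2%:E * (gagliardo2 s (fun x => u x - w x)%R + gagliardo2 s (fun x => v x - w x)%R))%E.
Proof.
move=> mu mv mw; rewrite ge0_muleDr ?gagliardo2_ge0//.
have := gagliardo2_lin_le 1 (-1) (measurable_funB mu mw) (measurable_funB mv mw).
rewrite sqrrN expr1n mulr1; congr (gagliardo2 s _ <= _)%E.
by apply/funext => x /=; ring.
Qed.

(** Fatou's lemma on the product space, where the convergence of the difference
    quotients holds at almost every pair. *)
Lemma gagliardo2_le_of_ae_cvg (f : nat -> 'rV[R]_N -> R) u (M : \bar R) :
  (forall k, measurable_fun setT (f k)) -> measurable_fun setT u ->
  (\forall x \ae leb, f ^~ x @ \oo --> u x) ->
  (forall k, (gagliardo2 s (f k) <= M)%E) -> (gagliardo2 s u <= M)%E.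
Proof.
move=> mf mu fu fM; rewrite gagliardo2E.
apply: (@integral_le_of_ae_cvg _ _ _ leb2 setT measurableT (fun k z => dquot s (f k) z ^+ 2)).
- by move=> k; apply: measurable_funX; exact: measurable_dquot.
- by apply: measurable_funX; exact: measurable_dquot.
- by move=> k z _; exact: sqr_ge0.
- by move=> z _; exact: sqr_ge0.
- have h1 := @ae_fst _ _ _ _ _ leb leb _ fu; have h2 := @ae_snd _ _ _ _ _ leb leb _ fu.
  apply: (filterS2 _ _ h1 h2) => z z1 z2 _.
  have cd : (fun k => dquot s (f k) z) @ \oo --> dquot s u z.
    by apply: cvgM; [exact: cvgB|exact: cvg_cst].
  by have := cvgM cd cd; exact.
- by move=> k; rewrite -gagliardo2E.
Qed.

Lemma Lq_massE u : Lq_mass Omega q u = pmass leb Omega q u. Proof. by []. Qed.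

Lemma ae_cvg_of_Lq_mass (f : nat -> 'rV[R]_N -> R) u :
  (forall k, measurable_fun setT (f k)) -> measurable_fun setT u ->
  (forall k x, ~ Omega x -> f k x = 0) -> (forall x, ~ Omega x -> u x = 0) ->
  (forall k, (Lq_mass Omega q (fun x => f k x - u x)%R <= (2^-1 ^+ k)%:E)%E) ->
  \forall x \ae leb, f ^~ x @ \oo --> u x.
Proof.
move=> mf mu f0 u0 h.
have := ae_cvg_of_pmass mO q02 mf mu h; apply: filterS => x hx.
have [xO|xO] := pselect (Omega x); first exact: hx.
rewrite u0// (_ : f ^~ x = fun=> 0); first exact: cvg_cst.
by apply/funext => k; rewrite f0.
Qed.

Lemma test_function_L2 phi : test_function Omega phi -> L2 leb2 (dquot s phi).
Proof.
move=> tp; apply: L2_dquot_measurable; first exact: test_function_measurable tp.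
exact: test_function_gagliardo tp.
Qed.

(** Along a fast subsequence the [L^q] convergence holds almost everywhere, so
    Fatou's lemma turns the Cauchy property of the seminorm into convergence. *)
Lemma gagliardo2_complete (f : nat -> 'rV[R]_N -> R) u :
  (forall k, measurable_fun setT (f k)) -> measurable_fun setT u ->
  (forall k x, ~ Omega x -> f k x = 0) -> (forall x, ~ Omega x -> u x = 0) ->
  (forall e : R, 0 < e -> exists k0, forall j k, (k0 <= j)%N -> (k0 <= k)%N ->
     (gagliardo2 s (fun x => f j x - f k x)%R <= e%:E)%E) ->
  Lq_mass Omega q (fun x => f k x - u x) @[k --> \oo] --> 0%E ->
  gagliardo2 s (fun x => f k x - u x) @[k --> \oo] --> 0%E.
Proof.
move=> mf mu f0 u0 cf /(cvge0P (fun k => pmass_ge0 _ _ _ _)) fu.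
have [n hn] := choice (fun k => fu _ (exprV2_gt0 R k)).
apply/cvge0P => [k|e e0]; first exact: gagliardo2_ge0.
have [k0 hk0] := cf e e0; exists k0 => k k0k.
pose m j := (n j + k0)%N.
have fm : \forall x \ae leb, (fun j => f (m j) x) @ \oo --> u x.
  apply: ae_cvg_of_Lq_mass => //; first by move=> j x; exact: f0.
  by move=> j; apply: hn; exact: leq_addr.
apply: (@gagliardo2_le_of_ae_cvg (fun j x => f k x - f (m j) x)).
- by move=> j; exact: measurable_funB.
- exact: measurable_funB.
- move: fm; apply: filterS => x hx; apply: cvgB; [exact: cvg_cst|exact: hx].
- by move=> j; apply: hk0 => //; exact: leq_addl.
Qed.

Lemma approximableP u : in_D Omega s q u <-> approximable u.
Proof.
split=> [[mu u0 [phi [tphi cphi phiu]]]|[mu u0 Lu Mu hu]].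
  have mphi k : measurable_fun setT (phi k) := test_function_measurable (tphi k).
  have mass_small := (cvge0P (fun k => pmass_ge0 _ _ _ _)).1 phiu.
  have en_small : forall e : R, 0 < e -> exists k0, forall k, (k0 <= k)%N ->
      (gagliardo2 s (fun x => phi k x - u x)%R <= e%:E)%E.
    apply: (cvge0P (fun k => gagliardo2_ge0 _)).1.
    apply: gagliardo2_complete => //.
      by move=> k x; exact: test_function0 (tphi _).
    move=> e e0; have [k0 hk0] := cphi e e0; exists k0 => j k hj hk.
    by apply: ltW; exact: hk0.
  have [k1 hk1] := en_small 1 ltr01; have [k2 hk2] := mass_small 1 ltr01.
  have Ld : L2 leb2 (dquot s (fun x => phi k1 x - u x)).
    apply: L2_dquot_measurable; first exact: measurable_funB.
    by apply: le_lt_trans (hk1 k1 (leqnn _)) _; exact: ltry.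
  split => //.
  - rewrite (_ : u = fun x => phi k1 x - (phi k1 x - u x)).
      by apply: L2_dquotB => //; exact: test_function_L2.
    by apply/funext => x; rewrite subKr.
  - rewrite (_ : u = fun x => phi k2 x - (phi k2 x - u x)); last first.
      by apply/funext => x; rewrite subKr.
    apply: le_lt_trans (pmassB leb mO q02 (mphi k2) (measurable_funB (mphi k2) mu)) _.
    rewrite lte_mul_pinfty ?lee_fin//; apply: lte_add_pinfty.
      exact: (test_function_mass (tphi k2) q0 mO).
    by apply: le_lt_trans (hk2 k2 (leqnn _)) _; exact: ltry.
  - move=> e e0; have [k3 hk3] := en_small e e0; have [k4 hk4] := mass_small e e0.
    exists (phi (maxn k3 k4)); split; first exact: tphi.
    + by apply: hk3; exact: leq_maxl.
    + by apply: hk4; exact: leq_maxr.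
split=> //; have [phi hphi] := choice (fun k => hu _ (exprV2_gt0 R k)).
have tphi k : test_function Omega (phi k) by case: (hphi k).
have mphi k : measurable_fun setT (phi k) := test_function_measurable (tphi k).
exists phi; split => //; last first.
  by apply: cvge0_of_exprV2 => k; rewrite pmass_ge0/=; case: (hphi k).
have gphi : gagliardo2 s (fun x => phi k x - u x) @[k --> \oo] --> 0%E.
  by apply: cvge0_of_exprV2 => k; rewrite gagliardo2_ge0/=; case: (hphi k).
move=> e e0; have e40 : 0 < e / 8 by rewrite divr_gt0.
have [k0 hk0] := (cvge0P (fun k => gagliardo2_ge0 _)).1 gphi _ e40.
exists k0 => j k hj hk.
apply: le_lt_trans (gagliardo2B_le (mphi j) (mphi k) mu) _.
apply: le_lt_trans (lee_wpmul2l _ (leeD (hk0 _ hj) (hk0 _ hk))) _ => //.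
by rewrite -EFinD -EFinM lte_fin; lra.
Qed.

End energy_space.

(* The form is used below only through its algebraic properties. *)
#[global] Opaque gform.

Section approximable_functions.
Context {R : realType} {N : nat}.
Variables (Omega : set 'rV[R]_N) (s q : R).
Hypothesis s01 : 0 < s < 1.
Hypothesis q12 : 1 < q < 2.
Hypothesis oO : open Omega.
Local Notation leb := (@lebesgue_rV R N).
Local Notation leb2 := (leb \x leb)%E.
Local Notation approximable := (approximable Omega s q).
Local Notation gform := (gform s).
Local Notation mass := (mass Omega q).
Implicit Types (u v w phi psi : 'rV[R]_N -> R).

Let q0 : 0 < q. Proof. by case/andP: q12 => ? _; lra. Qed.
Let q02 : 0 < q < 2. Proof. by rewrite q0; case/andP: q12. Qed.
Let mO : measurable Omega. Proof. exact: open_measurable_rV. Qed.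

Lemma massE u : (Lq_mass Omega q u < +oo)%E -> Lq_mass Omega q u = (mass u)%:E.
Proof. by move=> h; rewrite /mass fineK// ge0_fin_numE// pmass_ge0. Qed.

Lemma massR u : mass u = \int[leb]_(x in Omega) (`|u x| `^ q).
Proof. by []. Qed.

Lemma mass_ge0 u : 0 <= mass u.
Proof. by rewrite fine_ge0// pmass_ge0. Qed.

Lemma mass1 u : Lq_mass Omega q u = 1%E -> mass u = 1.
Proof. by rewrite /mass => ->. Qed.

Lemma eq_mass u v : (forall x, `|u x| = `|v x|) -> mass u = mass v.
Proof. by move=> uv; congr fine; apply: eq_integral => x _; rewrite uv. Qed.

Lemma mass_cst0 : mass (fun=> 0) = 0.
Proof.
rewrite /mass /Lq_mass (eq_integral (cst 0%E)) ?integral0// => x _.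
by rewrite normr0 powR0// gt_eqF.
Qed.

Lemma cvg_mass0 (f : nat -> 'rV[R]_N -> R) :
  Lq_mass Omega q (f k) @[k --> \oo] --> 0%E -> mass (f k) @[k --> \oo] --> 0.
Proof. by move/fine_cvgP => [_]. Qed.

Lemma approximable_test phi : test_function Omega phi -> approximable phi.
Proof.
move=> tp; split.
- exact: test_function_measurable tp.
- by move=> x; exact: test_function0 tp.
- exact: (test_function_L2 s01 tp).
- exact: test_function_mass tp q0 mO.
- move=> e e0; exists phi; split => //.
    rewrite gagliardo2E (eq_integral (cst 0%E)) ?integral0 ?lee_fin ?ltW//.
    by move=> z _; rewrite /dquot !subrr mul0r expr0n.
  rewrite /Lq_mass (eq_integral (cst 0%E)) ?integral0 ?lee_fin ?ltW//.
  by move=> z _; rewrite subrr normr0 powR0// gt_eqF.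
Qed.

(** The geometric rate gives convergence almost everywhere as well. *)
Lemma approximable_seq u : approximable u ->
  exists phi : nat -> 'rV[R]_N -> R, [/\ forall k, test_function Omega (phi k),
    forall k, (gagliardo2 s (fun x => phi k x - u x)%R <= (2^-1 ^+ k)%:E)%E,
    forall k, (Lq_mass Omega q (fun x => phi k x - u x)%R <= (2^-1 ^+ k)%:E)%E &
    \forall x \ae leb, phi ^~ x @ \oo --> u x].
Proof.
move=> [mu u0 Lu Mu hu].
have [phi hphi] := choice (fun k => hu _ (exprV2_gt0 R k)).
exists phi; split => [k|k|k|]; try by case: (hphi k).
apply: (@ae_cvg_of_Lq_mass _ _ Omega q) => //.
- by move=> k; have [tp _ _] := hphi k; exact: test_function_measurable tp.
- by move=> k x; have [tp _ _] := hphi k; exact: test_function0 tp.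
- by move=> k; case: (hphi k).
Qed.

Lemma gagliardo2_distC u v :
  gagliardo2 s (fun x => u x - v x) = gagliardo2 s (fun x => v x - u x).
Proof. by apply: eq_integral => p _; congr (_ / _)%:E; ring. Qed.

Lemma Lq_mass_lin_le u v a b : measurable_fun setT u -> measurable_fun setT v ->
  (Lq_mass Omega q (fun x => a * u x + b * v x)%R <=
   4%:E * ((`|a| `^ q)%:E * Lq_mass Omega q u + (`|b| `^ q)%:E * Lq_mass Omega q v))%E.
Proof.
move=> mu mv.
have mZ c (f : 'rV[R]_N -> R) : measurable_fun setT f -> measurable_fun setT (fun x : 'rV[R]_N => c * f x).
  by move=> mf; exact: measurable_funM.
have := pmassD leb mO q02 (mZ a u mu) (mZ b v mv).
by rewrite !pmassZ//.
Qed.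

Lemma approximable_lin u v a b : approximable u -> approximable v ->
  approximable (fun x => a * u x + b * v x).
Proof.
move=> [mu u0 Lu Mu hu] [mv v0 Lv Mv hv].
have mZ c (f : 'rV[R]_N -> R) : measurable_fun setT f -> measurable_fun setT (fun x : 'rV[R]_N => c * f x).
  by move=> mf; exact: measurable_funM.
split.
- by apply: measurable_funD; exact: mZ.
- by move=> x xO; rewrite u0// v0// !mulr0 addr0.
- exact: L2_dquot_lin.
- apply: le_lt_trans (Lq_mass_lin_le _ _ mu mv) _.
  rewrite (massE Mu) (massE Mv).
  exact: ltry (4 * (`|a| `^ q * mass u + `|b| `^ q * mass v)).
move=> e e0.
pose c := 2 * a ^+ 2 + 2 * b ^+ 2 + 4 * (`|a| `^ q + `|b| `^ q) + 1.
have a1 : 0 <= 2 * a ^+ 2 by rewrite mulr_ge0 ?sqr_ge0.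
have b1 : 0 <= 2 * b ^+ 2 by rewrite mulr_ge0 ?sqr_ge0.
have a2 := powR_ge0 `|a| q; have b2 := powR_ge0 `|b| q.
have c0 : 0 < c by rewrite /c; lra.
have ec : 0 < e / c by rewrite divr_gt0.
have [phi [tphi g1 m1]] := hu _ ec; have [psi [tpsi g2 m2]] := hv _ ec.
have mphi := test_function_measurable tphi; have mpsi := test_function_measurable tpsi.
have E : (fun x => (a * phi x + b * psi x) - (a * u x + b * v x)) =
    (fun x => a * (phi x - u x) + b * (psi x - v x)).
  by apply/funext => x; ring.
exists (fun x => a * phi x + b * psi x); split.
- exact: test_functionD.
- rewrite E; apply: le_trans (gagliardo2_lin_le _ _ _ (measurable_funB mphi mu) (measurable_funB mpsi mv)) _.
  apply: (@le_trans _ _ ((2 * a ^+ 2)%:E * (e / c)%:E + (2 * b ^+ 2)%:E * (e / c)%:E)%E).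
    apply: leeD; apply: lee_wpmul2l; rewrite ?lee_fin; [exact: a1|exact: g1|exact: b1|exact: g2].
  change ((2 * a ^+ 2 * (e / c) + 2 * b ^+ 2 * (e / c))%:E <= e%:E)%E.
  rewrite lee_fin -mulrDl mulrCA ger_pMr// ler_pdivrMr// mul1r /c; lra.
- rewrite E; apply: le_trans (Lq_mass_lin_le _ _ (measurable_funB mphi mu) (measurable_funB mpsi mv)) _.
  apply: (@le_trans _ _ (4%:E * ((`|a| `^ q)%:E * (e / c)%:E + (`|b| `^ q)%:E * (e / c)%:E))%E).
    apply: lee_wpmul2l; first by [].
    apply: leeD; apply: lee_wpmul2l; rewrite ?lee_fin; [exact: a2|exact: m1|exact: b2|exact: m2].
  change ((4 * (`|a| `^ q * (e / c) + `|b| `^ q * (e / c)))%:E <= e%:E)%E.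
  rewrite lee_fin -mulrDl mulrA mulrCA ger_pMr// ler_pdivrMr// mul1r /c; lra.
Qed.

Lemma approximableB u v : approximable u -> approximable v ->
  approximable (fun x => u x - v x).
Proof.
move=> au av; rewrite (_ : (fun _ => _) = fun x => 1 * u x + (-1) * v x).
  exact: approximable_lin.
by apply/funext => x; ring.
Qed.

Lemma approximable_closed (z : nat -> 'rV[R]_N -> R) w :
  (forall k, approximable (z k)) -> measurable_fun setT w ->
  (forall x, ~ Omega x -> w x = 0) -> (Lq_mass Omega q w < +oo)%E ->
  L2 leb2 (dquot s w) ->
  (gagliardo2 s (fun x => z k x - w x)) @[k --> \oo] --> 0%E ->
  (Lq_mass Omega q (fun x => z k x - w x)) @[k --> \oo] --> 0%E ->
  approximable w.
Proof.
move=> az mw w0 Mw Lw gz mz; split => // e e0.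
have e8 : 0 < e / 8 by rewrite divr_gt0.
have [k1 hk1] := (cvge0P (fun k => gagliardo2_ge0 s _)).1 gz _ e8.
have [k2 hk2] := (cvge0P (fun k => pmass_ge0 _ _ _ _)).1 mz _ e8.
pose k := maxn k1 k2.
have gk := hk1 k (leq_maxl _ _); have mk := hk2 k (leq_maxr _ _).
have [mzk _ _ _ /(_ _ e8)[phi [tphi g1 m1]]] := az k.
have mphi := test_function_measurable tphi.
exists phi; split => //.
- apply: le_trans (gagliardo2B_le s mphi mw mzk) _.
  apply: (@le_trans _ _ (2%:E * ((e / 8)%:E + (e / 8)%:E))%E).
    apply: lee_wpmul2l; first by [].
    by apply: leeD; [exact: g1|rewrite gagliardo2_distC; exact: gk].
  change ((2 * (e / 8 + e / 8))%:E <= e%:E)%E; rewrite lee_fin; lra.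
- rewrite (_ : (fun x => phi x - w x) = fun x => (phi x - z k x) + (z k x - w x)); last first.
    by apply/funext => x; rewrite addrA subrK.
  apply: le_trans (pmassD leb mO q02 (measurable_funB mphi mzk) (measurable_funB mzk mw)) _.
  apply: (@le_trans _ _ (4%:E * ((e / 8)%:E + (e / 8)%:E))%E).
    apply: lee_wpmul2l; first by [].
    by apply: leeD; [exact: m1|exact: mk].
  change ((4 * (e / 8 + e / 8))%:E <= e%:E)%E; rewrite lee_fin; lra.
Qed.

Lemma approximable_complete (z : nat -> 'rV[R]_N -> R) w :
  (forall k, approximable (z k)) -> measurable_fun setT w ->
  (forall x, ~ Omega x -> w x = 0) ->
  (forall e : R, 0 < e -> exists k0, forall j k, (k0 <= j)%N -> (k0 <= k)%N ->
     (gagliardo2 s (fun x => z j x - z k x)%R <= e%:E)%E) ->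
  Lq_mass Omega q (fun x => z k x - w x) @[k --> \oo] --> 0%E ->
  approximable w /\ gagliardo2 s (fun x => z k x - w x) @[k --> \oo] --> 0%E.
Proof.
move=> az mw w0 cz mz.
have mzk k : measurable_fun setT (z k) by case: (az k).
have gz : gagliardo2 s (fun x => z k x - w x) @[k --> \oo] --> 0%E.
  by apply: (gagliardo2_complete q12 oO) => // k; have [_ zk0 _ _ _] := az k.
split => //.
have [k1 hk1] := (cvge0P (fun k => gagliardo2_ge0 s _)).1 gz 1 ltr01.
have [k2 hk2] := (cvge0P (fun k => pmass_ge0 _ _ _ _)).1 mz 1 ltr01.
apply: (approximable_closed az) => //.
- have [_ _ _ Mz _] := az k2.
  rewrite (_ : w = fun x => z k2 x - (z k2 x - w x)); last first.
    by apply/funext => x; rewrite subKr.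
  apply: le_lt_trans (pmassB leb mO q02 (mzk k2) (measurable_funB (mzk k2) mw)) _.
  rewrite lte_mul_pinfty ?lee_fin//; apply: lte_add_pinfty; first exact: Mz.
  by apply: le_lt_trans (hk2 k2 (leqnn _)) _; exact: ltry.
- have [_ _ Lz _ _] := az k1.
  rewrite (_ : w = fun x => z k1 x - (z k1 x - w x)); last first.
    by apply/funext => x; rewrite subKr.
  apply: L2_dquotB => //; apply: L2_dquot_measurable; first exact: measurable_funB.
  by apply: le_lt_trans (hk1 k1 (leqnn _)) _; exact: ltry.
Qed.

(** Increments of [w] and of its approximants [z k] controlled by those of [u],
    [phi k] and [psi] give a domination, so pointwise convergence is enough. *)
Lemma approximable_lipschitz (C : R) (phi z : nat -> 'rV[R]_N -> R) u psi w :
  0 <= C -> approximable u -> approximable psi ->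
  (forall k, test_function Omega (phi k)) -> (forall k, test_function Omega (z k)) ->
  gagliardo2 s (fun x => phi k x - u x) @[k --> \oo] --> 0%E ->
  Lq_mass Omega q (fun x => phi k x - u x) @[k --> \oo] --> 0%E ->
  measurable_fun setT w -> (forall x, ~ Omega x -> w x = 0) ->
  (\forall x \ae leb, z ^~ x @ \oo --> w x) ->
  (forall k x y, `|z k x - z k y| <= C * (`|phi k x - phi k y| + `|psi x - psi y|)) ->
  (forall x y, `|w x - w y| <= C * (`|u x - u y| + `|psi x - psi y|)) ->
  (forall k x, `|z k x| <= C * (`|phi k x| + `|psi x|)) ->
  (forall x, `|w x| <= C * (`|u x| + `|psi x|)) ->
  approximable w.
Proof.
move=> C0 [mu _ Lu Mu _] [mpsi _ Lp Mp _] tphi tz gphi Mphi mw w0 zw zphi wu zphi' wu'.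
have mz k : measurable_fun setT (z k) := test_function_measurable (tz k).
have mphi k : measurable_fun setT (phi k) := test_function_measurable (tphi k).
have sq (a b c : R) : 0 <= b -> 0 <= c -> `|a| <= C * (b + c) ->
    a ^+ 2 <= 2 * C ^+ 2 * (b ^+ 2 + c ^+ 2).
  move=> b0 c0 h; rewrite -real_normK ?num_real//.
  apply: (@le_trans _ _ ((C * (b + c)) ^+ 2)).
    by rewrite lerXn2r ?nnegrE ?mulr_ge0 ?addr_ge0.
  rewrite exprMn -subr_ge0.
  have : 0 <= C ^+ 2 * (b - c) ^+ 2 by rewrite mulr_ge0 ?sqr_ge0.
  by congr (_ <= _); ring.
have dsq (f g h : 'rV[R]_N -> R) : (forall x y, `|f x - f y| <= C * (`|g x - g y| + `|h x - h y|)) ->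
    forall p, dquot s f p ^+ 2 <= 2 * C ^+ 2 * (dquot s g p ^+ 2 + dquot s h p ^+ 2).
  move=> H p; rewrite /dquot !exprMn -mulrDl mulrA ler_wpM2r ?sqr_ge0//.
  have := sq _ _ _ (normr_ge0 _) (normr_ge0 _) (H p.1 p.2).
  by rewrite !real_normK ?num_real.
have qpow (a b c : R) : 0 <= b -> 0 <= c -> `|a| <= C * (b + c) ->
    `|a| `^ q <= C `^ q * (4 * (b `^ q + c `^ q)).
  move=> b0 c0 h; apply: (@le_trans _ _ ((C * (b + c)) `^ q)).
    by apply: ge0_ler_powR; rewrite ?nnegrE ?mulr_ge0 ?addr_ge0// ltW.
  rewrite powRM ?addr_ge0// ler_wpM2l ?powR_ge0//.
  by have := powR_norm_addl b c q02; rewrite !ger0_norm ?addr_ge0.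
have mdq f : measurable_fun setT f -> measurable_fun setT (fun p => dquot s f p ^+ 2).
  by move=> mf; apply: measurable_funX; exact: measurable_dquot.
have iu : (\int[leb2]_p (dquot s u p ^+ 2)%:E < +oo)%E by case: Lu.
have ip : (\int[leb2]_p (dquot s psi p ^+ 2)%:E < +oo)%E by case: Lp.
pose G p := dquot s u p ^+ 2 + dquot s psi p ^+ 2.
have G0 p : 0 <= G p by rewrite addr_ge0 ?sqr_ge0.
have mG : measurable_fun setT G by apply: measurable_funD; exact: mdq.
have iG : (\int[leb2]_p (G p)%:E < +oo)%E.
  rewrite (eq_integral (fun p => (dquot s u p ^+ 2)%:E + (dquot s psi p ^+ 2)%:E)%E)//.
  rewrite ge0_integralD//.
  - exact: lte_add_pinfty.
  - by move=> p _; rewrite lee_fin sqr_ge0.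
  - by apply/measurable_EFinP; exact: mdq.
  - by move=> p _; rewrite lee_fin sqr_ge0.
  - by apply/measurable_EFinP; exact: mdq.
pose H x := `|u x| `^ q + `|psi x| `^ q.
have H0 x : 0 <= H x by rewrite addr_ge0 ?powR_ge0.
have mH : measurable_fun Omega H.
  by apply: measurable_funD; exact: measurable_norm_powR.
have iH : (\int[leb]_(x in Omega) (H x)%:E < +oo)%E.
  rewrite (eq_integral (fun x => (`|u x| `^ q)%:E + (`|psi x| `^ q)%:E)%E)//.
  rewrite ge0_integralD.
  - by apply: lte_add_pinfty; [exact: Mu|exact: Mp].
  - exact: mO.
  - by move=> x _; rewrite lee_fin powR_ge0.
  - exact: measurable_norm_powRE.
  - by move=> x _; rewrite lee_fin powR_ge0.
  - exact: measurable_norm_powRE.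
have C2 : 0 <= 2 * C ^+ 2 by rewrite mulr_ge0 ?sqr_ge0.
apply: (@approximable_closed z w _ mw w0).
- by move=> k; exact: approximable_test.
- apply: (@le_lt_trans _ _ (\int[leb]_(x in Omega) ((C `^ q * 4)%:E * (H x)%:E))%E).
    apply: ge0_le_integral => //.
    + exact: measurable_norm_powRE.
    + by apply: measurable_funeM; exact/measurable_EFinP.
    move=> x _; rewrite -EFinM lee_fin -mulrA.
    by have := qpow _ _ _ (normr_ge0 _) (normr_ge0 _) (wu' x).
  rewrite ge0_integralZl_EFin ?mulr_ge0 ?powR_ge0//.
  - by rewrite lte_mul_pinfty ?lee_fin ?mulr_ge0 ?powR_ge0.
  - by move=> x _; rewrite lee_fin.
  - exact/measurable_EFinP.
- apply: L2_dquot_measurable => //; rewrite gagliardo2E.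
  apply: (@le_lt_trans _ _ (\int[leb2]_p ((2 * C ^+ 2)%:E * (G p)%:E))%E).
    apply: ge0_le_integral => //.
    + by move=> p _; rewrite lee_fin sqr_ge0.
    + by apply/measurable_EFinP; exact: mdq.
    + by apply: measurable_funeM; exact/measurable_EFinP.
    by move=> p _; rewrite -EFinM lee_fin; exact: (dsq _ _ _ wu).
  rewrite ge0_integralZl_EFin//; [|by move=> p _; rewrite lee_fin|exact/measurable_EFinP].
  by rewrite lte_mul_pinfty ?lee_fin.
- rewrite (eq_cvg _ _ (fun k => gagliardo2E s _)).
  apply: (@dominated_cvg0 _ _ _ leb2 setT measurableT
    (fun k p => dquot s (fun x => z k x - w x) p ^+ 2)
    (fun k p => dquot s (fun x => phi k x - u x) p ^+ 2) G (12 * C ^+ 2)) => //.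
  + by rewrite mulr_ge0 ?sqr_ge0.
  + by move=> k; apply: mdq; exact: measurable_funB.
  + by move=> k; apply: mdq; exact: measurable_funB.
  + by move=> k p _; exact: sqr_ge0.
  + by move=> k p _; exact: sqr_ge0.
  + move=> k p _; rewrite /G.
    have h1 := dsq _ _ _ (zphi k) p; have h2 := dsq _ _ _ wu p.
    rewrite !dquotB.
    have := sqr_ge0 C; have := sqr_ge0 (dquot s (phi k) p - 2 * dquot s u p).
    move: h1 h2; set a := dquot s (z k) p; set b := dquot s w p.
    set c := dquot s (phi k) p; set d := dquot s u p; set e := dquot s psi p.
    set K := C ^+ 2 => h1 h2 h3 h4.
    have h5 : 0 <= (a + b) ^+ 2 by exact: sqr_ge0.
    have h6 : 0 <= K * (c - 2 * d) ^+ 2 by exact: mulr_ge0.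
    have h7 : 0 <= K * e ^+ 2 by rewrite mulr_ge0 ?sqr_ge0.
    have h8 : 0 <= K * (c - d) ^+ 2 by rewrite mulr_ge0 ?sqr_ge0.
    have h9 : (1 * a + -1 * b) ^+ 2 <= 2 * a ^+ 2 + 2 * b ^+ 2.
      by rewrite -subr_ge0; move: h5; congr (_ <= _); ring.
    apply: (le_trans h9).
    apply: (@le_trans _ _ (4 * K * (c ^+ 2 + e ^+ 2) + 4 * K * (d ^+ 2 + e ^+ 2))).
      by lra.
    rewrite -subr_ge0 (_ : _ - _ = 4 * (K * (c - 2 * d) ^+ 2) + 4 * (K * (c - d) ^+ 2) +
      4 * (K * e ^+ 2)); last by ring.
    by apply: addr_ge0; [apply: addr_ge0|]; apply: mulr_ge0.
  + have h1 := @ae_fst _ _ _ _ _ leb leb _ zw; have h2 := @ae_snd _ _ _ _ _ leb leb _ zw.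
    apply: (filterS2 _ _ h1 h2) => p z1 z2 _.
    have cd : (fun k => dquot s (fun x => z k x - w x) p) @ \oo --> (0 : R).
      rewrite -[X in _ --> X](_ : (w p.1 - w p.1 - (w p.2 - w p.2)) * gkernel s p = 0); last first.
        by rewrite !subrr mul0r.
      apply: cvgM; last exact: cvg_cst.
      by apply: cvgB; apply: cvgB; (exact: cvg_cst || exact: z1 || exact: z2).
    by have := cvgM cd cd; rewrite mulr0; exact.
  + by move: gphi; under eq_cvg do rewrite gagliardo2E.
- apply: (@dominated_cvg0 _ _ _ leb Omega mO
    (fun k x => `|z k x - w x| `^ q) (fun k x => `|phi k x - u x| `^ q) H (80 * C `^ q)) => //.
  + by rewrite mulr_ge0 ?powR_ge0.
  + by move=> k; apply: measurable_norm_powR; exact: measurable_funB.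
  + by move=> k; apply: measurable_norm_powR; exact: measurable_funB.
  + move=> k x _; rewrite /H.
    have h1 := qpow _ _ _ (normr_ge0 _) (normr_ge0 _) (zphi' k x).
    have h2 := qpow _ _ _ (normr_ge0 _) (normr_ge0 _) (wu' x).
    have h3 := powR_norm_addl (z k x) (- w x) q02.
    have h4 := powR_norm_addl (phi k x - u x) (u x) q02.
    rewrite subrK in h4; rewrite normrN in h3.
    apply: (le_trans h3); move: h1 h2 h4.
    have := powR_ge0 C q; have := powR_ge0 `|phi k x - u x| q.
    have := powR_ge0 `|u x| q; have := powR_ge0 `|psi x| q.
    set a := `|z k x| `^ q; set b := `|w x| `^ q; set K := C `^ q.
    set c := `|phi k x| `^ q; set d := `|u x| `^ q; set e := `|psi x| `^ q.
    set f := `|phi k x - u x| `^ q => e0 d0 f0 K0 h1 h2 h4.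
    have h5 : K * c <= K * (4 * (f + d)) by exact: ler_wpM2l.
    have h6 : 0 <= K * e by exact: mulr_ge0.
    have h7 : 0 <= K * d by exact: mulr_ge0.
    have h8 : 0 <= K * f by exact: mulr_ge0.
    nra.
  + move: zw; apply: filterS => x hx _.
    have : (fun k => z k x - w x) @ \oo --> (0 : R).
      by rewrite -(subrr (w x)); apply: cvgB; [exact: hx|exact: cvg_cst].
    by move=> /(cvg_norm_powR q0); rewrite normr0 powR0// gt_eqF.
Qed.

End approximable_functions.

(* The mass, too, is used below only through the lemmas above. *)
#[global] Opaque mass.

(** * Absolute values and quotients in the completion *)

Section smooth_absolute_value.
Context {R : realType}.
Implicit Types (a b e : R).

(** [sqrt(a^2 + e^2)], written as a real power so that [smooth_powR] applies. *)
Definition soft_abs e a : R := (a * a + e * e) `^ 2^-1.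

Lemma soft_absE e a : soft_abs e a = Num.sqrt (a ^+ 2 + e ^+ 2).
Proof. by rewrite /soft_abs powR12_sqrt -!expr2// addr_ge0 ?sqr_ge0. Qed.

Lemma soft_abs_ge0 e a : 0 <= soft_abs e a. Proof. exact: powR_ge0. Qed.

Lemma soft_abs0 e : 0 <= e -> soft_abs e 0 = e.
Proof. by move=> e0; rewrite soft_absE expr0n add0r sqrtr_sqr ger0_norm. Qed.

Lemma le_soft_abs e a : `|a| <= soft_abs e a.
Proof.
rewrite soft_absE -[leLHS]sqrtr_sqr.
by apply: ler_wsqrtr; rewrite lerDl sqr_ge0.
Qed.

Lemma soft_abs_le e a : 0 <= e -> soft_abs e a <= `|a| + e.
Proof.
move=> e0; have H : 0 <= `|a| + e by rewrite addr_ge0.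
rewrite soft_absE -[leRHS](ger0_norm H) -[leRHS]sqrtr_sqr.
apply: ler_wsqrtr; rewrite sqrrD real_normK ?num_real//.
by rewrite -addrA lerD2l lerDr mulrn_wge0// mulr_ge0.
Qed.

Lemma soft_abs_lipschitz e a b : 0 < e -> `|soft_abs e a - soft_abs e b| <= `|a - b|.
Proof.
move=> e0; have A0 : 0 < soft_abs e a by rewrite powR_gt0// ltr_wpDl ?mulr_gt0// -expr2 sqr_ge0.
have AB : 0 < soft_abs e a + soft_abs e b by rewrite ltr_wpDr ?soft_abs_ge0.
rewrite -(ler_pM2r AB) -{1}(ger0_norm (ltW AB)) -normrM.
have -> : (soft_abs e a - soft_abs e b) * (soft_abs e a + soft_abs e b) = (a - b) * (a + b).
  rewrite -!subr_sqr !soft_absE !sqr_sqrtr ?addr_ge0 ?sqr_ge0//; ring.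
rewrite normrM ler_wpM2l//; apply: le_trans (ler_normD _ _) _.
by apply: lerD; exact: le_soft_abs.
Qed.

Lemma cvg_soft_abs (a : nat -> R) (l : R) : a @ \oo --> l ->
  (fun k => soft_abs (2^-1 ^+ k) (a k)) @ \oo --> `|l|.
Proof.
move=> al; have nl : (fun k => `|a k|) @ \oo --> `|l| by exact: cvg_norm.
have half0 := @cvg_exprV2 R.
apply: (@squeeze_cvgr _ _ _ _ (fun k => `|a k|) (fun k => `|a k| + 2^-1 ^+ k)) => //.
- by apply: nearW => k; rewrite le_soft_abs soft_abs_le// exprn_ge0.
- by rewrite -[X in _ --> X]addr0; exact: cvgD.
Qed.

Lemma smooth_soft_abs N (phi : 'rV[R]_N -> R) e : 0 < e -> smooth phi ->
  smooth (fun x => soft_abs e (phi x)).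
Proof.
move=> e0 sp; apply: smooth_powR.
  by move=> x; rewrite ltr_wpDl ?mulr_gt0// -expr2 sqr_ge0.
by apply: smoothD; [exact: smoothM|exact: smooth_cst].
Qed.

End smooth_absolute_value.

Section lipschitz_images.
Context {R : realType} {N : nat}.
Variables (Omega : set 'rV[R]_N) (s q : R).
Hypothesis s01 : 0 < s < 1.
Hypothesis q12 : 1 < q < 2.
Hypothesis oO : open Omega.
Local Notation leb := (@lebesgue_rV R N).
Local Notation approximable := (approximable Omega s q).
Implicit Types (u v w phi psi : 'rV[R]_N -> R).

(** Subtracting the value at [0] makes the smoothed absolute values of test
    functions vanish where these do. *)
Lemma approximable_abs u : approximable u -> approximable (fun x => `|u x|).
Proof.
move=> au; have [mu u0 _ _ _] := au.
have [phi [tphi gphi Mphi aphi]] := approximable_seq q12 oO au.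
pose z k x := soft_abs (2^-1 ^+ k) (phi k x) - 2^-1 ^+ k.
have tz k : test_function Omega (z k).
  apply: (test_function_support (tphi k) (tphi k)).
    apply: smoothD; last exact: smooth_cst.
    by apply: smooth_soft_abs; [exact: exprV2_gt0|case: (tphi k)].
  by move=> x px _; rewrite /z px soft_abs0 ?subrr// ltW.
apply: (@approximable_lipschitz _ _ _ _ _ s01 q12 oO 1 phi z u u) => //.
- by apply: cvge0_of_exprV2 => k; rewrite gagliardo2_ge0 gphi.
- by apply: cvge0_of_exprV2 => k; rewrite pmass_ge0 Mphi.
- exact: measurableT_comp.
- by move=> x /u0 ->; rewrite normr0.
- move: aphi; apply: filterS => x hx; rewrite -[X in _ --> X]subr0.
  by apply: cvgB; [exact: (cvg_soft_abs hx)|exact: cvg_exprV2].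
- move=> k x y; rewrite mul1r /z opprB addrA subrK.
  by apply: le_trans (soft_abs_lipschitz _ _ (exprV2_gt0 R k)) _; rewrite lerDl.
- move=> x y; rewrite mul1r; apply: le_trans (ler_dist_dist _ _) _.
  by rewrite lerDl.
- move=> k x; rewrite mul1r /z -[X in _ - X](soft_abs0 (ltW (exprV2_gt0 R k))).
  apply: le_trans (soft_abs_lipschitz _ _ (exprV2_gt0 R k)) _.
  by rewrite subr0 lerDl.
- by move=> x; rewrite normr_id mul1r lerDl.
Qed.

(** The numerators are bounded, by [M ^+ 2], and the denominators are bounded
    away from zero, by [e]. *)
Lemma ratio_lipschitz (M e a a' b b' : R) : 0 <= M -> 0 < e -> `|a| <= M -> `|a'| <= M ->
  0 <= b -> 0 <= b' ->
  `|a ^+ 2 / (b + e) - a' ^+ 2 / (b' + e)| <=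
    (2 * M / e + M ^+ 2 / e ^+ 2) * (`|b - b'| + `|a - a'|).
Proof.
move=> M0 e0 aM aM' b0 b'0.
have B0 : 0 < b + e by rewrite ltr_wpDl.
have B'0 : 0 < b' + e by rewrite ltr_wpDl.
have -> : a ^+ 2 / (b + e) - a' ^+ 2 / (b' + e) =
    (a - a') * ((a + a') / (b + e)) + (b' - b) * (a' ^+ 2 / ((b + e) * (b' + e))).
  by field; rewrite !gt_eqF.
apply: le_trans (ler_normD _ _) _.
have h1 : `|(a + a') / (b + e)| <= 2 * M / e.
  rewrite normrM normfV (gtr0_norm B0) ler_pM ?invr_ge0// ?(ltW B0)//.
    by apply: le_trans (ler_normD _ _) _; rewrite mulr2n mulrDl mul1r lerD.
  by rewrite lef_pV2 ?posrE// lerDr.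
have h2 : `|a' ^+ 2 / ((b + e) * (b' + e))| <= M ^+ 2 / e ^+ 2.
  rewrite normrM normfV normrX (gtr0_norm (mulr_gt0 B0 B'0)).
  apply: ler_pM; rewrite ?exprn_ge0 ?invr_ge0//.
  - by rewrite mulr_ge0// ltW.
  - by rewrite lerXn2r ?nnegrE.
  - rewrite lef_pV2 ?posrE ?exprn_gt0 ?mulr_gt0// expr2.
    by apply: ler_pM; rewrite ?lerDr// ltW.
rewrite normrM [`|(b' - b) * _|]normrM [`|b' - b|]distrC.
have k1 : 0 <= 2 * M / e by rewrite divr_ge0 ?mulr_ge0// ltW.
have k2 : 0 <= M ^+ 2 / e ^+ 2 by rewrite divr_ge0 ?sqr_ge0.
apply: le_trans (lerD (ler_wpM2l (normr_ge0 _) h1) (ler_wpM2l (normr_ge0 _) h2)) _.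
have gen (p r K1 K2 : R) : 0 <= p -> 0 <= r -> 0 <= K1 -> 0 <= K2 ->
    p * K1 + r * K2 <= (K1 + K2) * (r + p) by move=> *; nra.
exact: gen.
Qed.

(** The quotients used as test functions in Picone's inequality. *)
Lemma approximable_ratio phi u (e : R) : 0 < e -> test_function Omega phi ->
  approximable u -> approximable (fun x => phi x ^+ 2 / (`|u x| + e)).
Proof.
move=> e0 tp au; have [mu u0 _ _ _] := au.
have [r [M [L [_ M0 _ [_ pM _]]]]] := test_function_bounds tp.
have [phik [tphi gphi Mphi aphi]] := approximable_seq q12 oO au.
have mp := test_function_measurable tp.
pose z k x := phi x ^+ 2 / (soft_abs (2^-1 ^+ k) (phik k x) + e).
have tz k : test_function Omega (z k).
  apply: (test_function_support tp tp); last first.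
    by move=> x px _; rewrite /z px expr0n mul0r.
  have B0 x : 0 < soft_abs (2^-1 ^+ k) (phik k x) + e by rewrite ltr_wpDl ?soft_abs_ge0.
  rewrite (_ : z k = fun x => (phi x * phi x) * (soft_abs (2^-1 ^+ k) (phik k x) + e) `^ (-1)).
    have [sp _ _] := tp; have [spk _ _] := tphi k.
    apply: smoothM; first exact: smoothM.
    apply: smooth_powR => //; apply: smoothD; last exact: smooth_cst.
    exact: smooth_soft_abs.
  by apply/funext => x; rewrite powR_inv1 ?expr2// ltW.
pose C := 2 * M / e + M ^+ 2 / e ^+ 2.
have C1 : 0 <= 2 * M / e by rewrite divr_ge0 ?mulr_ge0// ltW.
have C2 : 0 <= M ^+ 2 / e ^+ 2 by rewrite divr_ge0 ?sqr_ge0.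
have C0 : 0 <= C by rewrite addr_ge0.
have zero (a b : R) : `|a| <= M -> 0 <= b -> `|a ^+ 2 / (b + e)| <= C * `|a|.
  move=> aM b0; have := ratio_lipschitz M0 e0 aM (_ : `|0| <= M) b0 b0.
  by rewrite normr0 => /(_ M0); rewrite expr0n mul0r !subr0 subrr normr0 add0r.
apply: (@approximable_lipschitz _ _ _ _ _ s01 q12 oO C phik z u phi) => //.
- exact: approximable_test.
- by apply: cvge0_of_exprV2 => k; rewrite gagliardo2_ge0 gphi.
- by apply: cvge0_of_exprV2 => k; rewrite pmass_ge0 Mphi.
- apply: measurable_funM; first exact: measurable_funX.
  rewrite (_ : (fun _ => _) = fun x => (`|u x| + e) `^ (-1)).
    apply: (@measurableT_comp _ _ _ _ _ _ (@powR R ^~ (-1))).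
      exact: measurable_powR.
    by apply: measurable_funD => //; exact: measurableT_comp.
  by apply/funext => x; rewrite powR_inv1// addr_ge0// ltW.
- by move=> x xO; rewrite (test_function0 tp xO) expr0n mul0r.
- move: aphi; apply: filterS => x hx.
  apply: cvgM; first exact: cvg_cst.
  apply: cvgV; first by rewrite gt_eqF// ltr_wpDl.
  by apply: cvgD; [exact: (cvg_soft_abs hx)|exact: cvg_cst].
- move=> k x y; apply: le_trans (ratio_lipschitz M0 e0 (pM x) (pM y)
    (soft_abs_ge0 _ _) (soft_abs_ge0 _ _)) _.
  by rewrite ler_wpM2l// lerD2r soft_abs_lipschitz.
- move=> x y; apply: le_trans (ratio_lipschitz M0 e0 (pM x) (pM y)
    (normr_ge0 _) (normr_ge0 _)) _.
  by rewrite ler_wpM2l// lerD2r ler_dist_dist.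
- move=> k x; apply: le_trans (zero _ _ (pM x) (soft_abs_ge0 _ _)) _.
  by rewrite ler_wpM2l// lerDr.
- move=> x; apply: le_trans (zero _ _ (pM x) (normr_ge0 _)) _.
  by rewrite ler_wpM2l// lerDr.
Qed.

End lipschitz_images.

(** * The Poincare inequality *)

Section first_eigenvalue.
Context {R : realType} {N : nat}.
Variables (Omega : set 'rV[R]_N) (s q : R).
Hypothesis s01 : 0 < s < 1.
Hypothesis q12 : 1 < q < 2.
Hypothesis oO : open Omega.
Hypothesis O0 : Omega !=set0.
Hypothesis lam0 : (0 < lambda1 Omega s q)%E.
Local Notation leb := (@lebesgue_rV R N).
Local Notation leb2 := (leb \x leb)%E.
Local Notation approximable := (approximable Omega s q).
Local Notation gform := (gform s).
Local Notation mass := (mass Omega q).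
Implicit Types (u v w phi psi : 'rV[R]_N -> R).

Let q0 : 0 < q. Proof. by case/andP: q12 => ? _; lra. Qed.
Let q1 : 1 < q. Proof. by case/andP: q12. Qed.
Let q2 : q < 2. Proof. by case/andP: q12. Qed.
Let q02 : 0 < q < 2. Proof. by rewrite q0 q2. Qed.
Let mO : measurable Omega. Proof. exact: open_measurable_rV. Qed.

(** By continuity the function exceeds half its value at [x0] on a whole box. *)
Lemma test_function_mass_gt0 phi x0 : test_function Omega phi -> Omega x0 ->
  phi x0 != 0 -> 0 < mass phi.
Proof.
move=> tp Ox0 p0; have mp := test_function_measurable tp.
have [sp _ _] := tp; have cp := smooth_continuous sp.
pose c := `|phi x0| / 2; have c0 : 0 < c by rewrite divr_gt0 ?normr_gt0.
have : nbhs x0 (Omega `&` [set x | c < `|phi x|]).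
  apply: filterI; first exact: open_nbhs_nbhs.
  have cn : (fun x => `|phi x|) @ x0 --> `|phi x0|.
    by apply: (@continuous_comp _ _ _ phi Num.norm); [exact: cp|exact: norm_continuous].
  have cp0 : c < `|phi x0|.
    by rewrite /c ltr_pdivrMr// ltr_pMr ?normr_gt0// ltr1n.
  exact: (cn [set y | c < y] (lt_nbhsr cp0)).
move=> /nbhs_ballP[e /= e0 eO].
pose r := e / 2; have r0 : 0 < r by rewrite divr_gt0.
have bO : rV_box x0 r `<=` Omega `&` [set x | c < `|phi x|].
  move=> x xb; apply: eO; split => // i j; rewrite (ord1 i).
  rewrite /ball/= distrC; apply: le_lt_trans (xb j) _.
  by rewrite /r ltr_pdivrMr// ltr_pMr// ltr1n.
rewrite -lte_fin -massE//; last exact: test_function_mass tp q0 mO.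
apply: (@lt_le_trans _ _ (\int[leb]_(x in Omega) ((c `^ q)%:E * (\1_(rV_box x0 r) x)%:E))%E).
  rewrite ge0_integralZl_EFin ?powR_ge0//; last first.
    by apply/measurable_EFinP; apply: measurable_indic; exact: measurable_rV_box.
  rewrite integral_indic//; last exact: measurable_rV_box.
  rewrite (setIidl (subset_trans bO (@subIsetl _ _ _))).
  have := lebesgue_rV_box x0 (ltW r0) => /= e1.
  apply: mule_gt0; first by rewrite lte_fin powR_gt0.
  by rewrite [X in (_ < X)%E]e1 lte_fin exprn_gt0// mulr_gt0.
apply: ge0_le_integral => //.
- by move=> x _; rewrite -EFinM lee_fin mulr_ge0 ?powR_ge0.
- apply: measurable_funeM; apply/measurable_EFinP; apply: measurable_indic.
  exact: measurable_rV_box.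
- exact: measurable_norm_powRE.
move=> x _; rewrite -EFinM lee_fin indicE; have [xb|xb] := boolP (x \in _).
  rewrite mulr1 ge0_ler_powR ?nnegrE// ?ltW//.
  by have [_ /=] := bO x (set_mem xb).
by rewrite mulr0 powR_ge0.
Qed.

Lemma Lq_massZ u a : measurable_fun setT u -> (Lq_mass Omega q u < +oo)%E ->
  Lq_mass Omega q (fun x => a * u x) = (`|a| `^ q * mass u)%:E.
Proof.
move=> mu Mu; rewrite EFinM -massE//; exact: pmassZ.
Qed.

Lemma exists_normalized u : approximable u -> 0 < mass u -> exists2 c, 0 < c &
  Lq_mass Omega q (fun x => c * u x) = 1%E.
Proof.
move=> [mu _ _ Mu _] M0; exists (mass u `^ (- q^-1)); first by rewrite powR_gt0.
rewrite Lq_massZ// ger0_norm ?powR_ge0// -powRrM mulNr mulVf ?gt_eqF//.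
by rewrite powR_inv1 ?mulVf ?gt_eqF// ltW.
Qed.

Definition lam : R := fine (lambda1 Omega s q).

Lemma lambda1_le_test phi : test_function Omega phi -> Lq_mass Omega q phi = 1%E ->
  (lambda1 Omega s q <= gagliardo2 s phi)%E.
Proof. by move=> tp M1; apply: ereal_inf_lbound; exists phi. Qed.

Lemma test_functionZ phi c : test_function Omega phi ->
  test_function Omega (fun x => c * phi x).
Proof.
move=> tp; rewrite (_ : (fun _ => _) = fun x => c * phi x + 0 * phi x).
  exact: test_functionD.
by apply/funext => x; rewrite mul0r addr0.
Qed.

Lemma lambda1E : lambda1 Omega s q = lam%:E.
Proof.
rewrite /lam fineK// ge0_fin_numE; last exact: ltW.
have [phi tp [x0 Ox0 p0]] := exists_test_function oO O0.
have M0 := test_function_mass_gt0 tp Ox0 p0.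
have [c c0 c1] := exists_normalized (approximable_test s01 q12 oO tp) M0.
apply: le_lt_trans (lambda1_le_test (test_functionZ c tp) c1) _.
exact: test_function_gagliardo (test_functionZ c tp).
Qed.

Lemma lam_gt0 : 0 < lam.
Proof. by rewrite -lte_fin -lambda1E. Qed.

Lemma gformZ u a : L2 leb2 (dquot s u) ->
  gform (fun x => a * u x) (fun x => a * u x) = a ^+ 2 * gform u u.
Proof.
move=> Lu; have := gform_sqr_lin a 0 Lu Lu.
rewrite (_ : (fun x => a * u x + 0 * u x) = fun x => a * u x); last first.
  by apply/funext => x; rewrite mul0r addr0.
by move=> ->; ring.
Qed.

Lemma poincare_test phi : test_function Omega phi ->
  lam * mass phi `^ (2 / q) <= gform phi phi.
Proof.
move=> tp; have ap := approximable_test s01 q12 oO tp.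
have [mp _ Lp Mp _] := ap.
have := mass_ge0 Omega q phi; rewrite le_eqVlt => /predU1P[<-|M0].
  by rewrite powR0 ?mulr0 ?gform_ge0// gt_eqF// divr_gt0.
have [c c0 c1] := exists_normalized ap M0.
have := lambda1_le_test (test_functionZ c tp) c1.
rewrite lambda1E gagliardo2_gform; last exact: test_function_L2 (test_functionZ c tp).
rewrite gformZ// lee_fin => h.
move: c1; rewrite Lq_massZ// (gtr0_norm c0) => -[c1].
have M2 : mass phi `^ (2 / q) = c ^- 2.
  have -> : mass phi = c `^ (- q).
    have cq : c `^ q != 0 by rewrite gt_eqF// powR_gt0.
    by apply: (mulfI cq); rewrite c1 powRN mulfV.
  rewrite -powRrM (_ : - q * (2 / q) = - 2%:R); last by field; rewrite gt_eqF.
  by rewrite powR_invn// ltW.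
by rewrite M2 ler_pdivrMr ?exprn_gt0// mulrC.
Qed.

Lemma gform_seq_le u (phi : nat -> 'rV[R]_N -> R) (t : R) : 0 < t -> approximable u ->
  (forall k, test_function Omega (phi k)) ->
  gagliardo2 s (fun x => phi k x - u x) @[k --> \oo] --> 0%E ->
  exists k0, forall k, (k0 <= k)%N -> gform (phi k) (phi k) <= (1 + t) * gform u u + t.
Proof.
move=> t0 [mu _ Lu _ _] tphi gphi.
have t1 : 0 < 1 + t^-1 by rewrite addr_gt0 ?invr_gt0.
have [k0 hk0] := (cvge0P (fun k => gagliardo2_ge0 s _)).1 gphi _ (divr_gt0 t0 t1).
exists k0 => k /hk0.
have Lp := test_function_L2 s01 (tphi k).
rewrite gagliardo2_gform; last exact: L2_dquotB.
rewrite lee_fin ler_pdivlMr// mulrC => h.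
by apply: le_trans (gform_young t0 Lu Lp) _; rewrite lerD2l.
Qed.

(** The inequality passes from test functions to their limits: [gform_young]
    bounds the forms of the approximants from above, and Fatou's lemma bounds
    the mass of the limit by theirs. *)
Lemma poincare u : approximable u -> lam * mass u `^ (2 / q) <= gform u u.
Proof.
move=> au; have [mu u0 Lu Mu _] := au.
have [phi [tphi gphi Mphi aphi]] := approximable_seq q12 oO au.
have gphi0 : gagliardo2 s (fun x => phi k x - u x) @[k --> \oo] --> 0%E.
  by apply: cvge0_of_exprV2 => k; rewrite gagliardo2_ge0 gphi.
have l0 := lam_gt0; have E0 := gform_ge0 s u.
have qh : 0 < q / 2 by rewrite divr_gt0.
have key (t : R) : 0 < t -> lam * mass u `^ (2 / q) <= (1 + t) * gform u u + t.
  move=> t0; have [k0 hk0] := gform_seq_le t0 au tphi gphi0.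
  pose B := ((1 + t) * gform u u + t) / lam.
  have B0 : 0 <= B by rewrite divr_ge0 ?(ltW l0)// addr_ge0 ?(ltW t0)// mulr_ge0// addr_ge0// ltW.
  have pB y : 0 <= y -> lam * y `^ (2 / q) <= (1 + t) * gform u u + t -> y <= B `^ (q / 2).
    move=> y0 h; have -> : y = (y `^ (2 / q)) `^ (q / 2).
      by rewrite -powRrM (_ : 2 / q * (q / 2) = 1) ?powRr1//; field; rewrite gt_eqF.
    apply: ge0_ler_powR; rewrite ?nnegrE ?powR_ge0//; first exact: ltW.
    by rewrite ler_pdivlMr// mulrC.
  have uB : mass u <= B `^ (q / 2).
    rewrite -lee_fin -massE//.
    apply: (@integral_le_of_ae_cvg _ _ _ leb Omega mO
      (fun k x => `|phi (k + k0)%N x| `^ q)).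
    - by move=> k; apply: measurable_norm_powR; exact: test_function_measurable (tphi _).
    - exact: measurable_norm_powR.
    - by move=> k x _; exact: powR_ge0.
    - by move=> x _; exact: powR_ge0.
    - move: aphi; apply: filterS => x hx _; apply: (cvg_norm_powR q0).
      by have := hx; rewrite -(cvg_shiftn k0); exact.
    - move=> k; have [_ _ _ Mk _] := approximable_test s01 q12 oO (tphi (k + k0)%N).
      rewrite -[X in (X <= _)%E]/(Lq_mass Omega q _) massE// lee_fin; apply: pB.
        exact: mass_ge0.
      apply: le_trans (poincare_test (tphi _)) _; apply: hk0; exact: leq_addl.
  have uq : mass u `^ (2 / q) <= B.
    have : mass u `^ (2 / q) <= (B `^ (q / 2)) `^ (2 / q).
      apply: ge0_ler_powR; rewrite ?nnegrE ?powR_ge0 ?mass_ge0//.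
      by rewrite divr_ge0// ltW.
    by rewrite -powRrM (_ : q / 2 * (2 / q) = 1) ?powRr1//; field; rewrite gt_eqF.
  by rewrite mulrC -ler_pdivlMr.
apply/ler_addgt0Pr => e e0.
have E1 : 0 < gform u u + 1 by rewrite ltr_wpDl.
apply: le_trans (key _ (divr_gt0 e0 E1)) _.
rewrite le_eqVlt; apply/orP; left; apply/eqP; field.
by rewrite gt_eqF.
Qed.

(** * The energy and its minimizing sequences *)

Let l0 : 0 < lam. Proof. exact: lam_gt0. Qed.
Let p1 : 1 < 2 / q. Proof. by rewrite ltr_pdivlMr// mul1r. Qed.

(** The constrained problem, made free: with this multiplier the minimizers
    over the whole space are those of the constrained problem, by
    [energy_minimizer], and unlike the constraint the energy behaves well under
    maxima and minima. *)
Definition energy u : R := gform u u - 2 * lam / q * mass u.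

Definition min_energy : R := lam * (1 - 2 / q).

(** By homogeneity the energy is at least a function of the mass alone, which
    has a strict minimum at mass [1] since [2 / q > 1]. *)
Lemma energy_ge_mass u : approximable u ->
  lam * (mass u `^ (2 / q) - 2 / q * mass u) <= energy u.
Proof.
move=> au; rewrite /energy mulrBr lerB//; first exact: poincare.
by rewrite le_eqVlt; apply/orP; left; apply/eqP; ring.
Qed.

Lemma min_energy_le u : approximable u -> min_energy <= energy u.
Proof.
move=> au; apply: le_trans (energy_ge_mass au); rewrite ler_pM2l//.
by have := bernoulli_powR p1 (mass_ge0 Omega q u); lra.
Qed.

Lemma energy_minimizer u : approximable u -> energy u <= min_energy ->
  mass u = 1 /\ gform u u = lam.
Proof.
move=> au; rewrite /energy => h; have m1 : mass u = 1.
  apply/eqP/negPn/negP => mn1.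
  have B := bernoulli_powR_strict p1 (mass_ge0 Omega q u) mn1.
  have := le_trans (energy_ge_mass au) h; rewrite ler_pM2l//.
  by move: B; lra.
split => //; have := poincare au.
have e : 2 * lam / q = lam * (2 / q) by ring.
move: h; rewrite m1 powR1 !mulr1 e /min_energy mulrBr mulr1 => h P.
by apply/eqP; rewrite eq_le; apply/andP; split => //; lra.
Qed.

(** Coercivity: the tangent of [m `^ p] at the point [a] where
    [a `^ (p - 1) = 2] has slope [2 p], so [m `^ p - p * m] grows at least like
    [p * m]. *)
Lemma mass_bounded (C : R) : exists B, forall u, approximable u ->
  energy u <= C -> mass u <= B.
Proof.
pose p := 2 / q; pose a : R := 2 `^ (p - 1)^-1.
have a0 : 0 < a by rewrite powR_gt0.
exists ((C / lam - a `^ p + p * 2 * a) / p) => u au uC.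
have := le_trans (energy_ge_mass au) uC; rewrite mulrC -ler_pdivlMr// -/p => h.
have := powR_tangent a (mass u - a) p1.
rewrite [a + _]addrC subrK (ger0_norm (mass_ge0 _ _ _)) (gtr0_norm a0).
have -> : a `^ (2 / q - 2) * a = 2.
  have an0 : a != 0 by rewrite gt_eqF.
  rewrite -[X in _ * X](powRr1 (ltW a0)) -powRD ?an0 ?implybT//.
  rewrite (_ : 2 / q - 2 + 1 = p - 1); last by rewrite /p; ring.
  rewrite /a -powRrM mulVf ?powRr1// gt_eqF// subr_gt0; exact: p1.
rewrite -/p ler_pdivlMr; last by apply: lt_trans p1.
by move: h; lra.
Qed.

Lemma integrable_norm_powR u : approximable u ->
  leb.-integrable Omega (EFin \o (fun x => `|u x| `^ q)).
Proof.
move=> [mu _ _ Mu _]; apply/integrableP; split; first exact: measurable_norm_powRE.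
rewrite (eq_integral (fun x => (`|u x| `^ q)%:E)); first exact: Mu.
by move=> x _; rewrite gee0_abs ?lee_fin ?powR_ge0.
Qed.

Lemma mass_add_le u1 u2 v1 v2 :
  approximable u1 -> approximable u2 -> approximable v1 -> approximable v2 ->
  (forall x, `|u1 x| `^ q + `|u2 x| `^ q <= `|v1 x| `^ q + `|v2 x| `^ q) ->
  mass u1 + mass u2 <= mass v1 + mass v2.
Proof.
move=> /integrable_norm_powR i1 /integrable_norm_powR i2.
move=> /integrable_norm_powR i3 /integrable_norm_powR i4 h.
rewrite !massR -(RintegralD mO i1 i2) -(RintegralD mO i3 i4).
apply: (le_Rintegral mO (integrableD mO i1 i2) (integrableD mO i3 i4)) => x _.
exact: h.
Qed.

Lemma mass_split_le u v (t : R) : 0 < t -> approximable u -> approximable v ->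
  mass u <= (1 + t) ^+ 2 * mass v + (1 + t^-1) ^+ 2 * mass (fun x => u x - v x).
Proof.
move=> t0 au av; have iu := integrable_norm_powR au; have iv := integrable_norm_powR av.
have id := integrable_norm_powR (approximableB q12 oO au av).
have iv' := integrableZl mO ((1 + t) ^+ 2) iv.
have id' := integrableZl mO ((1 + t^-1) ^+ 2) id.
rewrite !massR -(RintegralZl _ mO iv) -(RintegralZl _ mO id) -(RintegralD mO iv' id').
apply: (le_Rintegral mO iu (integrableD mO iv' id')) => x _.
exact: powR_norm_split.
Qed.

Lemma le_mass u v : approximable u -> approximable v ->
  (forall x, `|u x| <= `|v x|) -> mass u <= mass v.
Proof.
move=> [m1 _ _ M1 _] [m2 _ _ M2 _] h.
have := le_pmass leb mO q02 m1 m2 (fun x _ => h x).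
by rewrite -!Lq_massE (massE M1) (massE M2).
Qed.

Lemma approximable_max u v : approximable u -> approximable v ->
  approximable (fun x => Num.max (u x) (v x)).
Proof.
move=> au av; rewrite (_ : (fun _ => _) =
    fun x => 1 * (2^-1 * u x + 2^-1 * v x) + 2^-1 * `|u x - v x|).
  exact: (approximable_lin q12 oO 1 2^-1 (approximable_lin q12 oO 2^-1 2^-1 au av)
    (approximable_abs s01 q12 oO (approximableB q12 oO au av))).
apply/funext => x; have [h|h] := leP (u x) (v x).
  by rewrite ler0_norm ?subr_le0//; field.
by rewrite gtr0_norm ?subr_gt0//; field.
Qed.

Lemma approximable_min u v : approximable u -> approximable v ->
  approximable (fun x => Num.min (u x) (v x)).
Proof.
move=> au av; rewrite (_ : (fun _ => _) =
    fun x => 1 * (2^-1 * u x + 2^-1 * v x) + (- 2^-1) * `|u x - v x|).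
  exact: (approximable_lin q12 oO 1 (- 2^-1) (approximable_lin q12 oO 2^-1 2^-1 au av)
    (approximable_abs s01 q12 oO (approximableB q12 oO au av))).
apply/funext => x; have [h|h] := leP (u x) (v x).
  by rewrite ler0_norm ?subr_le0//; field.
by rewrite gtr0_norm ?subr_gt0//; field.
Qed.

Lemma mass_maxmin u v : approximable u -> approximable v ->
  mass (fun x => Num.max (u x) (v x)) + mass (fun x => Num.min (u x) (v x)) =
  mass u + mass v.
Proof.
move=> au av; have aM := approximable_max au av; have am := approximable_min au av.
have E x : `|Num.max (u x) (v x)| `^ q + `|Num.min (u x) (v x)| `^ q =
    `|u x| `^ q + `|v x| `^ q.
  by have [h|h] := leP (u x) (v x) => //; rewrite addrC.
apply/eqP; rewrite eq_le (mass_add_le aM am au av) ?(mass_add_le au av aM am)// => x.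
  by rewrite E.
by rewrite E.
Qed.

(** Submodularity: rearranging two values into their maximum and minimum at
    each point does not increase the seminorms. *)
Lemma energy_submodular u v : approximable u -> approximable v ->
  energy (fun x => Num.max (u x) (v x)) + energy (fun x => Num.min (u x) (v x)) <=
  energy u + energy v.
Proof.
move=> au av; have aM := approximable_max au av; have am := approximable_min au av.
have [_ _ Lu _ _] := au; have [_ _ Lv _ _] := av.
have [_ _ LM _ _] := aM; have [_ _ Lm _ _] := am.
have := mass_maxmin au av.
have := gform_add_le LM Lm Lu Lv.
rewrite /energy; set k := 2 * lam / q => h hm.
have {}h : gform (fun x => Num.max (u x) (v x)) (fun x => Num.max (u x) (v x)) +
    gform (fun x => Num.min (u x) (v x)) (fun x => Num.min (u x) (v x)) <=
    gform u u + gform v v.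
  apply: h => x y; case: (leP (u x) (v x)) => h1; case: (leP (u y) (v y)) => h2.
  - by rewrite addrC.
  - have : 0 <= 2 * ((v x - u x) * (u y - v y)).
      by rewrite mulr_ge0// mulr_ge0 ?subr_ge0// ltW.
    by move=> h3; rewrite -subr_ge0; move: h3; congr (_ <= _); ring.
  - have : 0 <= 2 * ((u x - v x) * (v y - u y)).
      by rewrite mulr_ge0// mulr_ge0 ?subr_ge0// ltW.
    by move=> h3; rewrite -subr_ge0; move: h3; congr (_ <= _); ring.
  - by [].
move: h hm; move: (mass _) (mass _) (mass _) (mass _) => a b c d.
move: (gform _ _) (gform _ _) (gform _ _) (gform _ _) => A B C D h hm.
have -> : b = c + d - a by lra.
by lra.
Qed.

Lemma energy_abs_le u : approximable u -> energy (fun x => `|u x|) <= energy u.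
Proof.
move=> au; have aa := approximable_abs s01 q12 oO au.
have [_ _ Lu _ _] := au; have [_ _ La _ _] := aa.
rewrite /energy (eq_mass Omega q (v := u)); last by move=> x; rewrite normr_id.
apply: lerB; last by [].
rewrite -(lerD2r (gform u u)); apply: (gform_add_le La Lu Lu Lu) => x y.
rewrite lerD2r -real_normK ?num_real// -[leRHS]real_normK ?num_real//.
by rewrite lerXn2r ?nnegrE// ler_dist_dist.
Qed.

Lemma exists_minimizing_sequence : exists u : nat -> 'rV[R]_N -> R,
  forall n, [/\ approximable (u n), (forall x, 0 <= u n x) &
    energy (u n) <= min_energy + 2^-1 ^+ n].
Proof.
have H n : exists phi, [/\ test_function Omega phi, Lq_mass Omega q phi = 1%E &
    (gagliardo2 s phi < (lam + 2^-1 ^+ n)%:E)%E].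
  have : (lambda1 Omega s q < (lam + 2^-1 ^+ n)%:E)%E.
    by rewrite lambda1E lte_fin ltrDl exprV2_gt0.
  by move=> /ereal_inf_lt[_ [phi [tp M1] <-] h]; exists phi.
have [phi hphi] := choice H.
exists (fun n x => `|phi n x|) => n; have [tp M1 h] := hphi n.
have ap := approximable_test s01 q12 oO tp; have [_ _ Lp _ _] := ap.
split; [exact: (approximable_abs s01 q12 oO ap)|by move=> x; exact: normr_ge0|].
apply: le_trans (energy_abs_le ap) _.
rewrite /energy /min_energy (mass1 M1) mulr1.
move: h; rewrite (gagliardo2_gform Lp) lte_fin => h.
have e : 2 * lam / q = lam * (2 / q) by ring.
by rewrite e mulrBr mulr1; lra.
Qed.

(** The parallelogram identity, with the energy of the midpoint bounded below by
    the minimum and its mass by that of [min(u, v)]. *)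
Lemma energy_midpoint u v : approximable u -> approximable v ->
  (forall x, 0 <= u x) -> (forall x, 0 <= v x) ->
  gform (fun x => u x - v x) (fun x => u x - v x) <=
  2 * (energy u - min_energy) + 2 * (energy v - min_energy) +
  4 * lam / q * (mass (fun x => Num.max (u x) (v x)) -
                 mass (fun x => Num.min (u x) (v x))).
Proof.
move=> au av u0 v0; have am := approximable_min au av.
have [_ _ Lu _ _] := au; have [_ _ Lv _ _] := av.
pose m x := 2^-1 * u x + 2^-1 * v x.
have amid : approximable m := approximable_lin q12 oO 2^-1 2^-1 au av.
have J := min_energy_le amid.
have mm : mass (fun x => Num.min (u x) (v x)) <= mass m.
  apply: (le_mass am amid) => x; rewrite !ger0_norm ?le_min ?u0 ?v0//; last first.
    by rewrite addr_ge0 ?mulr_ge0.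
  by rewrite /m; have [h|h] := leP (u x) (v x); lra.
have hm := mass_maxmin au av.
have k0 : 0 <= 2 * lam / q by rewrite divr_ge0 ?mulr_ge0 ?ltW.
have {}mm := ler_wpM2l k0 mm.
move: J; rewrite /energy (gform_sqr_lin _ _ Lu Lv) (gform_sqrB Lu Lv).
have -> : 4 * lam / q = 2 * (2 * lam / q) by ring.
move: hm mm; move: (2 * lam / q) (mass (fun x => Num.max _ _)) (mass (fun x => Num.min _ _))
  (mass u) (mass v) (mass m) (gform u u) (gform v v) (gform u v) min_energy => k M1 M2 a b c A B C e hm mm J.
have hk : k * M1 + k * M2 = k * a + k * b by rewrite -!mulrDr hm.
rewrite -subr_ge0.
rewrite (_ : _ - _ = 4 * (2^-1 ^+ 2 * A + 2 * 2^-1 * 2^-1 * C + 2^-1 ^+ 2 * B - k * c - e) +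
  4 * (k * c - k * M2) + 2 * (k * M1 + k * M2 - (k * a + k * b))); last by field.
by rewrite hk subrr mulr0 addr0 addr_ge0// mulr_ge0// subr_ge0.
Qed.

(** Superadditivity of [x `^ q] on nonnegative numbers. *)
Lemma mass_dist_le u v : approximable u -> approximable v ->
  (forall x, 0 <= u x) -> (forall x, 0 <= v x) ->
  mass (fun x => u x - v x) <= mass (fun x => Num.max (u x) (v x)) -
                 mass (fun x => Num.min (u x) (v x)).
Proof.
move=> au av u0 v0; have am := approximable_min au av.
have aM := approximable_max au av; have ad := approximableB q12 oO au av.
have az : approximable (fun=> 0).
  rewrite (_ : (fun=> 0) = fun x => u x - u x); first exact: approximableB.
  by apply/funext => x; rewrite subrr.
rewrite lerBrDr -[leRHS]addr0 -(mass_cst0 Omega q12); apply: (mass_add_le ad am aM az) => x.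
rewrite normr0 powR0 ?gt_eqF// addr0 -lerBrDr.
have [h|h] := leP (u x) (v x).
  rewrite distrC !ger0_norm ?subr_ge0//.
  by apply: powR_superadd; [exact: ltW|rewrite u0].
rewrite !ger0_norm ?subr_ge0//; last exact: ltW.
by apply: powR_superadd; [exact: ltW|rewrite v0 ltW].
Qed.

(** Maxima of ever longer stretches of a minimizing sequence still almost
    minimize, by submodularity, and they are monotone; choosing them nearly
    exhausting gives a sequence that is Cauchy in [L^q]. *)
Lemma exists_monotone_minimizing_sequence : exists z : nat -> 'rV[R]_N -> R,
  [/\ forall n, approximable (z n), forall n x, 0 <= z n x,
    forall n, energy (z n) <= min_energy + 2 * 2^-1 ^+ n &
    forall e, 0 < e -> exists n0, forall n m, (n0 <= n)%N -> (n <= m)%N ->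
      mass (fun x => Num.max (z n x) (z m x)) -
      mass (fun x => Num.min (z n x) (z m x)) <= e].
Proof.
have [u hu] := exists_minimizing_sequence.
have au n : approximable (u n) by case: (hu n).
have u0 n x : 0 <= u n x by case: (hu n).
pose w n := fix w k : 'rV[R]_N -> R := match k with
  | 0 => u n
  | k'.+1 => fun x => Num.max (w k' x) (u (n + k'.+1)%N x) end.
have aw n k : approximable (w n k).
  by elim: k => [|k IH]; [exact: au|exact: approximable_max IH (au _)].
have w0 n k x : 0 <= w n k x.
  by elim: k => [|k IH] //=; rewrite le_max IH.
have lin (A B C D e x y : R) : C <= e + 2 * x - 2 * y -> D <= e + y -> e <= B ->
    A + B <= C + D -> A <= e + 2 * x - y by lra.
have lin2 (M1 M2 a b Sn Sm l x y d : R) : 0 < d -> M1 + M2 = a + b -> M1 <= Sn ->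
    Sn - x < a -> Sm - y < b -> l <= Sm -> Sn - l <= d / 4 -> x <= d / 4 -> y <= d / 4 ->
    M1 - M2 <= d by lra.
have Jw n k : energy (w n k) <= min_energy + 2 * 2^-1 ^+ n - 2^-1 ^+ (n + k).
  elim: k => [|k IH].
    have [_ _ h] := hu n; rewrite addn0 (_ : _ - _ = min_energy + 2^-1 ^+ n)//.
    by ring.
  have [_ _ h] := hu (n + k.+1)%N.
  have am := min_energy_le (approximable_min (aw n k) (au (n + k.+1)%N)).
  have := energy_submodular (aw n k) (au (n + k.+1)%N).
  have e2 : (2^-1 : R) ^+ (n + k) = 2 * 2^-1 ^+ (n + k.+1).
    by rewrite addnS exprS mulrA mulfV ?mul1r.
  move: IH h am; rewrite e2 /=; exact: lin.
have wS n k x : w n k x <= w n k.+1 x by rewrite /= le_max lexx.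
have wle n k l x : (k <= l)%N -> w n k x <= w n l x.
  elim: l => [|l IH]; first by rewrite leqn0 => /eqP ->.
  rewrite leq_eqVlt => /predU1P[->//|]; rewrite ltnS => /IH h.
  exact: le_trans h (wS _ _ _).
have wn n k x : w n.+1 k x <= w n k.+1 x.
  elim: k => [|k IH].
    by rewrite /= addn1 le_max lexx orbT.
  rewrite [w n.+1 k.+1 x]/= ge_max; apply/andP; split.
    exact: le_trans IH (wS _ _ _).
  by rewrite [w n k.+2 x]/= le_max addSnnS lexx orbT.
have wnd n d k x : w (n + d)%N k x <= w n (k + d)%N x.
  elim: d n k => [|d IH] n k; first by rewrite !addn0.
  rewrite addnS -addSn; apply: le_trans (IH _ _) _.
  by apply: le_trans (wn _ _ _) _; rewrite addnS.
have mw n k n' k' : (forall x, w n k x <= w n' k' x) -> mass (w n k) <= mass (w n' k').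
  by move=> h; apply: (le_mass (aw n k) (aw n' k')) => x; rewrite !ger0_norm.
have [B hB] := mass_bounded (min_energy + 2).
have wB n k : mass (w n k) <= B.
  apply: (hB _ (aw n k)); apply: le_trans (Jw n k) _.
  have : (2^-1 : R) ^+ n <= 1 by rewrite exprn_ile1// invf_le1// ler1n.
  by have := exprV2_gt0 R (n + k); lra.
pose S n := sup [set mass (w n k) | k in setT].
have hsup n : has_sup [set mass (w n k) | k in setT].
  split; first by exists (mass (w n 0%N)), 0%N.
  by exists B => _ [k _ <-].
have leS n k : mass (w n k) <= S n by apply: sup_upper_bound => //; exists k.
have hk n : exists k, S n - 2^-1 ^+ n < mass (w n k).
  have [_ [k _ <-] h] := sup_adherent (exprV2_gt0 R n) (hsup n).
  by exists k.
have [kk hkk] := choice hk.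
have Sdec n : S n.+1 <= S n.
  apply: ge_sup; first by exists (mass (w n.+1 0%N)), 0%N.
  by move=> _ [k _ <-]; apply: le_trans (leS n k.+1); apply: mw => x; exact: wn.
have S0 n : 0 <= S n by apply: le_trans (leS n 0%N); exact: mass_ge0.
have Scvg : cvgn S.
  apply: nonincreasing_is_cvgn; first by apply/nonincreasing_seqP.
  by exists 0 => _ [n _ <-].
pose L := limn S.
have Snd : nonincreasing_seq S := (nonincreasing_seqP S).1 Sdec.
have SL n : L <= S n := nonincreasing_cvgn_ge Snd Scvg n.
exists (fun n => w n (kk n)); split => [n|n x|n|]; [exact: aw|exact: w0|..].
  by apply: le_trans (Jw _ _) _; have := exprV2_gt0 R (n + kk n); lra.
move=> e e0; have e4 : 0 < e / 4 by rewrite divr_gt0.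
have [n1 _ hn1] : \forall n \near \oo, S n - L <= e / 4.
  have /cvgrPdist_le/(_ _ e4) : S @ \oo --> L by exact: Scvg.
  apply: filterS => n; rewrite distrC => h; exact: le_trans (ler_norm _) h.
have [n2 _ hn2] : \forall n \near \oo, (2^-1 : R) ^+ n <= e / 4.
  have /cvgr0Pnorm_le/(_ _ e4) := (@cvg_exprV2 R).
  by apply: filterS => n h; exact: le_trans (ler_norm _) h.
exists (maxn n1 n2) => n m; rewrite geq_max => /andP[h1 h2] nm.
have hM : mass (fun x => Num.max (w n (kk n) x) (w m (kk m) x)) <= S n.
  apply: le_trans (leS n (maxn (kk n) (kk m + (m - n)))%N).
  apply: (le_mass (approximable_max (aw n (kk n)) (aw m (kk m))) (aw _ _)) => x.
  rewrite !ger0_norm ?le_max ?w0// ge_max; apply/andP; split.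
    by apply: wle; exact: leq_maxl.
  apply: (@le_trans _ _ (w n (kk m + (m - n))%N x)); last first.
    by apply: wle; exact: leq_maxr.
  by rewrite -{1}(subnKC nm); exact: wnd.
exact: (lin2 _ _ _ _ _ _ _ _ _ _ e0 (mass_maxmin (aw n (kk n)) (aw m (kk m))) hM
  (hkk n) (hkk m) (SL m) (hn1 n h1) (hn2 n h2) (hn2 m (leq_trans h2 nm))).
Qed.

(** * Existence of a minimizer *)

Lemma half_ratio (F : realFieldType) (k e : F) : 0 <= k -> 0 < e ->
  k * (e / (2 * (k + 1))) <= e / 2.
Proof.
move=> k0 e0; have k1 : 0 < k + 1 by rewrite ltr_wpDl.
rewrite (_ : _ * _ = e / 2 * (k / (k + 1))); last by field; rewrite gt_eqF.
by rewrite ger_pMr ?divr_gt0// ler_pdivrMr// mul1r lerDl.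
Qed.

(** A monotone minimizing sequence is Cauchy in mass, hence by
    [energy_midpoint] also for the form. Its limit has minimal energy because
    both [gform] and [mass] pass to the limit. *)
Lemma exists_energy_minimizer : exists2 w, approximable w & energy w <= min_energy.
Proof.
have [z [az z0 Jz Dz]] := exists_monotone_minimizing_sequence.
have mz n : measurable_fun setT (z n) by case: (az n).
have k0 : 0 <= 4 * lam / q by rewrite divr_ge0 ?mulr_ge0 ?ltW.
have half0 := @cvg_exprV2 R.
have wlogle (P : nat -> nat -> Prop) n0 : (forall j k, P j k -> P k j) ->
    (forall j k, (n0 <= j)%N -> (j <= k)%N -> P j k) ->
    forall j k, (n0 <= j)%N -> (n0 <= k)%N -> P j k.
  move=> sym h j k hj hk; have [jk|/ltnW kj] := leqP j k; first exact: h.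
  by apply: sym; exact: h.
have cauchy_mass (e : R) : 0 < e -> exists n0, forall j k, (n0 <= j)%N -> (n0 <= k)%N ->
    (Lq_mass Omega q (fun x => z j x - z k x)%R < e%:E)%E.
  move=> e0; have [n0 hn0] := Dz _ (divr_gt0 e0 (ltr0n _ 2)); exists n0.
  apply: wlogle => [j k|j k hj jk].
    by rewrite Lq_massE pmass_distC.
  have [_ _ _ Md _] := approximableB q12 oO (az j) (az k).
  rewrite (massE Md) lte_fin.
  apply: le_lt_trans (mass_dist_le (az j) (az k) (z0 j) (z0 k)) _.
  by apply: le_lt_trans (hn0 j k hj jk) _; lra.
have lin (A B D c x y e : R) : A <= c + 2 * x -> B <= c + 2 * y -> x <= e / 16 ->
    y <= e / 16 -> D <= e / 2 -> 2 * (A - c) + 2 * (B - c) + D <= e by lra.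
have cauchy_form (e : R) : 0 < e -> exists n0, forall j k, (n0 <= j)%N -> (n0 <= k)%N ->
    (gagliardo2 s (fun x => z j x - z k x)%R <= e%:E)%E.
  move=> e0; have K0 : 0 < 4 * lam / q + 1 by lra.
  have [n0 hn0] := Dz _ (divr_gt0 e0 (mulr_gt0 (ltr0n _ 2) K0)).
  have [n1 _ hn1] : \forall n \near \oo, (2^-1 : R) ^+ n <= e / 16.
    have /cvgr0Pnorm_le/(_ (e / 16) (divr_gt0 e0 (ltr0n _ 16))) := half0.
    by apply: filterS => n h; exact: le_trans (ler_norm _) h.
  exists (maxn n0 n1); apply: wlogle => [j k|j k].
    by rewrite gagliardo2_distC.
  rewrite geq_max => /andP[h0 h1] jk.
  have [_ _ Ld _ _] := approximableB q12 oO (az j) (az k).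
  rewrite (gagliardo2_gform Ld) lee_fin.
  apply: le_trans (energy_midpoint (az j) (az k) (z0 j) (z0 k)) _.
  have D := hn0 j k h0 jk.
  have {}D : 4 * lam / q * (mass (fun x => Num.max (z j x) (z k x)) -
      mass (fun x => Num.min (z j x) (z k x))) <= e / 2.
    apply: le_trans (ler_wpM2l k0 D) _.
    exact: half_ratio k0 e0.
  exact: (lin _ _ _ _ _ _ _ (Jz j) (Jz k) (hn1 j h1) (hn1 k (leq_trans h1 jk)) D).
have [g mg gz] := pmass_complete mO q02 mz cauchy_mass.
(* completeness gives no control of [g] off [Omega] *)
pose w x := g x * \1_Omega x.
have mw : measurable_fun setT w by apply: measurable_funM => //; exact: measurable_indic.
have w0 x : ~ Omega x -> w x = 0.
  by move=> xO; rewrite /w indicE memNset// mulr0.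
have wz : Lq_mass Omega q (fun x => z k x - w x) @[k --> \oo] --> 0%E.
  suff E k : Lq_mass Omega q (fun x => z k x - w x) = pmass leb Omega q (fun x => z k x - g x).
    by under eq_cvg do rewrite E.
  by apply: eq_integral => x xO; rewrite /w indicE xO mulr1.
have [aw gzw] := approximable_complete q12 oO az mw w0 cauchy_form wz.
exists w; first exact: aw.
have [_ _ Lw _ _] := aw.
have Ld k : L2 leb2 (dquot s (fun x => z k x - w x)).
  by have [_ _ ? _ _] := approximableB q12 oO (az k) aw.
have md0 : (fun k => mass (fun x => z k x - w x)) @ \oo --> (0 : R).
  exact: cvg_mass0 wz.
have gd0 : (fun k => gform (fun x => z k x - w x) (fun x => z k x - w x)) @ \oo --> (0 : R).
  have : (fun k => (gform (fun x => z k x - w x) (fun x => z k x - w x))%:E) @ \oo --> 0%E.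
    by move: gzw; under eq_cvg do rewrite (gagliardo2_gform (Ld _)).
  by move=> /fine_cvgP[_].
pose k1 := 2 * lam / q; have k10 : 0 <= k1 by rewrite divr_ge0 ?mulr_ge0 ?ltW.
(* only the upper bound on [gform w w] is needed, up to factors [1 + t] *)
have step (t : R) : 0 < t ->
    gform w w <= (1 + t) * (min_energy + k1 * ((1 + t) ^+ 2 * mass w)).
  move=> t0.
  pose X k := (1 + t) * (min_energy + 2 * 2^-1 ^+ k + k1 * ((1 + t) ^+ 2 * mass w +
      (1 + t^-1) ^+ 2 * mass (fun x => z k x - w x))) +
      (1 + t^-1) * gform (fun x => z k x - w x) (fun x => z k x - w x).
  have Xc : X @ \oo --> (1 + t) * (min_energy + 2 * 0 + k1 * ((1 + t) ^+ 2 * mass w +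
      (1 + t^-1) ^+ 2 * 0)) + (1 + t^-1) * 0.
    apply: cvgD; last by apply: cvgM => //; exact: cvg_cst.
    apply: cvgM; first exact: cvg_cst.
    apply: cvgD.
      apply: cvgD; first exact: cvg_cst.
      by apply: cvgM => //; exact: cvg_cst.
    apply: cvgM; first exact: cvg_cst.
    apply: cvgD; first exact: cvg_cst.
    by apply: cvgM => //; exact: cvg_cst.
  rewrite !mulr0 !addr0 in Xc.
  apply: (cvgr_to_ge Xc); apply: nearW => k; rewrite /X.
  have [_ _ Lz _ _] := az k.
  apply: le_trans (gform_young t0 Lz Lw) _.
  rewrite (gform_distC s w).
  rewrite lerD2r ler_pM2l; last by lra.
  have := mass_split_le t0 (az k) aw.
  move=> /(ler_wpM2l k10) h.
  by have := lerD (Jz k) h; rewrite /energy -/k1 subrK.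
rewrite /energy -/k1 lerBlDr; apply/ler_addgt0Pr => e e0.
have m0 := mass_ge0 Omega q w; have kM : 0 <= k1 * mass w by rewrite mulr_ge0.
pose K := 7 * (k1 * mass w) + e + 1; have K0 : 0 < K by rewrite /K; lra.
pose t := e / K; have t0 : 0 < t by rewrite divr_gt0.
have t1 : t <= 1 by rewrite ler_pdivrMr// /K; lra.
have tK : t * (7 * (k1 * mass w)) <= e.
  rewrite mulrAC ler_pdivrMr// ler_pM2l// /K; lra.
apply: le_trans (step t t0) _.
have mle : min_energy <= 0 by rewrite /min_energy mulr_ge0_le0 ?ltW// subr_lt0.
have : t * min_energy <= 0 by rewrite mulr_ge0_le0// ltW.
have : 0 <= (k1 * mass w) * (t * (1 - t) * (4 + t)).
  apply: mulr_ge0 kM _; apply: mulr_ge0; last by lra.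
  by apply: mulr_ge0; [exact: ltW|rewrite subr_ge0].
set A := k1 * mass w in tK *; move=> h1 h2.
have -> : (1 + t) * (min_energy + k1 * ((1 + t) ^+ 2 * mass w)) =
  min_energy + t * min_energy + A * (1 + t) ^+ 3 by rewrite /A; ring.
have -> : A * (1 + t) ^+ 3 = A + t * (7 * A) - A * (t * (1 - t) * (4 + t)) by ring.
lra.
Qed.

(** * Weak solutions *)

Definition pairing u phi : R :=
  \int[leb]_(x in Omega) (`|u x| `^ (q - 2) * u x * phi x).

Definition weak_solution (lambda : R) u : Prop :=
  forall phi, approximable phi -> gform u phi = lambda * pairing u phi.

Lemma measurable_pairing u phi : measurable_fun setT u -> measurable_fun setT phi ->
  measurable_fun Omega (fun x => `|u x| `^ (q - 2) * u x * phi x).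
Proof.
move=> mu mp; apply: measurable_funM; last exact: measurable_funTS.
by apply: measurable_funM; [exact: measurable_norm_powR|exact: measurable_funTS].
Qed.

Lemma integrable_pairing u phi : approximable u -> approximable phi ->
  leb.-integrable Omega (EFin \o (fun x => `|u x| `^ (q - 2) * u x * phi x)).
Proof.
move=> au ap; have [mu _ _ _ _] := au; have [mp _ _ _ _] := ap.
have iu := integrable_norm_powR au; have ip := integrable_norm_powR ap.
apply: (le_integrable mO _ _ (integrableD mO iu ip)).
  by apply/measurable_EFinP; exact: measurable_pairing.
move=> x _; rewrite /= lee_fin [leRHS]ger0_norm ?addr_ge0 ?powR_ge0//.
by rewrite !normrM [`|_ `^ _|]ger0_norm ?powR_ge0// powR_young_le.
Qed.

Lemma pairingE u phi : approximable u -> approximable phi ->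
  (\int[leb]_(x in Omega) (`|u x| `^ (q - 2) * u x * phi x)%:E = (pairing u phi)%:E)%E.
Proof.
move=> au ap; rewrite /pairing /Rintegral fineK//.
by apply: integrable_fin_num => //; exact: integrable_pairing.
Qed.

Lemma pairing_self u : pairing u u = mass u.
Proof. by rewrite massR; apply: eq_Rintegral => x _; exact: (powR_norm_sqr _ q0). Qed.

Lemma mass_tangent u phi (t : R) : approximable u -> approximable phi ->
  mass u + q * t * pairing u phi <= mass (fun x => u x + t * phi x).
Proof.
move=> au ap.
have at' : approximable (fun x => u x + t * phi x).
  rewrite (_ : (fun _ => _) = fun x => 1 * u x + t * phi x).
    exact: approximable_lin.
  by apply/funext => x; rewrite mul1r.
have iu := integrable_norm_powR au; have it := integrable_norm_powR at'.
have ip := integrable_pairing au ap.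
rewrite !massR /pairing -RintegralZl//.
rewrite -RintegralD//; last exact: (integrableZl mO (q * t) ip).
apply: le_Rintegral => //.
  exact: (integrableD mO iu (integrableZl mO (q * t) ip)).
move=> x _; apply: le_trans (powR_tangent _ _ q1).
by rewrite le_eqVlt; apply/orP; left; apply/eqP; ring.
Qed.

Lemma quadratic_linear_part (a b : R) : 0 <= b ->
  (forall t : R, 0 <= 2 * t * a + t ^+ 2 * b) -> a = 0.
Proof.
move=> b0 h; apply/eqP/negPn/negP => a0.
have b1 : 0 < b + 1 by rewrite ltr_wpDl.
(* close to the minimum point [- a / b], and defined also for [b = 0] *)
have := h (- (a / (b + 1))).
rewrite (_ : _ + _ = - (a ^+ 2 * (b + 2) / (b + 1) ^+ 2)); last first.
  by field; rewrite gt_eqF.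
rewrite oppr_ge0 leNgt divr_gt0 ?exprn_gt0// mulr_gt0//; last by lra.
by rewrite lt0r sqrf_eq0 a0 sqr_ge0.
Qed.

(** Convexity of the mass bounds the energy along the line [u + t phi] by a
    quadratic polynomial in [t] which is minimal at [t = 0]; this replaces
    differentiation under the integral sign. *)
Lemma euler_lagrange u : approximable u -> energy u <= min_energy ->
  weak_solution lam u.
Proof.
move=> au um phi ap; have [_ _ Lu _ _] := au; have [_ _ Lp _ _] := ap.
apply/eqP; rewrite -subr_eq0; apply/eqP.
apply: (quadratic_linear_part (gform_ge0 s phi)) => t.
have at' : approximable (fun x => 1 * u x + t * phi x) := approximable_lin q12 oO 1 t au ap.
have J := le_trans um (min_energy_le at').
have T := mass_tangent t au ap.
have E : (fun x => 1 * u x + t * phi x) = (fun x => u x + t * phi x).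
  by apply/funext => x; rewrite mul1r.
move: J; rewrite /energy (gform_sqr_lin _ _ Lu Lp) E.
have k0 : 0 <= 2 * lam / q by rewrite divr_ge0 ?mulr_ge0 ?ltW// lam_gt0.
have := ler_wpM2l k0 T; rewrite mulrDr.
rewrite (_ : 2 * lam / q * (q * t * _) = 2 * lam * t * pairing u phi); last first.
  by field; rewrite gt_eqF.
have lin (A B C D F P l : R) : A + 2 * l * t * P <= B ->
    C - A <= 1 ^+ 2 * C + 2 * 1 * t * D + t ^+ 2 * F - B ->
    0 <= 2 * t * (D - l * P) + t ^+ 2 * F.
  by rewrite -subr_ge0 => h1; rewrite -subr_ge0 => h2; have := addr_ge0 h1 h2;
    congr (_ <= _); ring.
exact: lin.
Qed.

(** * Eigenfunctions, minimizers and normalization *)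

Lemma mass_eq0_ae u : approximable u -> mass u = 0 -> \forall x \ae leb, u x = 0.
Proof.
move=> [mu u0 _ Mu _] m0.
have mf : measurable_fun Omega (fun x => `|u x| `^ q) by exact: measurable_norm_powR.
have I0 : (\int[leb]_(x in Omega) (`|u x| `^ q)%:E = 0)%E.
  by have := massE Mu; rewrite m0.
have := ae_eq0_of_integral mO mf (fun x _ => powR_ge0 _ _) I0; apply: filterS => x h.
have [Ox|nOx] := pselect (Omega x); last exact: u0.
exact/normr0_eq0/(powR_eq0_eq0 (h Ox)).
Qed.

Lemma Lq_norm_mass u : approximable u -> Lq_norm Omega q u = (mass u `^ q^-1)%:E.
Proof. by move=> [_ _ _ Mu _]; rewrite /Lq_norm (massE Mu). Qed.

(** Multiplying an eigenfunction by a constant rescales the factor in front of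
    the right-hand side; at unit mass that factor is the eigenvalue itself. *)
Lemma eigenfunction_weak (mu : R) v : eigenfunction Omega s q mu v ->
  [/\ 0 < mu, approximable v, 0 < mass v &
      weak_solution (mu * mass v `^ ((2 - q) / q)) v].
Proof.
move=> [mu0 /(approximableP s01 q12 oO) av vn0 hv].
have M0 : 0 < mass v.
  rewrite lt0r mass_ge0 andbT; apply/negP => /eqP /(mass_eq0_ae av); exact: vn0.
split=> // phi ap.
have := hv _ ((approximableP s01 q12 oO phi).2 ap).
have [_ _ Lv _ _] := av; have [_ _ Lp _ _] := ap.
rewrite (gagliardo_form_gform Lv Lp) (Lq_norm_mass av) (pairingE av ap).
rewrite poweR_EFin -!EFinM => -[->]; congr (_ * _ * _).
by rewrite -powRrM mulrC.
Qed.

Lemma weak_eigenfunction (mu : R) u : 0 < mu -> approximable u -> mass u = 1 ->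
  weak_solution mu u -> eigenfunction Omega s q mu u.
Proof.
move=> mu0 au m1 wu; split=> //.
- exact/(approximableP s01 q12 oO).
- move=> u0; have [mu' _ _ Mu _] := au.
  have : Lq_mass Omega q u = 0%E.
    rewrite /Lq_mass (ae_eq_integral (cst 0%E)) ?integral0//.
      exact: measurable_norm_powRE.
    by apply: filterS u0 => x -> _ /=; rewrite normr0 powR0// gt_eqF.
  by rewrite (massE Mu) m1 => -[] /eqP; rewrite oner_eq0.
- move=> phi /(approximableP s01 q12 oO) ap.
  have [_ _ Lu _ _] := au; have [_ _ Lp _ _] := ap.
  rewrite (gagliardo_form_gform Lu Lp) (Lq_norm_mass au) (pairingE au ap).
  by rewrite poweR_EFin m1 !powR1 -!EFinM mulr1 (wu _ ap).
Qed.

Lemma approximableZ u (c : R) : approximable u -> approximable (fun x => c * u x).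
Proof.
move=> au; rewrite (_ : (fun _ => _) = fun x => c * u x + 0 * u x).
  exact: (approximable_lin q12 oO c 0 au au).
by apply/funext => x; rewrite mul0r addr0.
Qed.

Lemma pairingZ u phi (c : R) : 0 < c -> approximable u -> approximable phi ->
  pairing (fun x => c * u x) phi = c `^ (q - 1) * pairing u phi.
Proof.
move=> c0 au ap; rewrite /pairing -(RintegralZl _ mO (integrable_pairing au ap)).
apply: eq_Rintegral => x _.
rewrite normrM powRM// gtr0_norm// (_ : q - 1 = q - 2 + 1); last by ring.
have ac (A B C D E : R) : A * B * (C * D) * E = A * C * (B * D * E) by ring.
by rewrite [c `^ (_ + 1)]powRD ?powRr1 ?ltW ?(gt_eqF c0) ?implybT//; exact: ac.
Qed.

Lemma eigenfunction_normalize (mu : R) v : eigenfunction Omega s q mu v ->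
  exists2 c : R, 0 < c & let u := fun x => c * v x in
    [/\ approximable u, mass u = 1 & weak_solution mu u].
Proof.
move=> /eigenfunction_weak [mu0 av M0 wv].
have [mv _ Lv Mv _] := av.
exists (mass v `^ (- q^-1)); first exact: powR_gt0.
set c := mass v `^ _; have c0 : 0 < c by exact: powR_gt0.
split; first exact: approximableZ.
  apply: mass1; rewrite (Lq_massZ _ mv Mv); rewrite gtr0_norm// /c -powRrM.
  by rewrite mulNr mulVf ?gt_eqF// powR_inv1 ?ltW// mulVf// gt_eqF.
move=> phi ap; have [_ _ Lp _ _] := ap.
rewrite (_ : (fun x => c * v x) = fun x => c * v x + 0 * v x); last first.
  by apply/funext => x; rewrite mul0r addr0.
rewrite (gform_lin _ _ Lv Lv Lp).
rewrite (_ : (fun _ => _) = fun x => c * v x); last first.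
  by apply/funext => x; rewrite mul0r addr0.
rewrite (pairingZ c0 av ap) (wv _ ap) mul0r addr0.
rewrite (_ : c `^ (q - 1) = c * mass v `^ ((2 - q) / q)); first by ring.
rewrite -[c in c * _]powRr1 ?ltW// /c -!powRrM -powRD; last by rewrite (gt_eqF M0) implybT.
by congr (_ `^ _); field; rewrite gt_eqF.
Qed.

Lemma minimizer_of_energy u : approximable u -> energy u <= min_energy ->
  minimizer Omega s q u /\ gagliardo2 s u = lambda1 Omega s q.
Proof.
move=> au eu; have [m1 gu] := energy_minimizer au eu.
have [_ _ Lu Mu _] := au.
have gl : gagliardo2 s u = lambda1 Omega s q.
  by rewrite (gagliardo2_gform Lu) gu lambda1E.
split=> //; split.
  by split; [exact/(approximableP s01 q12 oO)|rewrite (massE Mu) m1].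
move=> v [/(approximableP s01 q12 oO) av v1].
have [_ _ Lv Mv _] := av.
rewrite gl (gagliardo2_gform Lv) lambda1E lee_fin.
have := poincare av.
by rewrite (mass1 v1) powR1 mulr1.
Qed.

Lemma energy_of_gform u : mass u = 1 -> gform u u <= lam -> energy u <= min_energy.
Proof.
move=> m1 gu; rewrite /energy /min_energy m1.
have lin (g l k : R) : g <= l -> g - 2 * l / k * 1 <= l * (1 - 2 / k).
  move=> h; rewrite mulr1 mulrBr mulr1 lerB//.
  by rewrite mulrA [l * 2]mulrC.
exact: lin.
Qed.

Lemma energy_of_minimizer v : minimizer Omega s q v ->
  approximable v /\ energy v <= min_energy.
Proof.
move=> [[/(approximableP s01 q12 oO) av v1] vmin]; split=> //.
have [w aw ew] := exists_energy_minimizer.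
have [[wad _] wl] := minimizer_of_energy aw ew.
apply: (energy_of_gform (mass1 v1)).
have [_ _ Lv _ _] := av.
have := vmin _ wad; rewrite wl (gagliardo2_gform Lv).
by rewrite lambda1E lee_fin.
Qed.

Lemma energy_of_weak u : approximable u -> mass u = 1 -> weak_solution lam u ->
  energy u <= min_energy.
Proof.
move=> au m1 wu; apply: (energy_of_gform m1).
by rewrite (wu _ au) (pairing_self) m1 mulr1.
Qed.

(** * Uniqueness and sign of minimizers *)

Lemma squeeze_add (F : realDomainType) (a b m : F) :
  a + b <= m + m -> m <= a -> m <= b -> a <= m /\ b <= m.
Proof. by move=> h ma mb; split; lra. Qed.

(** Passing to the absolute value preserves the mass and decreases the
    increment of [u] strictly at any pair where [u] changes sign; so for a
    minimizer such pairs form a null set. It is a rectangle, hence one of its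
    sides is null. *)
Lemma minimizer_sign u : approximable u -> energy u <= min_energy ->
  (\forall x \ae leb, u x = `|u x|) \/ (\forall x \ae leb, u x = - `|u x|).
Proof.
move=> au eu; have aa := approximable_abs s01 q12 oO au.
have ea := le_trans (energy_abs_le au) eu.
have [_ gu] := energy_minimizer au eu.
have [_ ga] := energy_minimizer aa ea.
have [mu _ Lu _ _] := au; have [ma _ La _ _] := aa.
pose f z := dquot s u z ^+ 2 - dquot s (fun x => `|u x|) z ^+ 2.
have f0 z : 0 <= f z.
  rewrite subr_ge0 -real_normK ?num_real// -[leRHS]real_normK ?num_real//.
  rewrite lerXn2r ?nnegrE// !normrM ler_wpM2r//; exact: ler_dist_dist.
have mf : measurable_fun setT f.
  by apply: measurable_funB; apply: measurable_funX; apply: measurable_dquot.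
have If : (\int[leb2]_z (f z)%:E = 0)%E.
  rewrite (eq_integral (fun z => (dquot s u z ^+ 2)%:E -
      (dquot s (fun x => `|u x|)%R z ^+ 2)%:E)%E); last by [].
  rewrite integralB//; [|exact: L2_integrable_sqr Lu|exact: L2_integrable_sqr La].
  by rewrite -!gagliardo2E (gagliardo2_gform Lu) (gagliardo2_gform La) gu ga subee.
have opp : \forall z \ae leb2, ~ (0 < u z.1 /\ u z.2 < 0).
  apply: filterS (ae_eq0_of_integral measurableT mf (fun z _ => f0 z) If) => z /(_ I) fz [u1 u2].
  have zz : z.1 != z.2 by apply/eqP => E; move: u1 u2; rewrite E => /lt_trans h /h; rewrite ltxx.
  have := gkernel_gt0 s zz; move: fz; rewrite /f /dquot (gtr0_norm u1) (ltr0_norm u2).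
  have lin (a b k : R) : 0 < a -> b < 0 -> 0 < k ->
      ((a - b) * k) ^+ 2 - ((a - - b) * k) ^+ 2 = 0 -> False.
    move=> a0 b0 k0 /eqP; rewrite (_ : _ - _ = - (4 * (a * b) * k ^+ 2)); last by ring.
    by rewrite oppr_eq0 !mulf_eq0 (gt_eqF a0) (lt_eqF b0) (gt_eqF k0) /= pnatr_eq0.
  by move=> h k; exact: (lin _ _ _ u1 u2 k h).
have mset (P : set R) : measurable P -> measurable (u @^-1` P).
  by move=> mP; rewrite -[X in measurable X]setTI; exact: mu.
have := @ae_rectangle _ _ _ _ _ leb leb [set x | 0 < u x] [set x | u x < 0].
case.
- rewrite (_ : [set x | _] = u @^-1` `]0, +oo[%classic); first exact: mset.
  by apply/seteqP; split => x /=; rewrite in_itv/= andbT.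
- rewrite (_ : [set x | _] = u @^-1` `]-oo, 0[%classic); first exact: mset.
  by apply/seteqP; split => x /=; rewrite in_itv.
- exact: opp.
- move=> h; right; apply: filterS h => x /negP; rewrite -leNgt => ux.
  by rewrite ler0_norm// opprK.
- move=> h; left; apply: filterS h => x /negP; rewrite -leNgt => ux.
  by rewrite ger0_norm.
Qed.

(** By submodularity the maximum and the minimum of two minimizers are
    minimizers, so they have equal mass; but the difference of their masses
    bounds the distance of [u] and [v]. *)
Lemma nonneg_minimizer_unique u v : approximable u -> approximable v ->
  (forall x, 0 <= u x) -> (forall x, 0 <= v x) ->
  energy u <= min_energy -> energy v <= min_energy -> \forall x \ae leb, u x = v x.
Proof.
move=> au av u0 v0 eu ev.
have aM := approximable_max au av.
have am := approximable_min au av.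
have sub := energy_submodular au av.
have JM := min_energy_le aM.
have Jm := min_energy_le am.
have sub2 := le_trans sub (lerD eu ev).
have [eM em] := squeeze_add sub2 JM Jm.
have [mM _] := energy_minimizer aM eM.
have [mm _] := energy_minimizer am em.
have ad := approximableB q12 oO au av.
have := mass_dist_le au av u0 v0; rewrite mM mm subrr => h.
have d0 : mass (fun x => u x - v x) = 0 by apply/eqP; rewrite eq_le h mass_ge0.
by apply: filterS (mass_eq0_ae ad d0) => x /eqP; rewrite subr_eq0 => /eqP.
Qed.

Lemma minimizer_unique u v : approximable u -> approximable v ->
  energy u <= min_energy -> energy v <= min_energy ->
  exists2 c : R, c = 1 \/ c = - 1 & \forall x \ae leb, v x = c * `|u x|.
Proof.
move=> au av eu ev.
have aau := approximable_abs s01 q12 oO au; have aav := approximable_abs s01 q12 oO av.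
have eau := le_trans (energy_abs_le au) eu.
have eav := le_trans (energy_abs_le av) ev.
have uv := nonneg_minimizer_unique aau aav (fun=> normr_ge0 _) (fun=> normr_ge0 _) eau eav.
case: (minimizer_sign av ev) => sv; [exists 1|exists (- 1)]; [by left| |by right|];
  apply: filterS2 uv sv => x <-; first by rewrite mul1r.
by rewrite mulN1r.
Qed.

Lemma weak_solution_abs (mu c : R) u : approximable u -> c = 1 \/ c = - 1 ->
  (\forall x \ae leb, `|u x| = c * u x) -> weak_solution mu u ->
  weak_solution mu (fun x => `|u x|).
Proof.
move=> au c1 uc wu phi ap.
have aa := approximable_abs s01 q12 oO au.
have [mu' _ Lu _ _] := au; have [mp _ Lp _ _] := ap; have [ma _ La _ _] := aa.
have G : gform (fun x => `|u x|) phi = c * gform u phi.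
  have E : (gagliardo_form s (fun x => `|u x|)%R phi =
            gagliardo_form s (fun x => c * u x + 0 * u x)%R phi)%E.
    rewrite !gagliardo_formE; apply: ae_eq_integral => //.
    - by apply/measurable_EFinP; apply: measurable_funM; exact: measurable_dquot.
    - apply/measurable_EFinP; apply: measurable_funM; apply: measurable_dquot => //.
      by apply: measurable_funD; exact: measurable_funM.
    - have h1 := @ae_fst _ _ _ _ _ leb leb _ uc; have h2 := @ae_snd _ _ _ _ _ leb leb _ uc.
      by apply: filterS2 h1 h2 => z z1 z2 _; rewrite /dquot z1 z2 !mul0r !addr0.
  move: E; rewrite (gagliardo_form_gform La Lp) gagliardo_form_gform//; last exact: L2_dquot_lin.
  by rewrite (gform_lin _ _ Lu Lu Lp) mul0r addr0 => -[].
have P : pairing (fun x => `|u x|) phi = c * pairing u phi.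
  rewrite /pairing -(RintegralZl _ mO (integrable_pairing au ap)).
  congr fine; apply: ae_eq_integral => //.
  - by apply/measurable_EFinP; exact: measurable_pairing.
  - apply/measurable_EFinP; apply: measurable_funM => //; exact: measurable_pairing.
  - by apply: filterS uc => x ux _; rewrite normr_id {2}ux; congr EFin; ring.
by rewrite G P (wu _ ap); ring.
Qed.

(** * Picone's inequality *)

(** The left-hand side is the defect in Picone's inequality for the functions
    taking the values [a], [b] and [p], [r] at two points. *)
Lemma picone_identity (F : realFieldType) (a b p r g e : F) : 0 <= a -> 0 <= b -> 0 < e ->
  ((p - r) * g) ^+ 2 - (a - b) * g * ((p ^+ 2 / (a + e) - r ^+ 2 / (b + e)) * g) =
  (g * ((a + e) * r - (b + e) * p)) ^+ 2 / ((a + e) * (b + e)).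
Proof.
move=> a0 b0 e0.
have ae : a + e != 0 by rewrite gt_eqF// ltr_wpDl.
have be : b + e != 0 by rewrite gt_eqF// ltr_wpDl.
by field; rewrite ae be.
Qed.

Section comparison.
Variables (u phi : 'rV[R]_N -> R) (mu : R).
Hypotheses (au : approximable u) (tp : test_function Omega phi).
Hypotheses (u0 : forall x, 0 <= u x) (mu0 : 0 < mu) (wu : weak_solution mu u).

Let e (k : nat) : R := k.+1%:R^-1.
Let e0 k : 0 < e k. Proof. by rewrite invr_gt0. Qed.
Let ecvg : e @ \oo --> (0 : R). Proof. exact: cvg_harmonic. Qed.
Let psi k x := phi x ^+ 2 / (`|u x| + e k).
Let ap : approximable phi. Proof. exact: approximable_test. Qed.
Let apsi k : approximable (psi k).
Proof. exact: approximable_ratio. Qed.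

Let rest k z := dquot s phi z ^+ 2 - dquot s u z * dquot s (psi k) z.

Let restE k z : rest k z =
  (gkernel s z * ((u z.1 + e k) * phi z.2 - (u z.2 + e k) * phi z.1)) ^+ 2 /
  ((u z.1 + e k) * (u z.2 + e k)).
Proof. by rewrite -picone_identity// /rest /dquot /psi !ger0_norm. Qed.

Let rest_ge0 k z : 0 <= rest k z.
Proof.
by rewrite restE divr_ge0 ?sqr_ge0// mulr_ge0// addr_ge0// ltW.
Qed.

Let rest_measurable k : measurable_fun setT (rest k).
Proof.
have [mu' _ _ _ _] := au; have [mp _ _ _ _] := ap; have [ms _ _ _ _] := apsi k.
by apply: measurable_funB; [apply: measurable_funX|apply: measurable_funM];
  exact: measurable_dquot.
Qed.

Let rest_integral k :
  (\int[leb2]_z (rest k z)%:E = (gform phi phi - mu * pairing u (psi k))%:E)%E.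
Proof.
have [_ _ Lu _ _] := au; have [_ _ Lp _ _] := ap; have [_ _ Ls _ _] := apsi k.
rewrite (eq_integral (fun z => (dquot s phi z ^+ 2)%:E -
    (dquot s u z * dquot s (psi k) z)%:E)%E); last by [].
rewrite integralB//; [|exact: L2_integrable_sqr Lp|exact: L2_integrableM Lu Ls].
rewrite -gagliardo2E (gagliardo2_gform Lp) -gagliardo_formE (gagliardo_form_gform Lu Ls).
by rewrite (wu (apsi k)).
Qed.

Let pairing_psi_ge0 k : 0 <= pairing u (psi k).
Proof.
apply: Rintegral_ge0 => x _; apply: mulr_ge0; first by rewrite mulr_ge0 ?powR_ge0.
by rewrite divr_ge0 ?sqr_ge0// addr_ge0// ltW.
Qed.

Let rest_integral_le k : (\int[leb2]_z (rest k z)%:E <= (gform phi phi)%:E)%E.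
Proof. by rewrite rest_integral lee_fin gerBl mulr_ge0 ?(ltW mu0). Qed.

Let mset (v : 'rV[R]_N -> R) (P : set R) : measurable_fun setT v -> measurable P ->
  measurable (v @^-1` P).
Proof. by move=> mv mP; rewrite -[X in measurable X]setTI; exact: mv. Qed.

Let pos : set 'rV[R]_N := [set x | 0 < u x].
Let zero : set 'rV[R]_N := [set x | u x = 0 /\ phi x != 0].

Let mpos : measurable pos.
Proof.
have [mu' _ _ _ _] := au.
rewrite (_ : pos = u @^-1` `]0, +oo[%classic); first exact: mset.
by apply/seteqP; split => x /=; rewrite /pos/= in_itv/= andbT.
Qed.

Let mzero : measurable zero.
Proof.
have [mu' _ _ _ _] := au; have [mp _ _ _ _] := ap.
rewrite (_ : zero = (u @^-1` [set 0]) `&` (phi @^-1` (~` [set 0]))).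
  by apply: measurableI; apply: mset => //; apply: measurableC.
by apply/seteqP; split => x /= [ux /eqP px].
Qed.

(** This replaces the strong minimum principle: on such pairs the defect
    [rest k] blows up like [(e k)^-1], while its integral stays bounded, so
    that [e k * rest k], of integral tending to [0], has a positive limit there;
    this leaves only a null set. *)
Let pos_zero_null : \forall z \ae leb2, ~ (pos z.1 /\ zero z.2).
Proof.
have [mu' _ _ _ _] := au; have [mp _ _ _ _] := ap.
pose D := pos `*` zero.
have mD : measurable D by exact: measurableX.
pose f z := (gkernel s z * phi z.2) ^+ 2 * u z.1.
have mfst (v : 'rV[R]_N -> R) : measurable_fun setT v ->
    measurable_fun setT (fun z : 'rV[R]_N * 'rV[R]_N => v z.1).
  by move=> mv; exact: measurableT_comp.
have msnd (v : 'rV[R]_N -> R) : measurable_fun setT v ->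
    measurable_fun setT (fun z : 'rV[R]_N * 'rV[R]_N => v z.2).
  by move=> mv; exact: measurableT_comp.
have mf : measurable_fun setT f.
  apply: measurable_funM; last exact: mfst.
  apply: measurable_funX; apply: measurable_funM; last exact: msnd.
  exact: measurable_gkernel.
have f0 z : 0 <= f z by rewrite mulr_ge0 ?sqr_ge0.
have cv z : D z -> e k * rest k z @[k --> \oo] --> f z.
  move=> [/= pz [uz _]].
  rewrite (_ : (fun k => _) = fun k =>
      (gkernel s z * ((u z.1 + e k) * phi z.2 - e k * phi z.1)) ^+ 2 / (u z.1 + e k)).
    have cu : u z.1 + e k @[k --> \oo] --> u z.1.
      by rewrite -[X in _ --> X]addr0; apply: cvgD => //; exact: cvg_cst.
    rewrite (_ : f z = (gkernel s z * (u z.1 * phi z.2 - 0 * phi z.1)) ^+ 2 / u z.1).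
      apply: cvgM; last by apply: cvgV => //; rewrite gt_eqF.
      rewrite expr2; under eq_fun do rewrite expr2.
      have ci : gkernel s z * ((u z.1 + e k) * phi z.2 - e k * phi z.1) @[k --> \oo] -->
          gkernel s z * (u z.1 * phi z.2 - 0 * phi z.1).
        apply: cvgM; first exact: cvg_cst.
        by apply: cvgB; apply: cvgM => //; exact: cvg_cst.
      exact: cvgM.
    by rewrite /f; field; rewrite gt_eqF.
  apply/funext => k; rewrite restE uz add0r.
  by field; rewrite !gt_eqF// ltr_wpDl// ltW.
have fle m : (\int[leb2]_(z in D) (f z)%:E <= (e m * gform phi phi)%:E)%E.
  apply: (@integral_le_of_ae_cvg _ _ _ leb2 D mD (fun k z => e (k + m)%N * rest (k + m)%N z)).
  - move=> k; apply: measurable_funTS; exact: measurable_funM.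
  - exact: measurable_funTS.
  - by move=> k z _; rewrite mulr_ge0// ltW.
  - by move=> z _; exact: f0.
  - apply: aeW => z Dz; rewrite (cvg_shiftn m (fun k => e k * rest k z)); exact: cv.
  move=> k; apply: (@le_trans _ _ (\int[leb2]_z (e (k + m)%N * rest (k + m)%N z)%:E)%E).
    apply: ge0_subset_integral => //.
    - by apply/measurable_EFinP; exact: measurable_funM.
    - by move=> z _; rewrite lee_fin mulr_ge0// ltW.
  under eq_integral do rewrite EFinM.
  rewrite ge0_integralZl_EFin//; last first.
  - by rewrite ltW.
  - exact/measurable_EFinP.
  - by move=> z _; rewrite lee_fin.
  apply: (@le_trans _ _ ((e (k + m)%N)%:E * (gform phi phi)%:E)%E).
    by apply: lee_wpmul2l; [rewrite lee_fin ltW|exact: rest_integral_le].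
  rewrite -EFinM lee_fin ler_wpM2r ?gform_ge0// lef_pV2 ?posrE//.
  by rewrite ler_nat ltnS leq_addl.
have f00 : (\int[leb2]_(z in D) (f z)%:E = 0)%E.
  apply/eqP; rewrite eq_le integral_ge0 ?andbT; last by move=> z _; rewrite lee_fin.
  have c0 : (e m * gform phi phi)%:E @[m --> \oo] --> 0%E.
    apply: cvg_EFin; first exact: nearW.
    rewrite -[X in _ --> X](mul0r (gform phi phi)).
    by apply: cvgM => //; exact: cvg_cst.
  by rewrite -(cvg_lim _ c0)//; apply: lime_ge; [exact: cvgP c0|exact: nearW].
have mfD : measurable_fun D f by exact: measurable_funTS.
apply: filterS (ae_eq0_of_integral mD mfD (fun z _ => f0 z) f00) => z h pz.
have [/= u_pos [uz phi_neq0]] := pz.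
have zz : z.1 != z.2 by apply/eqP => E; move: u_pos; rewrite /pos/= E uz ltxx.
have /eqP := h pz; rewrite /f mulf_eq0 expf_eq0 mulf_eq0 /= (negPf phi_neq0) orbF.
by rewrite (gt_eqF (gkernel_gt0 s zz)) (gt_eqF u_pos).
Qed.

Hypotheses (u1 : mass u = 1) (phi1 : Lq_mass Omega q phi = 1%E).

(** As [u] does not vanish almost everywhere, the other side of the rectangle
    is the null one. *)
Let phi_eq0 : \forall x \ae leb, u x = 0 -> phi x = 0.
Proof.
case: (@ae_rectangle _ _ _ _ _ leb leb pos zero mpos mzero pos_zero_null) => [h|].
  have uae0 : \forall x \ae leb, u x = 0.
    by apply: filterS h => x /negP; rewrite -leNgt => ux; apply/eqP; rewrite eq_le ux u0.
  have [_ _ []] := weak_eigenfunction mu0 au u1 wu; exact: uae0.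
apply: filterS => x nz ux; apply/eqP/negPn/negP => px; exact: nz.
Qed.

Let weighted x := `|u x| `^ (q - 2) * phi x ^+ 2.

Let weighted_measurable : measurable_fun setT weighted.
Proof.
have [mu' _ _ _ _] := au; have [mp _ _ _ _] := ap.
by apply: measurable_funM; [exact: measurable_norm_powR|exact: measurable_funX].
Qed.

Let weighted_ge0 x : 0 <= weighted x.
Proof. by rewrite mulr_ge0 ?powR_ge0 ?sqr_ge0. Qed.

(** The weak equation tested against [psi k], the defect being nonnegative,
    gives the bound uniformly in [k]; the limit is [0] where [u] vanishes
    because [phi] vanishes there too. *)
Let weighted_le : (\int[leb]_(x in Omega) (weighted x)%:E <= (gform phi phi / mu)%:E)%E.
Proof.
have [mu' _ _ _ _] := au; have [mp _ _ _ _] := ap.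
apply: (@integral_le_of_ae_cvg _ _ _ leb Omega mO
  (fun k x => `|u x| `^ (q - 2) * u x * psi k x)).
- by move=> k; have [ms _ _ _ _] := apsi k; exact: measurable_pairing.
- exact: measurable_funTS.
- move=> k x _; apply: mulr_ge0; first by rewrite mulr_ge0 ?powR_ge0.
  by rewrite divr_ge0 ?sqr_ge0// addr_ge0// ltW.
- by move=> x _; exact: weighted_ge0.
- apply: filterS phi_eq0 => x phi0 _; have [ux|ux] := eqVneq (u x) 0.
    rewrite /weighted (phi0 ux) expr0n mulr0.
    rewrite (_ : (fun k => _) = fun=> 0); first exact: cvg_cst.
    by apply/funext => k; rewrite ux mulr0 mul0r.
  have cu : `|u x| + e k @[k --> \oo] --> u x.
    by rewrite -[X in _ --> X]addr0 ger0_norm//; apply: cvgD => //; exact: cvg_cst.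
  rewrite (_ : weighted x = `|u x| `^ (q - 2) * u x * (phi x ^+ 2 / u x)); last first.
    by rewrite /weighted; field.
  by apply: cvgM; [exact: cvg_cst|apply: cvgM; [exact: cvg_cst|exact: cvgV]].
- move=> k; rewrite (pairingE au (apsi k)) lee_fin ler_pdivlMr//.
  have : (0 <= \int[leb2]_z (rest k z)%:E)%E.
    by apply: integral_ge0 => z _; rewrite lee_fin.
  by rewrite rest_integral lee_fin subr_ge0 mulrC.
Qed.

(** Young's inequality with weights, integrated, turns the two unit masses into
    the lower bound [1] for the integral of [weighted]. *)
Lemma eigenvalue_le_gform : mu <= gform phi phi.
Proof.
have [mu' _ _ Mu _] := au; have [mp _ _ _ _] := ap.
have qh : 0 <= q / 2 by rewrite divr_ge0// ltW.
have qh' : 0 <= 1 - q / 2.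
  by rewrite subr_ge0 ler_pdivrMr// mul1r ltW//; case/andP: q12.
have mW : measurable_fun Omega (fun x => (weighted x)%:E).
  by apply/measurable_EFinP; exact: measurable_funTS.
have mU : measurable_fun Omega (fun x => (`|u x| `^ q)%:E).
  exact: measurable_norm_powRE.
have mP : measurable_fun Omega (fun x => (`|phi x| `^ q)%:E).
  exact: measurable_norm_powRE.
have W0 x : Omega x -> (0 <= (weighted x)%:E)%E by move=> _; rewrite lee_fin.
have U0 x : Omega x -> (0 <= (`|u x| `^ q)%:E)%E by move=> _; rewrite lee_fin powR_ge0.
have P0 x : Omega x -> (0 <= (`|phi x| `^ q)%:E)%E by move=> _; rewrite lee_fin powR_ge0.
have young : (\int[leb]_(x in Omega) (`|phi x| `^ q)%:E <=
    \int[leb]_(x in Omega) ((q / 2)%:E * (weighted x)%:E +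
                            (1 - q / 2)%:E * (`|u x| `^ q)%:E))%E.
  apply: ae_ge0_le_integral => //.
  - by move=> x Ox; rewrite adde_ge0// mule_ge0 ?lee_fin// ?powR_ge0.
  - by apply: emeasurable_funD; exact: emeasurable_funM.
  apply: filterS phi_eq0 => x phi0 _; rewrite -!EFinM -EFinD lee_fin.
  have [ux|ux] := eqVneq (u x) 0.
    rewrite (phi0 ux) normr0 powR0 ?gt_eqF//.
    by rewrite addr_ge0// mulr_ge0 ?powR_ge0.
  have ux0 : 0 < u x by rewrite lt0r ux u0.
  by rewrite /weighted (ger0_norm (u0 x)) [_ * phi x ^+ 2]mulrC powR_young_weighted.
have I1 : (\int[leb]_(x in Omega) (`|phi x| `^ q)%:E = 1)%E := phi1.
have I2 : (\int[leb]_(x in Omega) (`|u x| `^ q)%:E = 1)%E.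
  by have := massE Mu; rewrite u1.
move: young; rewrite I1 ge0_integralD//; last first.
- exact: emeasurable_funM.
- by move=> x Ox; rewrite mule_ge0 ?lee_fin// powR_ge0.
- exact: emeasurable_funM.
- by move=> x Ox; rewrite mule_ge0 ?lee_fin.
rewrite !ge0_integralZl_EFin// I2 mule1 => young.
have : (1 <= (q / 2)%:E * (gform phi phi / mu)%:E + (1 - q / 2)%:E)%E.
  apply: le_trans young _; apply: leeD2r.
  by apply: lee_wpmul2l; [rewrite lee_fin|exact: weighted_le].
rewrite -EFinM -EFinD lee_fin addrCA lerDl subr_ge0 ler_pMr ?divr_gt0//.
by rewrite ler_pdivlMr// mul1r.
Qed.

End comparison.

Lemma nonneg_eigenvalue (mu : R) u : approximable u -> (forall x, 0 <= u x) -> 0 < mu ->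
  mass u = 1 -> weak_solution mu u -> mu = lam.
Proof.
move=> au u0 mu0 u1 wu; apply/eqP; rewrite eq_le; apply/andP; split.
  rewrite -lee_fin -lambda1E; apply: le_ereal_inf_tmp => _ [phi [tp M1] <-].
  have [_ _ Lp _ _] := approximable_test s01 q12 oO tp.
  rewrite (gagliardo2_gform Lp) lee_fin; exact: (eigenvalue_le_gform au tp u0 mu0 wu u1 M1).
(* testing the equation with [u] itself *)
have := poincare au.
by rewrite (wu _ au) (pairing_self) u1 powR1 !mulr1.
Qed.

(** * First eigenfunctions *)

Lemma first_eigenfunction_of_energy u : approximable u -> energy u <= min_energy ->
  first_eigenfunction Omega s q u.
Proof.
move=> au eu; have [u1 _] := energy_minimizer au eu.
apply: (weak_eigenfunction lam_gt0 au u1).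
exact: (euler_lagrange au eu).
Qed.

Lemma energy_of_first_eigenfunction v : first_eigenfunction Omega s q v ->
  exists2 c : R, 0 < c &
    approximable (fun x => c * v x) /\ energy (fun x => c * v x) <= min_energy.
Proof.
move=> /(eigenfunction_normalize) [c c0 [ac mc wc]]; exists c => //; split=> //.
exact: (energy_of_weak ac mc wc).
Qed.

Lemma first_eigenfunction_multiple w v : approximable w -> energy w <= min_energy ->
  first_eigenfunction Omega s q v ->
  exists c : R, \forall x \ae leb, v x = c * `|w x|.
Proof.
move=> aw ew /energy_of_first_eigenfunction [c c0 [ac ec]].
have [k _ h] := minimizer_unique aw ac ew ec.
exists (c^-1 * k); apply: filterS h => x h.
by rewrite -mulrA -h mulKf// gt_eqF.
Qed.

Lemma constant_sign_multiple u v (c : R) : (forall x, 0 <= u x) ->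
  (\forall x \ae leb, v x = c * u x) -> constant_sign Omega v.
Proof.
move=> u0 h; case: (lerP 0 c) => c0; [left|right]; apply: filterS h => x -> _.
- exact: mulr_ge0.
- by rewrite mulr_le0_ge0// ltW.
Qed.

Lemma constant_sign_abs v (c : R) : 0 < c -> (forall x, ~ Omega x -> v x = 0) ->
  constant_sign Omega v -> exists2 d : R, d = 1 \/ d = - 1 &
  \forall x \ae leb, `|c * v x| = d * (c * v x).
Proof.
move=> c0 v0 [] h; [exists 1|exists (- 1)]; [by left| |by right|];
  apply: filterS h => x hx; rewrite normrM (gtr0_norm c0);
  have [Ox|/v0->] := pselect (Omega x); rewrite ?normr0 ?mulr0 ?mulr0//.
- by rewrite mul1r ger0_norm ?hx.
- by rewrite mulN1r ler0_norm ?hx// mulrN.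
Qed.

Lemma constant_sign_eigenvalue (mu : R) v : eigenfunction Omega s q mu v ->
  constant_sign Omega v -> mu = lam.
Proof.
move=> ev sv; have [mu0 [_ v0 _] _ _] := ev.
have [c c0 [ac mc wc]] := eigenfunction_normalize ev.
have [d d1 hd] := constant_sign_abs c0 v0 sv.
have wa := weak_solution_abs ac d1 hd wc.
have aa := approximable_abs s01 q12 oO ac.
apply: (nonneg_eigenvalue aa (fun=> normr_ge0 _) mu0 _ wa).
by rewrite -mc; apply: eq_mass => x; rewrite normr_id.
Qed.

End first_eigenvalue.

Theorem theorem1 (R : realType) (N : nat) (s q : R) (Omega : set 'rV[R]_N) :
  (1 <= N)%N -> 0 < s < 1 -> 1 < q < 2 ->
  open Omega -> Omega !=set0 -> (0 < lambda1 Omega s q)%E ->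
  [/\ (exists u : 'rV[R]_N -> R,
         [/\ minimizer Omega s q u,
             gagliardo2 s u = lambda1 Omega s q,
             first_eigenfunction Omega s q u,
             forall v, minimizer Omega s q v ->
               exists c : R, \forall x \ae (@lebesgue_rV R N), v x = c * u x &
             forall v, first_eigenfunction Omega s q v ->
               exists c : R, \forall x \ae (@lebesgue_rV R N), v x = c * u x]),
      (forall u : 'rV[R]_N -> R,
         first_eigenfunction Omega s q u -> constant_sign Omega u) &
      (forall lambda : R,
         (exists u : 'rV[R]_N -> R,
            eigenfunction Omega s q lambda u /\ constant_sign Omega u) <->
         lambda%:E = lambda1 Omega s q)].
Proof.
move=> _ s01 q12 oO O0 lam0.
have [w aw ew] := exists_energy_minimizer s01 q12 oO O0 lam0.
have au := approximable_abs s01 q12 oO aw.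
have eu := le_trans (energy_abs_le s01 q12 oO aw) ew.
have [mu gu] := minimizer_of_energy s01 q12 oO O0 lam0 au eu.
have fu := first_eigenfunction_of_energy s01 q12 oO O0 lam0 au eu.
have multiple v : first_eigenfunction Omega s q v ->
    exists c : R, \forall x \ae (@lebesgue_rV R N), v x = c * `|w x|.
  exact: (first_eigenfunction_multiple s01 q12 oO O0 lam0 aw ew).
have sign v : first_eigenfunction Omega s q v -> constant_sign Omega v.
  by move=> /multiple [c]; apply: constant_sign_multiple => x; exact: normr_ge0.
split=> [|//|lambda].
- exists (fun x => `|w x|); split => // v mv.
  have [av ev] := energy_of_minimizer s01 q12 oO O0 lam0 mv.
  have [c _ h] := minimizer_unique s01 q12 oO O0 lam0 aw av ew ev.
  by exists c.
- rewrite (lambda1E s01 q12 oO O0 lam0); split=> [[u [eigu su]]|[->]].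
    by congr EFin; exact: (constant_sign_eigenvalue s01 q12 oO O0 lam0 eigu su).
  by exists (fun x => `|w x|); split; [exact: fu|exact: sign].
Qed.
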